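(* Let $0<\alpha<1$, $0\le\beta$, $0<h$ and $n,j\in\mathbb{N}_0$. The following properties hold (with $n\in\mathbb{N}$ in (iii) and (iv)): (i) $\displaystyle\varphi^h_{\alpha,\beta}(n,j)=h^\beta\sum_{i=0}^{j}\binom{j}{i}(-1)^i h^{i-\alpha i}k^{\beta-\alpha i}(n)$. (ii) $\displaystyle\varphi^h_{\alpha,\beta+\gamma}(n,j)=h^\beta\sum_{i=0}^{n}k^\beta(n-i)\,\varphi^h_{\alpha,\gamma}(i,j)$ for $\gamma>0$. (iii) $\displaystyle\frac{1}{h^n\Gamma(n)}\int_0^\infty e^{-s/h}s^{n-1}\psi_{\alpha,\beta}(s,t)\,ds=e^{-t/h}\sum_{j=1}^\infty\varphi^h_{\alpha,\beta}(n-1,j-1)\frac{t^{j-1}}{h^j(j-1)!}$ for $t>0$. (iv) $\displaystyle\sum_{j=1}^\infty\varphi^h_{\alpha,\beta}(n-1,j-1)\frac{1}{h^j}\left(\frac1h-\lambda\right)^{-j}=\frac1h\,\mathcal{E}^h_{\alpha,\alpha+\beta}(\lambda,n)$ for $n\in\mathbb{N}$, $|\lambda|<\frac{1}{h^\alpha}$. (v) $\varphi^h_{\alpha,\beta}(n,j)-\varphi^h_{\alpha,\beta}(n,j+1)=h\,\varphi^h_{\alpha,\beta-\alpha}(n,j)$. (vi) $\displaystyle\varphi^h_{\alpha,0}(n,j+1)=\sum_{p=0}^n\varphi^h_{\alpha,0}(n-p,j)\,\varphi^h_{\alpha,0}(p,1)$. (vii) $\varphi^h_{\alpha,\beta}(n,j)\ge0$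 for $0<h\le1$. (viii) $\displaystyle\sum_{i=0}^\infty\varphi^h_{\alpha,0}(i,j)=1$. (ix) $\displaystyle\sum_{j=0}^\infty\varphi^h_{\alpha,\beta}(n,j)\,k^\gamma(j)=h^{\beta+\gamma(\alpha-1)}k^{\beta+\gamma\alpha}(n)$ for $\gamma>0$.
   Context: Here $\mathbb{N}=\{1,2,\dots\}$ and $\mathbb{N}_0=\{0,1,2,\dots\}$. Cesàro numbers: for $\beta\in\mathbb{C}$, $k^\beta(0)=1$ and $k^\beta(n)=\frac{\beta(\beta+1)\cdots(\beta+n-1)}{n!}$ for $n\in\mathbb{N}$; equivalently $(1-z)^{-\beta}=\sum_{n\ge0}k^\beta(n)z^n$ for $|z|<1$. Discrete scaled Wright function: for $0<\alpha<1$, $h>0$, real $\beta$, and $n,j\in\mathbb{N}_0$, $$\varphi^h_{\alpha,\beta}(n,j)=\frac{1}{2\pi i}\int_{\Upsilon}\frac{1}{z^{n+1}}\frac{\left(1-h(\frac{1-z}{h})^{\alpha}\right)^{j}}{(\frac{1-z}{h})^{\beta}}\,dz,$$ where $\Upsilon$ is the positively oriented circle centred at $0$ of radius $r\in(0,1)$ (principal powers; the fraction is holomorphic in $|z|<1$). Scaled Wright function: for $\beta\ge0$, $t>0$, $s\in\mathbb{C}$, $\psi_{\alpha,\beta}(t,s)=t^{\beta-1}W_{-\alpha,\beta}(-st^{-\alpha})$, where $W_{\lambda,\mu}(z)=\sum_{m=0}^\infty\frac{z^m}{m!\,\Gamma(\lambda m+\mu)}$ for $\lambda>-1$, $\mu\ge0$,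 $z\in\mathbb{C}$ (with $1/\Gamma=0$ at the poles of $\Gamma$). Mittag-Leffler sequences: for $\alpha,\beta,h>0$, $n\in\mathbb{N}$ and $\lambda\in\mathbb{C}$ with $|\lambda|<h^{-\alpha}$, $\mathcal{E}^h_{\alpha,\beta}(\lambda,n)=\sum_{j=0}^\infty h^{\alpha j+\beta}k^{\alpha j+\beta}(n-1)\lambda^j$.
   Formalization: As printed, (iv) and (ix) fail for large h, where the series diverge or have undefined terms; (iv) additionally assumes |1−h^{1−α}|<|1−hλ|, and (ix) assumes h^{1−α}<2, or h^{1−α}=2 with n=0 and γ<1. These are exactly the domains of convergence. *)

(* Defs.v *)
From Stdlib Require Import Reals Lra ZArith.
From Coquelicot Require Import Coquelicot.
Open Scope R_scope.

(** Complex functions, principal branches. *)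

Definition Cexp (z : C) : C := (exp (Re z) * cos (Im z), exp (Re z) * sin (Im z)).

(* Principal argument, with values in (-PI, PI]; meaningful for [z <> 0]. *)
Definition Carg (z : C) : R :=
  if Rle_dec 0 (Im z) then acos (Re z / Cmod z) else - acos (Re z / Cmod z).

Definition Cln (z : C) : C := (ln (Cmod z), Carg z).

(* Principal power with real exponent; only meaningful for [z <> 0]. *)
Definition Cpower (z : C) (a : R) : C := Cexp (RtoC a * Cln z)%C.

(* Integral of [f] over the positively oriented circle [|z| = r]. *)
Definition circle_integral (f : C -> C) (r : R) : C :=
  RInt (V := C_R_CompleteNormedModule)
    (fun t : R => let z := (RtoC r * Cexp (Ci * RtoC t))%C in (f z * (Ci * z))%C)
    0 (2 * PI).

(* Meaningful when the series converges (in [C], coordinatewise). *)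
Definition CSeries (a : nat -> C) : C :=
  (Series (fun n => Re (a n)), Series (fun n => Im (a n))).

(** Gamma function: Euler's integral for [0 < x]; its reciprocal is continued
    to all real arguments by [1 / Gamma x = x / Gamma (x + 1)], so that it
    vanishes at [0, -1, -2, ...]. *)

Definition Gamma (x : R) : R :=
  RInt_gen (V := R_CompleteNormedModule) (fun u => Rpower u (x - 1) * exp (- u))
    (at_right 0) (Rbar_locally p_infty).

Fixpoint rGamma_shift (m : nat) (x : R) : R :=
  match m with
  | O => / Gamma x
  | S m' => x * rGamma_shift m' (x + 1)
  end.

(* [up (- x) > - x], hence the Euler integral is used at a point [> 0];
   no shift takes place when [0 < x]. *)
Definition rGamma (x : R) : R := rGamma_shift (Z.to_nat (up (- x))) x.

(** Cesaro numbers [k^b(n)]. *)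

Fixpoint rising (b : C) (n : nat) : C :=
  match n with
  | O => RtoC 1
  | S m => (rising b m * (b + RtoC (INR m)))%C
  end.

Definition cesaro (b : C) (n : nat) : C := (rising b n / RtoC (INR (fact n)))%C.

(** Discrete scaled Wright function; [r] is the radius of the contour. *)

Definition dwright (r h alpha beta : R) (n j : nat) : C :=
  (/ (RtoC (2 * PI) * Ci) *
   circle_integral
     (fun z : C =>
        let w := (RtoC 1 - z) / RtoC h in
        / z ^ (n + 1) *
        ((RtoC 1 - RtoC h * Cpower w alpha) ^ j / Cpower w beta))
     r)%C.

(** Wright function and scaled Wright function. *)

Definition wright (lambda mu : R) (z : C) : C :=
  CSeries (fun m => (z ^ m / RtoC (INR (fact m)) * RtoC (rGamma (lambda * INR m + mu)))%C).

Definition scaled_wright (alpha beta t : R) (s : C) : C :=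
  (RtoC (Rpower t (beta - 1)) * wright (- alpha) beta (- s * RtoC (Rpower t (- alpha))))%C.

(** Mittag-Leffler sequences, for [1 <= n]. *)

Definition mittag_leffler (h alpha beta : R) (lambda : C) (n : nat) : C :=
  CSeries (fun j =>
    (RtoC (Rpower h (alpha * INR j + beta)) *
     cesaro (RtoC (alpha * INR j + beta)) (n - 1) * lambda ^ j)%C).

(** Since [dwright r h alpha beta n j] is the [n]-th Taylor coefficient of
    [(1 - h ((1-z)/h)^alpha)^j ((1-z)/h)^(-beta)], whose base has value
    [q = 1 - h^(1-alpha)] at [z = 0], it equals [q^(j-n)] times a polynomial in
    [j] of exact degree [n] when [q <> 0]. The series
    [sum_j dwright .. (n-1) (j-1) h^(-j) (1/h - lambda)^(-j)] therefore has
    defined terms and converges exactly when [|q| < |1 - h lambda|].  For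
    [h <= 1] this is implied by [|lambda| < 1 / h^alpha]: *)

Lemma resolvent_condition (alpha h : R) (lambda : C) :
  0 < alpha < 1 -> 0 < h <= 1 -> Cmod lambda < 1 / Rpower h alpha ->
  Rabs (1 - Rpower h (1 - alpha)) < Cmod (RtoC 1 - RtoC h * lambda)%C.
Proof.
intros Ha Hh Hl.
assert (Hp : Rpower h (1 - alpha) = h * (1 / Rpower h alpha)).
{ unfold Rminus; rewrite Rpower_plus, Rpower_Ropp, Rpower_1 by lra.
  unfold Rdiv; ring. }
assert (Hle : Rpower h (1 - alpha) <= 1).
{ apply Rle_trans with (Rpower h 0); [|rewrite Rpower_O; lra]; unfold Rpower.
  assert (Hln : ln h <= 0) by (rewrite <- ln_1; apply ln_le; lra).
  destruct (Req_dec (ln h) 0) as [->|Hn].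
  - rewrite !Rmult_0_r; lra.
  - apply Rlt_le, exp_increasing; nra. }
rewrite Rabs_right by lra.
assert (Ht := Cmod_triangle (RtoC 1 - RtoC h * lambda)%C (RtoC h * lambda)%C).
replace (RtoC 1 - RtoC h * lambda + RtoC h * lambda)%C with (RtoC 1) in Ht by ring.
rewrite Cmod_1, Cmod_mult, Cmod_R, (Rabs_right h) in Ht by lra.
assert (h * Cmod lambda < h * (1 / Rpower h alpha))
  by (apply Rmult_lt_compat_l; lra).
lra.
Qed.

(** In the same way [sum_j dwright .. n j k^gamma(j)] converges exactly when
    [|q| < 1], i.e. [h^(1-alpha) < 2], or [q = -1], [n = 0] and [gamma < 1];
    the first alternative always holds for [h <= 1]. *)

(* Main.v *)
Require Import Defs.
From Stdlib Require Import Reals Lra Lia Arith ZArith Factorial.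
From Coquelicot Require Import Coquelicot.
Open Scope R_scope.

(** The number phi(n,j) is the n-th Taylor coefficient at 0 of
[(1 - h w^alpha)^j w^(-beta)], where [w = (1 - z)/h].  With [y = h^(1-alpha)]
this function is [h^beta (1 - y (1-z)^alpha)^j (1-z)^(-beta)], and multiplying
by [1 - y (1-z)^alpha] raises [j] by one: this is the recursion that defines
[dwrightR], a real sequence whose product with [h^beta] is phi.  The only
complex analysis needed is the identification [dwright_eq] of the contour
integral with that sequence.  It reduces to [j = 0], where the partial sums of
[(1-z)^(-b)] converge uniformly on the circle ([binomial_partial_error]) and
are integrated term by term.

From then on everything is a statement about [dwrightR].  Pascal's rule gives
(i) and (v), Vandermonde's convolution gives (ii) and (vi), nonnegativity of
the Taylor coefficients of [1 - y (1-z)^alpha] for [y <= 1] gives (vii), and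
the partial sums over [n] of the coefficients for [b = 0] are the coefficients
for [b = 1], which tend to 1: this is (viii).

The series over [j] in (iv), (ix) and on the right of (iii) are handled by
induction on [n].  Differentiating in [z] expresses [(n+1)] times the
coefficient of index [n+1] through coefficients of index [n] with other values
of [b] ([dwrightR_raise]); since [j] enters linearly and
[(j+1) k^g(j+1) = g k^(g+1)(j)], summation over [j] turns it into a recursion
that closes when [b] and [g] are allowed to vary.  The case [n = 0] is the
binomial or the exponential series.

The hard part is the integral in (iii).  The series of the Wright function
cannot be integrated term by term, because all but a few of its terms fail to
be integrable at 0,
so the behaviour of [g_b(x) = W_{-alpha,b}(-x)] for large [x] is required.  It
follows from positivity: [g_b(x)] is a limit of nonnegative discrete Wright
functions ([wrightR_nonneg]), hence [g_b >= 0] for [b >= 0].  As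
[g_b' = - g_(b-alpha)], the function [g_b] decreases from [1/Gamma(b)] when
[b >= alpha], and [g_(b-1) = (b-1) g_b + alpha x g_(b-alpha)] then bounds
[x g_b(x)] when [b >= 1].  With these bounds, [psi] (the scaled Wright
function) has for [b >= 1] a Laplace transform [L_b], integration by parts
gives [L_b = p L_(b+1)], and Taylor's formula for [g_b] with large [b] shows
that [p^b L_b] differs from the partial sum of order [N] of
[exp(- t p^alpha)] by at most the next term; letting [b] and [N] grow together
gives [L_b = p^(-b) exp(- t p^alpha)] ([laplace_value]).  The weight [s^n] is
added by the identity [s psi_b = b psi_(b+1) + alpha t psi_(b+1-alpha)], which
corresponds to [dwrightR_raise], and one more integration by parts leads from
[b >= 1] to [b >= 0]. *)

(** * Finite sums *)

(* For equalities stated in a carrier that only unfolds to [R] or [C]. *)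
Ltac Rring := match goal with |- @eq _ ?a ?b => change (@eq R a b); ring end.
Ltac Cring := match goal with |- @eq _ ?a ?b => change (@eq C a b); ring end.

Lemma sum_n_RS (a : nat -> R) n : sum_n a (S n) = sum_n a n + a (S n) :> R.
Proof. exact (sum_Sn a n). Qed.

Lemma sum_n_Rshift (a : nat -> R) n :
  sum_n a (S n) = a 0%nat + sum_n (fun i => a (S i)) n :> R.
Proof.
induction n as [|n IH].
- now rewrite sum_n_RS, !sum_O.
- rewrite sum_n_RS, IH, (sum_n_RS (fun i => a (S i))). ring.
Qed.

Lemma sum_n_Rplus (a b : nat -> R) n :
  sum_n (fun i => a i + b i) n = sum_n a n + sum_n b n :> R.
Proof. exact (sum_n_plus a b n). Qed.

Lemma sum_n_Rscal (c : R) (a : nat -> R) n :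
  sum_n (fun i => c * a i) n = c * sum_n a n :> R.
Proof. exact (sum_n_mult_l c a n). Qed.

Lemma sum_n_Rext (a b : nat -> R) n :
  (forall i, (i <= n)%nat -> a i = b i) -> sum_n a n = sum_n b n :> R.
Proof. exact (sum_n_ext_loc a b n). Qed.

Lemma sum_n_Rrev (a : nat -> R) n : sum_n a n = sum_n (fun i => a (n - i)%nat) n :> R.
Proof.
revert a; induction n as [|n IH]; intro a; [now rewrite !sum_O|].
rewrite sum_n_Rshift, sum_n_RS, (IH (fun i => a (S i))), Nat.sub_diag.
rewrite (sum_n_Rext (fun i => a (S (n - i))) (fun i => a (S n - i)%nat)); [ring|].
intros i Hi; f_equal; lia.
Qed.

Lemma sum_n_Rnonneg (a : nat -> R) n :
  (forall i, (i <= n)%nat -> 0 <= a i) -> 0 <= sum_n a n.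
Proof.
induction n as [|n IH]; intro H; [rewrite sum_O; auto|].
rewrite sum_n_RS. apply Rplus_le_le_0_compat; auto.
Qed.

(** * Real Cesaro numbers *)

Fixpoint cesaroR (b : R) (n : nat) : R :=
  match n with
  | O => 1
  | S m => cesaroR b m * (b + INR m) / INR (S m)
  end.

Lemma cesaroR_succ b n :
  INR (S n) * cesaroR b (S n) = (INR n + b) * cesaroR b n.
Proof. cbn [cesaroR]. field. apply not_0_INR; lia. Qed.

(** Coefficient form of [d/dz (1-z)^(-b) = b (1-z)^(-b-1)]. *)
Lemma cesaroR_raise b n :
  INR (S n) * cesaroR b (S n) = b * cesaroR (b + 1) n.
Proof.
induction n as [|n IH].
- rewrite cesaroR_succ; simpl; ring.
- rewrite cesaroR_succ.
  apply Rmult_eq_reg_l with (INR (S n)); [|apply not_0_INR; lia].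
  replace (INR (S n) * ((INR (S n) + b) * cesaroR b (S n)))
    with ((INR (S n) + b) * (INR (S n) * cesaroR b (S n))) by ring.
  replace (INR (S n) * (b * cesaroR (b + 1) (S n)))
    with (b * (INR (S n) * cesaroR (b + 1) (S n))) by ring.
  rewrite IH, cesaroR_succ, S_INR. ring.
Qed.

(** Coefficient form of [(1-z) (1-z)^(-b) = (1-z)^(-(b-1))]. *)
Lemma cesaroR_telescope b n :
  cesaroR b (S n) = cesaroR (b - 1) (S n) + cesaroR b n.
Proof.
apply Rmult_eq_reg_l with (INR (S n)); [|apply not_0_INR; lia].
rewrite Rmult_plus_distr_l, (cesaroR_raise (b - 1)), cesaroR_succ, S_INR.
replace (b - 1 + 1) with b by ring. ring.
Qed.

Lemma cesaroR_0 n : cesaroR 0 (S n) = 0.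
Proof.
apply Rmult_eq_reg_l with (INR (S n)); [|apply not_0_INR; lia].
rewrite cesaroR_raise; ring.
Qed.

Lemma cesaroR_1 n : cesaroR 1 n = 1.
Proof.
induction n as [|n IH]; [reflexivity|].
rewrite cesaroR_telescope, IH. replace (1 - 1) with 0 by ring.
rewrite cesaroR_0; ring.
Qed.

Lemma cesaroR_nonneg b n : 0 <= b -> 0 <= cesaroR b n.
Proof.
intro Hb; induction n as [|n IH]; cbn [cesaroR]; [lra|].
apply Rmult_le_pos.
- apply Rmult_le_pos; [assumption|]. assert (H := pos_INR n); lra.
- apply Rlt_le, Rinv_0_lt_compat, lt_0_INR; lia.
Qed.

Lemma cesaroR_pos b n : 0 < b -> 0 < cesaroR b n.
Proof.
intro Hb; induction n as [|n IH]; cbn [cesaroR]; [lra|].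
apply Rmult_lt_0_compat.
- apply Rmult_lt_0_compat; [assumption|]. assert (H := pos_INR n); lra.
- apply Rinv_0_lt_compat, lt_0_INR; lia.
Qed.

Lemma cesaroR_opp_nonpos a n : 0 <= a <= 1 -> cesaroR (- a) (S n) <= 0.
Proof.
intro Ha; induction n as [|n IH]; [simpl; lra|].
apply Rmult_le_reg_l with (INR (S (S n))); [apply lt_0_INR; lia|].
rewrite cesaroR_succ, Rmult_0_r, S_INR.
assert (H := pos_INR n). nra.
Qed.

(** Both sides satisfy the recursion
    [(n+1) c(n+1) = (n+a+b) c(n)]: on the right, [n+1] is split as the sum of
    the two indices and each part is absorbed by its own factor. *)
Lemma cesaroR_vandermonde a b n :
  cesaroR (a + b) n = sum_n (fun i => cesaroR a (n - i) * cesaroR b i) n.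
Proof.
induction n as [|n IH]; [rewrite sum_O; simpl; ring|].
apply Rmult_eq_reg_l with (INR (S n)); [|apply not_0_INR; lia].
rewrite cesaroR_succ, IH, <- !sum_n_Rscal.
rewrite (sum_n_Rext (fun i => INR (S n) * _)
  (fun i => INR (S n - i) * cesaroR a (S n - i) * cesaroR b i
            + cesaroR a (S n - i) * (INR i * cesaroR b i))).
2:{ intros i Hi. rewrite minus_INR by lia; ring. }
rewrite sum_n_Rplus, (sum_n_RS (fun i => INR (S n - i) * _ * _)), Nat.sub_diag.
rewrite (sum_n_Rshift (fun i => _ * (INR i * _))).
rewrite (sum_n_Rext (fun i => INR (S n - i) * _ * _)
  (fun i => (INR (n - i) + a) * cesaroR a (n - i) * cesaroR b i)).
2:{ intros i Hi. replace (S n - i)%nat with (S (n - i)) by lia.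
    now rewrite cesaroR_succ. }
rewrite (sum_n_Rext (fun i => cesaroR a (S n - S i) * _)
  (fun i => cesaroR a (n - i) * ((INR i + b) * cesaroR b i))).
2:{ intros i Hi. replace (S n - S i)%nat with (n - i)%nat by lia.
    now rewrite cesaroR_succ. }
change (INR 0) with 0. rewrite !Rmult_0_l, Rmult_0_r, Rplus_0_r, Rplus_0_l.
rewrite <- sum_n_Rplus. apply sum_n_Rext; intros i Hi.
rewrite minus_INR by lia. ring.
Qed.

(** * The discrete Wright function as a difference scheme *)

(** The [n]-th Taylor coefficient of
    [(1 - y (1-z)^alpha)^j (1-z)^(-b)].  Multiplication by [(1-z)^alpha] shifts
    [b] by [-alpha], so that [j] counts differences in [b] and no power of a
    power series is needed. *)
Fixpoint dwrightR (alpha y b : R) (j n : nat) : R :=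
  match j with
  | O => cesaroR b n
  | S i => dwrightR alpha y b i n - y * dwrightR alpha y (b - alpha) i n
  end.

Lemma dwrightR_at_0 alpha y b j : dwrightR alpha y b j 0 = (1 - y) ^ j.
Proof.
revert b; induction j as [|j IH]; intro b; simpl; [reflexivity|].
rewrite !IH; ring.
Qed.

(** Coefficient form of the derivative in [z] of
    [(1 - y (1-z)^alpha)^j (1-z)^(-b)]. *)
Lemma dwrightR_raise alpha y b j n :
  INR (S n) * dwrightR alpha y b j (S n) =
  b * dwrightR alpha y (b + 1) j n
  + alpha * y * (INR j * dwrightR alpha y (b + 1 - alpha) (pred j) n).
Proof.
revert b; induction j as [|j IH]; intro b.
- cbn [dwrightR]; change (INR 0) with 0. rewrite cesaroR_raise. ring.
- cbn [dwrightR pred]. rewrite Rmult_minus_distr_l.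
  replace (INR (S n) * (y * dwrightR alpha y (b - alpha) j (S n)))
    with (y * (INR (S n) * dwrightR alpha y (b - alpha) j (S n))) by ring.
  rewrite !IH, (S_INR j). replace (b - alpha + 1) with (b + 1 - alpha) by ring.
  destruct j as [|j]; cbn [pred dwrightR]; [simpl; ring|].
  rewrite S_INR; ring.
Qed.

(** Coefficient form of multiplication by [1-z]. *)
Lemma dwrightR_telescope alpha y b j n :
  dwrightR alpha y b j (S n) = dwrightR alpha y (b - 1) j (S n) + dwrightR alpha y b j n.
Proof.
revert b; induction j as [|j IH]; intro b; cbn [dwrightR].
- apply cesaroR_telescope.
- rewrite (IH b), (IH (b - alpha)). replace (b - alpha - 1) with (b - 1 - alpha) by ring. ring.
Qed.

Lemma dwrightR_vandermonde alpha y a b j n :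
  dwrightR alpha y (a + b) j n = sum_n (fun i => cesaroR a (n - i) * dwrightR alpha y b j i) n.
Proof.
revert b; induction j as [|j IH]; intro b; cbn [dwrightR].
- apply cesaroR_vandermonde.
- replace (a + b - alpha) with (a + (b - alpha)) by ring.
  rewrite !IH.
  replace (_ - y * _) with (sum_n (fun i => cesaroR a (n - i) * dwrightR alpha y b j i) n
    + (- y) * sum_n (fun i => cesaroR a (n - i) * dwrightR alpha y (b - alpha) j i) n) by ring.
  rewrite <- sum_n_Rscal, <- sum_n_Rplus.
  apply sum_n_Rext; intros; ring.
Qed.

(** The factor [1 - y (1-z)^alpha], whose coefficients are
    [dwrightR alpha y 0 1], acts by convolution. *)
Lemma dwrightR_convolution alpha y b j n :
  dwrightR alpha y b (S j) n =
  sum_n (fun i => dwrightR alpha y 0 1 (n - i) * dwrightR alpha y b j i) n.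
Proof.
cbn [dwrightR]. rewrite <- (Rplus_0_l b) at 1.
replace (b - alpha) with (0 - alpha + b) by ring.
rewrite !dwrightR_vandermonde.
replace (_ - y * _) with (sum_n (fun i => cesaroR 0 (n - i) * dwrightR alpha y b j i) n
    + (- y) * sum_n (fun i => cesaroR (0 - alpha) (n - i) * dwrightR alpha y b j i) n) by ring.
rewrite <- sum_n_Rscal, <- sum_n_Rplus.
apply sum_n_Rext; intros; ring.
Qed.

(** For [y <= 1] the coefficients of [1 - y (1-z)^alpha] are
    [1 - y] and [- y k^(-alpha)(n)], all nonnegative, and convolution preserves
    nonnegativity. *)
Lemma dwrightR_nonneg alpha y b j n :
  0 < alpha < 1 -> 0 <= y <= 1 -> 0 <= b -> 0 <= dwrightR alpha y b j n.
Proof.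
intros Ha Hy Hb; revert n; induction j as [|j IH]; intro n.
- now apply cesaroR_nonneg.
- rewrite dwrightR_convolution. apply sum_n_Rnonneg; intros i Hi.
  apply Rmult_le_pos; [|apply IH].
  destruct (n - i)%nat as [|m]; [rewrite dwrightR_at_0; simpl; lra|].
  cbn [dwrightR]. rewrite cesaroR_0.
  assert (H := cesaroR_opp_nonpos alpha m).
  replace (0 - alpha) with (- alpha) by ring. nra.
Qed.

(** Summing coefficients is dividing by [1-z], which raises
    [b] from 0 to 1. *)
Lemma dwrightR_partial_sum alpha y j n :
  sum_n (fun i => dwrightR alpha y 0 j i) n = dwrightR alpha y 1 j n :> R.
Proof.
induction n as [|n IH].
- now rewrite sum_O, !dwrightR_at_0.
- rewrite sum_n_RS, IH, (dwrightR_telescope alpha y 1). replace (1 - 1) with 0 by ring. ring.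
Qed.

(** The boundary case [i = 0] is separated because [Binomial.C]
    has no index [-1]. *)
Lemma binomial_pascal j i : (i <= j)%nat ->
  Binomial.C (S j) i = Binomial.C j i
    + match i with O => 0 | S i' => Binomial.C j i' end.
Proof.
intro H; destruct i as [|i].
- rewrite (pascal_step1 (S j) 0), (pascal_step1 j 0), !Nat.sub_0_r, !C_n_n by lia. ring.
- rewrite <- pascal by lia. ring.
Qed.

Lemma dwrightR_binomial alpha y b j n :
  dwrightR alpha y b j n =
  sum_n (fun i => Binomial.C j i * (- y) ^ i * cesaroR (b - alpha * INR i) n) j :> R.
Proof.
revert b; induction j as [|j IH]; intro b.
- rewrite sum_O, C_n_n. cbn [dwrightR pow INR]. rewrite Rmult_0_r, Rminus_0_r. ring.
- cbn [dwrightR]. rewrite !IH.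
  set (g := fun i => match i with O => 0 | S i' => Binomial.C j i' * (- y) ^ i * cesaroR (b - alpha * INR i) n end).
  assert (Hg : sum_n g (S j) = - y * sum_n
     (fun i => Binomial.C j i * (- y) ^ i * cesaroR (b - alpha - alpha * INR i) n) j :> R).
  { rewrite sum_n_Rshift, <- sum_n_Rscal. unfold g at 1. rewrite Rplus_0_l.
    apply sum_n_Rext; intros i Hi. unfold g. rewrite S_INR.
    replace (b - alpha - alpha * INR i) with (b - alpha * (INR i + 1)) by ring.
    cbn [pow]. ring. }
  rewrite sum_n_RS in Hg. rewrite sum_n_RS.
  rewrite (sum_n_Rext (fun i => Binomial.C (S j) i * _ * _)
    (fun i => Binomial.C j i * (- y) ^ i * cesaroR (b - alpha * INR i) n + g i)).
  2:{ intros i Hi. rewrite binomial_pascal by assumption. unfold g. destruct i; ring. }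
  rewrite sum_n_Rplus. unfold g at 2 in Hg. rewrite C_n_n in *. lra.
Qed.

(** * Real sequences inside the complex numbers *)

Lemma cesaro_RtoC b n : cesaro (RtoC b) n = RtoC (cesaroR b n).
Proof.
unfold cesaro.
assert (H : rising (RtoC b) n = RtoC (cesaroR b n * INR (fact n))).
{ induction n as [|n IH]; [simpl; now rewrite Rmult_1_l|].
  cbn [rising]. rewrite IH, <- RtoC_plus, <- RtoC_mult. f_equal.
  rewrite fact_simpl, mult_INR. cbn [cesaroR]. field. apply not_0_INR; lia. }
rewrite H, <- RtoC_div by apply INR_fact_neq_0. f_equal. field. apply INR_fact_neq_0.
Qed.

Lemma sum_n_RtoC (a : nat -> R) n :
  sum_n (G := C_AbelianMonoid) (fun i => RtoC (a i)) n = RtoC (sum_n a n).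
Proof.
induction n as [|n IH]; [now rewrite !sum_O|].
rewrite sum_Sn, IH, sum_n_RS, RtoC_plus. reflexivity.
Qed.

(** * Principal powers in the right half-plane *)

Lemma Cexp_plus z w : Cexp (z + w) = (Cexp z * Cexp w)%C.
Proof.
destruct z as [a b], w as [c d]. unfold Cexp, Cplus, Cmult; simpl.
rewrite exp_plus, cos_plus, sin_plus. f_equal; ring.
Qed.

Lemma Cexp_0 : Cexp (RtoC 0) = RtoC 1.
Proof. unfold Cexp, RtoC; simpl. now rewrite exp_0, cos_0, sin_0, !Rmult_1_l. Qed.

Lemma Cpower_plus w a b : Cpower w (a + b) = (Cpower w a * Cpower w b)%C.
Proof. unfold Cpower. rewrite <- Cexp_plus. f_equal. rewrite RtoC_plus. ring. Qed.

Lemma Cpower_0 w : Cpower w 0 = RtoC 1.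
Proof. unfold Cpower. rewrite Cmult_0_l. apply Cexp_0. Qed.

Lemma Cpower_opp_mult w a : (Cpower w a * Cpower w (- a))%C = RtoC 1.
Proof. rewrite <- Cpower_plus, Rplus_opp_r. apply Cpower_0. Qed.

Lemma Cpower_neq_0 w a : Cpower w a <> RtoC 0.
Proof.
intro H. assert (E := Cpower_opp_mult w a). rewrite H, Cmult_0_l in E.
apply (f_equal fst) in E; simpl in E; lra.
Qed.

Lemma Cpower_inv w a : (/ Cpower w a)%C = Cpower w (- a).
Proof.
assert (E := Cpower_opp_mult w a). assert (N := Cpower_neq_0 w a).
rewrite <- (Cmult_1_l (Cpower w (- a))), <- (Cinv_l _ N), <- Cmult_assoc, E. ring.
Qed.

Lemma Cmod_Cexp z : Cmod (Cexp z) = exp (Re z).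
Proof.
unfold Cmod, Cexp; simpl.
replace (_ + _) with (exp (Re z) * exp (Re z) * (Rsqr (sin (Im z)) + Rsqr (cos (Im z))))
  by (unfold Rsqr; ring).
rewrite sin2_cos2, Rmult_1_r. apply sqrt_square, Rlt_le, exp_pos.
Qed.

Lemma Cmod_Cpower w a : Cmod (Cpower w a) = exp (a * ln (Cmod w)).
Proof. unfold Cpower. rewrite Cmod_Cexp. f_equal. unfold Cln; simpl. ring. Qed.

(** The two branches of the argument agree with a single smooth
    formula in the right half-plane, where all powers below are taken. *)
Lemma Carg_right_half x v : 0 < x -> Carg (x, v) = atan (v / x).
Proof.
intro Hx. unfold Carg. cbn [Re Im fst snd].
set (m := Cmod (x, v)).
assert (Hm : 0 < m).
{ apply Cmod_gt_0. intro E. apply (f_equal fst) in E. simpl in E. lra. }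
assert (Hm2 : m * m = x * x + v * v).
{ unfold m, Cmod; simpl. rewrite sqrt_sqrt; nra. }
assert (Hq : 0 < x / m) by now apply Rdiv_lt_0_compat.
assert (E : acos (x / m) = atan (Rabs v / x)).
{ rewrite acos_atan by assumption. f_equal.
  replace (1 - (x / m)²) with ((v / m)²).
  2:{ unfold Rsqr. field_simplify; try lra. replace (m ^ 2) with (x * x + v * v) by (rewrite <- Hm2; ring). field.
      nra. }
  rewrite sqrt_Rsqr_abs, Rabs_div by lra. rewrite (Rabs_right m) by lra. field; lra. }
rewrite E. destruct (Rle_dec 0 v) as [Hv|Hv].
- now rewrite Rabs_right by lra.
- rewrite Rabs_left by lra. rewrite <- atan_opp. f_equal. field; lra.
Qed.

Lemma Cpower_right_half x v a : 0 < x ->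
  Cpower (x, v) a = (exp (a * (ln (x * x + v * v) / 2)) * cos (a * atan (v / x)),
                     exp (a * (ln (x * x + v * v) / 2)) * sin (a * atan (v / x))).
Proof.
intro Hx. unfold Cpower, Cexp, Cln. rewrite Carg_right_half by assumption. cbn [Re Im fst snd Cmult RtoC].
assert (E : ln (Cmod (x, v)) = ln (x * x + v * v) / 2).
{ assert (H : 0 < x * x + v * v) by nra.
  unfold Cmod; simpl. rewrite !Rmult_1_r.
  rewrite <- (sqrt_sqrt (x * x + v * v)) at 2 by lra.
  rewrite ln_mult by (apply sqrt_lt_R0; lra). lra. }
rewrite E.
replace (a * (ln (x * x + v * v) / 2) - 0 * atan (v / x)) with (a * (ln (x * x + v * v) / 2)) by ring.
replace (a * atan (v / x) + 0 * (ln (x * x + v * v) / 2)) with (a * atan (v / x)) by ring.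
reflexivity.
Qed.

(** Dividing by a positive number does not change the argument. *)
Lemma Cpower_scale w h a : 0 < h -> 0 < Re w ->
  Cpower (w / RtoC h) a = (RtoC (Rpower h (- a)) * Cpower w a)%C.
Proof.
intros Hh Hw. destruct w as [x v]; cbn [Re fst] in Hw.
replace ((x, v) / RtoC h)%C with ((x / h, v / h) : C).
2:{ unfold Cdiv. rewrite <- RtoC_inv by lra. unfold Cmult, RtoC; simpl. f_equal; field; lra. }
assert (Hp : 0 < x / h) by now apply Rdiv_lt_0_compat.
rewrite !Cpower_right_half by assumption.
replace (v / h / (x / h)) with (v / x) by (field; lra).
assert (E : ln (x / h * (x / h) + v / h * (v / h)) / 2 = - ln h + ln (x * x + v * v) / 2).
{ replace (x / h * (x / h) + v / h * (v / h)) with ((x * x + v * v) * (/ h * / h)) by (field; lra).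
  assert (0 < / h) by now apply Rinv_0_lt_compat.
  rewrite !ln_mult, ln_Rinv by nra. lra. }
rewrite E. unfold Rpower, Cmult, RtoC; simpl.
replace (a * (- ln h + ln (x * x + v * v) / 2)) with (- a * ln h + a * (ln (x * x + v * v) / 2)) by ring.
rewrite exp_plus. f_equal; ring.
Qed.

(** [auto_derive] leaves derivatives of unknown functions in this
    eta-expanded form. *)
Lemma Derive_eta (f : R -> R) (x l : R) :
  is_derive f x l -> Derive (fun y : R => f y) x = l.
Proof. exact (is_derive_unique f x l). Qed.

Definition is_Cderive (f : R -> C) (x : R) (l : C) : Prop :=
  is_derive (fun u => fst (f u)) x (fst l) /\ is_derive (fun u => snd (f u)) x (snd l).

Lemma is_Cderive_ext f g x l :
  (forall u, f u = g u) -> is_Cderive f x l -> is_Cderive g x l.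
Proof.
intros E [H1 H2]; split.
- apply is_derive_ext with (2 := H1); intro; now rewrite E.
- apply is_derive_ext with (2 := H2); intro; now rewrite E.
Qed.

Lemma is_Cderive_plus f g x l m :
  is_Cderive f x l -> is_Cderive g x m ->
  is_Cderive (fun u => f u + g u)%C x (l + m)%C.
Proof.
intros [H1 H2] [H3 H4]; split.
- exact (is_derive_plus _ _ x _ _ H1 H3).
- exact (is_derive_plus _ _ x _ _ H2 H4).
Qed.

Lemma is_Cderive_mult f g x l m :
  is_Cderive f x l -> is_Cderive g x m ->
  is_Cderive (fun u => f u * g u)%C x (l * g x + f x * m)%C.
Proof.
intros [H1 H2] [H3 H4].
assert (M := fun (p q : R -> R) (p' q' : R) (Hp : is_derive p x p') (Hq : is_derive q x q') =>
  is_derive_mult p q x p' q' Hp Hq Rmult_comm).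
split; simpl.
- evar_last; [exact (is_derive_minus _ _ x _ _ (M _ _ _ _ H1 H3) (M _ _ _ _ H2 H4))|].
  unfold minus, plus, mult, opp; simpl. ring.
- evar_last; [exact (is_derive_plus _ _ x _ _ (M _ _ _ _ H1 H4) (M _ _ _ _ H2 H3))|].
  unfold minus, plus, mult, opp; simpl. ring.
Qed.

Lemma is_Cderive_RtoC_mult (f : R -> R) (c : C) x l :
  is_derive f x l -> is_Cderive (fun u => RtoC (f u) * c)%C x (RtoC l * c)%C.
Proof.
intro H; split; cbn [fst snd Cmult RtoC].
- auto_derive; [now exists l|]. rewrite (Derive_eta f x _ H). ring.
- auto_derive; [now exists l|]. rewrite (Derive_eta f x _ H). ring.
Qed.

(** The logarithmic derivative of the principal power along a
    curve [w] is [a w'/w]: its real part is the derivative of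
    [a ln |w|] and its imaginary part that of [a arg w]. *)
Lemma is_Cderive_Cpower (x v : R -> R) (u x' v' a : R) :
  0 < x u -> is_derive x u x' -> is_derive v u v' ->
  is_Cderive (fun s => (exp (a * (ln (x s * x s + v s * v s) / 2)) * cos (a * atan (v s / x s)),
                     exp (a * (ln (x s * x s + v s * v s) / 2)) * sin (a * atan (v s / x s)))) u
    (RtoC a * Cpower (x u, v u) a * ((x', v') / (x u, v u)))%C.
Proof.
intros Hx Dx Dv.
assert (H : 0 < x u * x u + v u * v u) by nra.
rewrite Cpower_right_half by assumption.
assert (Hw : (((x', v') : C) / (x u, v u))%C =
  ((x u * x' + v u * v') / (x u * x u + v u * v u),
   (v' * x u - v u * x') / (x u * x u + v u * v u))).
{ unfold Cdiv, Cinv, Cmult; simpl. f_equal; field; lra. }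
rewrite Hw.
assert (L : is_derive (fun s => a * (ln (x s * x s + v s * v s) / 2)) u
   (a * ((x u * x' + v u * v') / (x u * x u + v u * v u)))).
{ auto_derive.
  - repeat split; try lra; eexists; eassumption.
  - rewrite (Derive_eta x u _ Dx), (Derive_eta v u _ Dv). field; lra. }
assert (T : is_derive (fun s => a * atan (v s / x s)) u
   (a * ((v' * x u - v u * x') / (x u * x u + v u * v u)))).
{ auto_derive.
  - repeat split; try lra; eexists; eassumption.
  - rewrite (Derive_eta x u _ Dx), (Derive_eta v u _ Dv). field. split; lra. }
set (l := fun s => a * (ln (x s * x s + v s * v s) / 2)) in *.
set (t := fun s => a * atan (v s / x s)) in *.
split; cbn [fst snd].
- apply is_derive_ext with (fun s => exp (l s) * cos (t s)); [reflexivity|].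
  auto_derive; [repeat split; eexists; eassumption|].
  rewrite (Derive_eta l u _ L), (Derive_eta t u _ T).
  unfold Cmult, RtoC; cbn [fst snd]. unfold l, t. ring.
- apply is_derive_ext with (fun s => exp (l s) * sin (t s)); [reflexivity|].
  auto_derive; [repeat split; eexists; eassumption|].
  rewrite (Derive_eta l u _ L), (Derive_eta t u _ T).
  unfold Cmult, RtoC; cbn [fst snd]. unfold l, t. ring.
Qed.

(** * The binomial series with an explicit error term *)

Lemma sum_n_CS (a : nat -> C) n :
  sum_n (G := C_AbelianMonoid) a (S n) = (sum_n (G := C_AbelianMonoid) a n + a (S n))%C :> C.
Proof. exact (sum_Sn a n). Qed.

(** The mean value theorem for [g - f]: comparing with a function [g]
    of known derivative keeps the gain [r^(J+1)/(J+1)] of an integration,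
    without integrals. *)
Lemma increment_le (f g f' g' : R -> R) r : 0 <= r ->
  (forall u, 0 <= u <= r -> is_derive f u (f' u)) ->
  (forall u, 0 <= u <= r -> is_derive g u (g' u)) ->
  (forall u, 0 <= u <= r -> f' u <= g' u) ->
  f r - f 0 <= g r - g 0.
Proof.
intros Hr Df Dg Hle.
destruct (MVT_gen (fun u => g u - f u) 0 r (fun u => g' u - f' u)) as [c [Hc E]].
- rewrite Rmin_left, Rmax_right by lra. intros u Hu.
  apply (is_derive_minus g f u (g' u) (f' u)); [apply Dg|apply Df]; lra.
- rewrite Rmin_left, Rmax_right by lra. intros u Hu.
  apply continuity_pt_filterlim, (ex_derive_continuous (fun u => g u - f u)).
  exists (g' u - f' u). apply (is_derive_minus g f u (g' u) (f' u)); [apply Dg|apply Df]; lra.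
- rewrite Rmin_left, Rmax_right in Hc by lra. specialize (Hle c Hc). nra.
Qed.

Lemma increment_abs_le (f g f' g' : R -> R) r : 0 <= r ->
  (forall u, 0 <= u <= r -> is_derive f u (f' u)) ->
  (forall u, 0 <= u <= r -> is_derive g u (g' u)) ->
  (forall u, 0 <= u <= r -> Rabs (f' u) <= g' u) ->
  Rabs (f r - f 0) <= g r - g 0.
Proof.
intros Hr Df Dg Hle. apply Rabs_le; split.
- assert (H := increment_le (fun u => - f u) g (fun u => - f' u) g' r Hr).
  simpl in H. assert (- f r - - f 0 <= g r - g 0); [|lra].
  apply H; [|assumption|].
  + intros u Hu. exact (is_derive_opp f u (f' u) (Df u Hu)).
  + intros u Hu. specialize (Hle u Hu). apply Rabs_le_between in Hle. lra.
- apply (increment_le f g f' g'); try assumption.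
  intros u Hu. specialize (Hle u Hu). apply Rabs_le_between in Hle. lra.
Qed.

Lemma Cmod_le_components z : Cmod z <= Rabs (fst z) + Rabs (snd z).
Proof.
destruct z as [a b]; cbn [fst snd].
replace ((a, b) : C) with (RtoC a + Ci * RtoC b)%C.
2:{ unfold Cplus, Cmult, RtoC, Ci; simpl. f_equal; ring. }
eapply Rle_trans; [apply Cmod_triangle|].
rewrite Cmod_mult, !Cmod_R. replace (Cmod Ci) with 1; [lra|].
unfold Cmod, Ci; simpl. replace (0 * _ + _) with 1 by ring. now rewrite sqrt_1.
Qed.

Lemma snd_le_Cmod z : Rabs (snd z) <= Cmod z.
Proof. eapply Rle_trans; [|apply Rmax_Cmod]. apply Rmax_r. Qed.

Lemma fst_le_Cmod z : Rabs (fst z) <= Cmod z.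
Proof. exact (re_le_Cmod z). Qed.

Definition binomial_partial (b : R) (J : nat) (z : C) : C :=
  sum_n (G := C_AbelianMonoid) (fun j => RtoC (cesaroR b j) * z ^ j)%C J.

(** The polynomial [S] of degree [J] satisfies the
    differential equation [(1-z) S' = b S] of [(1-z)^(-b)] up to the single
    monomial in which its last coefficient is left over. *)
Lemma binomial_partial_derive b z0 (u : R) J :
  exists D : C,
    is_Cderive (fun s => binomial_partial b J (RtoC s * z0)%C) u D /\
    ((1 - RtoC u * z0) * D =
     RtoC b * z0 * binomial_partial b J (RtoC u * z0)
     - RtoC ((b + INR J) * cesaroR b J * u ^ J) * z0 ^ (S J))%C.
Proof.
induction J as [|J [D [H E]]].
- exists (RtoC 0). split.
  + apply is_Cderive_ext with (fun _ => RtoC 1).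
    * intro s. unfold binomial_partial. rewrite sum_O. simpl. ring.
    * split; simpl; apply @is_derive_const.
  + unfold binomial_partial. rewrite sum_O. cbn [cesaroR INR pow Cpow].
    rewrite Rplus_0_r, !Rmult_1_r. ring.
- exists (D + RtoC ((INR J + b) * cesaroR b J * u ^ J) * z0 ^ (S J))%C. split.
  + apply is_Cderive_ext with (fun s => binomial_partial b J (RtoC s * z0)
      + RtoC (cesaroR b (S J) * s ^ (S J)) * z0 ^ (S J))%C.
    * intro s. unfold binomial_partial. rewrite sum_n_CS. f_equal.
      rewrite Cpow_mult_l, <- RtoC_pow, RtoC_mult. ring.
    * apply is_Cderive_plus; [exact H|]. apply is_Cderive_RtoC_mult.
      rewrite <- cesaroR_succ. generalize (cesaroR b (S J)); intro c.
      auto_derive; [easy|]. simpl. ring.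
  + assert (E2 : binomial_partial b (S J) (RtoC u * z0) =
       (binomial_partial b J (RtoC u * z0) + RtoC (cesaroR b (S J) * u ^ (S J)) * z0 ^ (S J))%C).
    { unfold binomial_partial. rewrite sum_n_CS. f_equal.
      rewrite Cpow_mult_l, <- RtoC_pow, RtoC_mult. ring. }
    rewrite E2, Cmult_plus_distr_l, E.
    replace (RtoC ((b + INR (S J)) * cesaroR b (S J) * u ^ S J))
      with (RtoC b * RtoC (cesaroR b (S J) * u ^ S J) + RtoC u * RtoC ((INR J + b) * cesaroR b J * u ^ J))%C.
    2:{ rewrite <- cesaroR_succ, <- !RtoC_mult, <- RtoC_plus. f_equal. cbn [pow]. ring. }
    rewrite (Rplus_comm b (INR J)), !Cpow_S. ring.
Qed.

Lemma exp_mult_le a l L : Rabs l <= L -> exp (a * l) <= exp (Rabs a * L).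
Proof.
intro H. assert (a * l <= Rabs a * L).
{ eapply Rle_trans; [apply Rle_abs|]. rewrite Rabs_mult.
  apply Rmult_le_compat_l; [apply Rabs_pos|assumption]. }
destruct (Req_dec (a * l) (Rabs a * L)) as [->|N]; [lra|].
apply Rlt_le, exp_increasing; lra.
Qed.

(** The function [u |-> (1 - u z0)^b S(u z0)] starts at 1,
    and by [binomial_partial_derive] its derivative consists of the left-over
    monomial times [(1 - u z0)^(b-1)]; integrating along the ray gives the error.
    The point [z = -1] of the unit circle is within reach, since only the
    distance of the ray to 1 matters: this is where the boundary case of the
    summation over [j] comes from. *)
Lemma binomial_partial_error b z0 r d J :
  Cmod z0 = 1 -> 0 <= r <= 1 -> 0 < d <= 1 ->
  (forall u, 0 <= u <= r -> d <= 1 - u * fst z0) ->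
  let L := ln 2 - ln d in
  Cmod (binomial_partial b J (RtoC r * z0)
        - Cpower (1 - RtoC r * z0) (- b))%C
  <= exp (Rabs b * L) * (2 * exp (Rabs (b - 1) * L)) * (Rabs (cesaroR b (S J)) * r ^ S J).
Proof.
intros Hz Hr Hd Hx L.
set (w := fun u : R => (1 - RtoC u * z0)%C).
assert (Ew : forall u, w u = (1 - u * fst z0, - u * snd z0)).
{ intro u. unfold w, RtoC, Cminus, Cplus, Copp, Cmult; simpl. f_equal; ring. }
assert (HL : forall u, 0 <= u <= r -> Rabs (ln (Cmod (w u))) <= L).
{ intros u Hu.
  assert (B1 : d <= Cmod (w u)).
  { eapply Rle_trans; [apply (Hx u Hu)|]. eapply Rle_trans; [apply Rle_abs|].
    replace (1 - u * fst z0) with (fst (w u)) by now rewrite Ew. apply fst_le_Cmod. }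
  assert (B2 : Cmod (w u) <= 2).
  { unfold w. eapply Rle_trans; [apply Cmod_triangle|].
    rewrite Cmod_1, Cmod_opp, Cmod_mult, Hz, Cmod_R, Rabs_right by lra. lra. }
  assert (ln d <= ln (Cmod (w u))) by (apply ln_le; lra).
  assert (ln (Cmod (w u)) <= ln 2) by (apply ln_le; lra).
  assert (ln d <= 0) by (rewrite <- ln_1; apply ln_le; lra).
  assert (0 < ln 2) by (rewrite <- ln_1; apply ln_increasing; lra).
  unfold L. apply Rabs_le; lra. }
assert (Hw : forall u, 0 <= u <= r -> w u <> RtoC 0).
{ intros u Hu E. rewrite Ew in E. apply (f_equal fst) in E. simpl in E. specialize (Hx u Hu). lra. }
set (U := fun u => (Cpower (w u) b * binomial_partial b J (RtoC u * z0))%C).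
set (K := exp (Rabs (b - 1) * L) * (Rabs (b + INR J) * Rabs (cesaroR b J))).
(* [P] is [Cpower (w u) b] by the formula of the right half-plane, which can be
   differentiated for every [u]. *)
set (P := fun u : R =>
  (exp (b * (ln ((1 - u * fst z0) * (1 - u * fst z0) + (- u * snd z0) * (- u * snd z0)) / 2))
     * cos (b * atan ((- u * snd z0) / (1 - u * fst z0))),
   exp (b * (ln ((1 - u * fst z0) * (1 - u * fst z0) + (- u * snd z0) * (- u * snd z0)) / 2))
     * sin (b * atan ((- u * snd z0) / (1 - u * fst z0)))) : C).
set (V := fun u => (P u * binomial_partial b J (RtoC u * z0))%C).
assert (EV : forall u, 0 <= u <= r -> V u = U u).
{ intros u Hu. unfold U, V. f_equal. rewrite Ew, Cpower_right_half; [reflexivity|].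
  specialize (Hx u Hu). lra. }
assert (DV : forall u, 0 <= u <= r -> exists l, is_Cderive V u l /\ Cmod l <= K * u ^ J).
{ intros u Hu. destruct (binomial_partial_derive b z0 u J) as [D [HD E]].
  assert (Hxu := Hx u Hu).
  assert (HP : is_Cderive P u (RtoC b * Cpower (w u) b * (- z0 / w u))%C).
  { assert (HH := is_Cderive_Cpower (fun u => 1 - u * fst z0) (fun u => - u * snd z0) u
       (- fst z0) (- snd z0) b).
    cbv beta in HH. rewrite <- Ew in HH. 
    replace (- z0)%C with ((- fst z0, - snd z0) : C) by (destruct z0; reflexivity).
    apply HH; [lra| |]; auto_derive; try easy; ring. }
  eexists. split; [exact (is_Cderive_mult _ _ _ _ _ HP HD)|].
  replace (P u) with (Cpower (w u) b).
  2:{ rewrite Ew, Cpower_right_half by lra. reflexivity. }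
  replace (_ + _)%C with (Cpower (w u) b * / w u *
     (- RtoC ((b + INR J) * cesaroR b J * u ^ J) * z0 ^ (S J)))%C.
  2:{ replace (- RtoC ((b + INR J) * cesaroR b J * u ^ J) * z0 ^ S J)%C
        with (w u * D - RtoC b * z0 * binomial_partial b J (RtoC u * z0))%C
        by (unfold w; rewrite E; ring).
      field. now apply Hw. }
  rewrite !Cmod_mult, Cmod_opp, Cmod_pow, Hz, pow1, Rmult_1_r, Cmod_R, Cmod_inv by now apply Hw.
  rewrite Cmod_Cpower, !Rabs_mult, (Rabs_right (u ^ J)) by (apply Rle_ge, pow_le; lra).
  assert (HM : 0 < Cmod (w u)) by (apply Cmod_gt_0, Hw; assumption).
  rewrite <- (exp_ln (Cmod (w u))) at 2 by assumption.
  rewrite <- exp_Ropp, <- exp_plus.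
  replace (b * ln (Cmod (w u)) + - ln (Cmod (w u))) with ((b - 1) * ln (Cmod (w u))) by ring.
  unfold K. rewrite (Rmult_assoc (exp (Rabs (b - 1) * L))). apply Rmult_le_compat.
  - apply Rlt_le, exp_pos.
  - repeat apply Rmult_le_pos; try apply Rabs_pos. apply pow_le; lra.
  - apply exp_mult_le. now apply HL.
  - lra. }
set (G := fun u : R => K * (u ^ S J / INR (S J))).
assert (HJ : INR (S J) <> 0) by (apply not_0_INR; lia).
assert (DG : forall u, is_derive G u (K * u ^ J)).
{ intro u. unfold G. auto_derive; [easy|]. cbn [Nat.pred]. field. assumption. }
assert (G0 : G r - G 0 = K * (r ^ S J / INR (S J))).
{ unfold G. rewrite pow_i by lia. field. assumption. }
assert (V0 : V 0 = RtoC 1).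
{ rewrite EV by lra. unfold U. rewrite Ew. 
  replace ((1 - 0 * fst z0, - 0 * snd z0) : C) with ((1, 0) : C) by (f_equal; ring).
  rewrite Cpower_right_half by lra.
  replace (1 * 1 + 0 * 0) with 1 by ring. rewrite ln_1. replace (b * (0 / 2)) with 0 by field.
  replace (0 / 1) with 0 by field. rewrite atan_0, Rmult_0_r, exp_0, cos_0, sin_0.
  replace (RtoC 0 * z0)%C with (RtoC 0) by ring.
  replace (binomial_partial b J (RtoC 0)) with (RtoC 1).
  - unfold Cmult, RtoC; simpl. f_equal; ring.
  - clear. unfold binomial_partial. induction J as [|J IH].
    + rewrite sum_O. simpl. ring.
    + rewrite sum_n_CS, <- IH. rewrite Cpow_S. ring. }
assert (HV : Cmod (V r - 1)%C <= 2 * (K * (r ^ S J / INR (S J)))).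
{ eapply Rle_trans; [apply Cmod_le_components|].
  replace (2 * (K * (r ^ S J / INR (S J)))) with ((G r - G 0) + (G r - G 0)) by (rewrite G0; ring).
  apply Rplus_le_compat.
  - replace (fst (V r - 1)%C) with (fst (V r) - fst (V 0)) by (rewrite V0; simpl; ring).
    apply (increment_abs_le (fun u => fst (V u)) G (Derive (fun u => fst (V u))) (fun u => K * u ^ J)); [lra| |auto|].
    + intros u Hu. destruct (DV u Hu) as [l [[H1 _] _]]. apply Derive_correct. now exists (fst l).
    + intros u Hu. destruct (DV u Hu) as [l [[H1 _] H2]].
      replace (Derive _ u) with (fst l) by (symmetry; apply is_derive_unique; exact H1).
      eapply Rle_trans; [apply fst_le_Cmod|exact H2].
  - replace (snd (V r - 1)%C) with (snd (V r) - snd (V 0)) by (rewrite V0; simpl; ring).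
    apply (increment_abs_le (fun u => snd (V u)) G (Derive (fun u => snd (V u))) (fun u => K * u ^ J)); [lra| |auto|].
    + intros u Hu. destruct (DV u Hu) as [l [[_ H1] _]]. apply Derive_correct. now exists (snd l).
    + intros u Hu. destruct (DV u Hu) as [l [[_ H1] H2]].
      replace (Derive _ u) with (snd l) by (symmetry; apply is_derive_unique; exact H1).
      eapply Rle_trans; [apply snd_le_Cmod|exact H2]. }
rewrite EV in HV by lra.
replace (_ - _)%C with (Cpower (w r) (- b) * (U r - 1))%C.
2:{ unfold U. fold (w r). 
    transitivity (Cpower (w r) b * Cpower (w r) (- b) * binomial_partial b J (RtoC r * z0) - Cpower (w r) (- b))%C; [ring|].
    rewrite Cpower_opp_mult. ring. }
rewrite Cmod_mult, Cmod_Cpower, Rmult_assoc. apply Rmult_le_compat.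
- apply Rlt_le, exp_pos.
- apply Cmod_ge_0.
- rewrite <- (Rabs_Ropp b). apply exp_mult_le, HL; lra.
- eapply Rle_trans; [exact HV|]. unfold K. right.
  assert (EE : Rabs (cesaroR b (S J)) = Rabs (b + INR J) * Rabs (cesaroR b J) / INR (S J)).
  { cbn [cesaroR]. unfold Rdiv. rewrite !Rabs_mult, Rabs_inv, (Rabs_right (INR (S J))).
    - ring.
    - apply Rle_ge, pos_INR. }
  rewrite EE. field. assumption.
Qed.

Lemma is_lim_seq_inv_S : is_lim_seq (fun n => / INR (S n)) 0.
Proof.
apply (is_lim_seq_incr_1 (fun n => / INR n)).
apply (is_lim_seq_inv _ p_infty); [apply is_lim_seq_INR|discriminate].
Qed.

Lemma cesaroR_abs_le b B n : Rabs b <= B -> Rabs (cesaroR b n) <= cesaroR B n.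
Proof.
intro H. induction n as [|n IH]; cbn [cesaroR]; [rewrite Rabs_R1; lra|].
unfold Rdiv. rewrite !Rabs_mult, Rabs_inv, (Rabs_right (INR (S n))) by apply Rle_ge, pos_INR.
apply Rmult_le_compat_r.
- apply Rlt_le, Rinv_0_lt_compat, lt_0_INR; lia.
- apply Rmult_le_compat; try apply Rabs_pos; [assumption|].
  eapply Rle_trans; [apply Rabs_triang|].
  rewrite (Rabs_right (INR n)) by apply Rle_ge, pos_INR. lra.
Qed.

(** The ratio test, applied to the positive majorant
    [k^B(n) p^n] with [B > |b|] and [p] between [r] and 1. *)
Lemma ex_series_cesaroR_geom b r : 0 <= r < 1 -> ex_series (fun n => Rabs (cesaroR b n) * r ^ n).
Proof.
intro Hr. set (B := Rabs b + 1). set (p := (1 + r) / 2).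
assert (HB : 0 < B) by (assert (H := Rabs_pos b); unfold B; lra).
apply (ex_series_le (fun n => Rabs (cesaroR b n) * r ^ n) (fun n => Rabs (cesaroR B n * p ^ n))).
- intro n. unfold norm; simpl; unfold abs; simpl.
  rewrite !Rabs_mult, Rabs_Rabsolu.
  apply Rmult_le_compat; try apply Rabs_pos.
  + rewrite (Rabs_right (cesaroR B n)) by (apply Rle_ge, cesaroR_nonneg; lra).
    apply cesaroR_abs_le. unfold B; lra.
  + rewrite !Rabs_right by (apply Rle_ge, pow_le; unfold p; lra).
    apply pow_incr. unfold p; lra.
- apply ex_series_DAlembert with p; [unfold p; lra| |].
  + intro n. apply Rmult_integral_contrapositive_currified.
    * apply Rgt_not_eq, cesaroR_pos, HB.
    * apply pow_nonzero. unfold p; lra.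
  + apply is_lim_seq_ext with (fun n => p + p * (B - 1) * / INR (S n)).
    * intro n. assert (H := cesaroR_pos B n HB). assert (Hp : 0 < p ^ n) by (apply pow_lt; unfold p; lra).
      assert (Hn : 0 < INR (S n)) by (apply lt_0_INR; lia).
      assert (Hn0 := pos_INR n).
      replace (cesaroR B (S n) * p ^ S n / (cesaroR B n * p ^ n)) with (p * ((B + INR n) / INR (S n))).
      2:{ cbn [cesaroR pow]. field. lra. }
      rewrite Rabs_right.
      -- rewrite S_INR in *. field. lra.
      -- apply Rle_ge, Rmult_le_pos; [unfold p; lra|].
         apply Rmult_le_pos; [lra|]. apply Rlt_le, Rinv_0_lt_compat, Hn.
    * evar_last.
      -- apply is_lim_seq_plus'; [apply is_lim_seq_const|].
         apply (is_lim_seq_scal_l _ (p * (B - 1)) 0), is_lim_seq_inv_S.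
      -- simpl. f_equal. ring.
Qed.

Lemma cesaroR_geom_lim b r : 0 <= r < 1 -> is_lim_seq (fun n => Rabs (cesaroR b n) * r ^ n) 0.
Proof. intro Hr. now apply ex_series_lim_0, ex_series_cesaroR_geom. Qed.

(** * The contour integral *)

Lemma Cexp_Ci t : Cexp (Ci * RtoC t) = (cos t, sin t).
Proof.
unfold Cexp, Ci, RtoC, Cmult; simpl.
replace (0 * t - 1 * 0) with 0 by ring. replace (0 * 0 + 1 * t) with t by ring.
rewrite exp_0. f_equal; ring.
Qed.

Lemma unit_pow t n : (((cos t, sin t) : C) ^ n)%C = (cos (INR n * t), sin (INR n * t)).
Proof.
induction n as [|n IH].
- simpl. rewrite Rmult_0_l, cos_0, sin_0. reflexivity.
- rewrite Cpow_S, IH, S_INR, Rmult_plus_distr_r, Rmult_1_l, cos_plus, sin_plus.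
  unfold Cmult; simpl. f_equal; ring.
Qed.

Lemma unit_inv u : (/ ((cos u, sin u) : C))%C = (cos u, - sin u).
Proof.
unfold Cinv; simpl. assert (H := sin2_cos2 u). unfold Rsqr in H.
replace (cos u * (cos u * 1) + sin u * (sin u * 1)) with 1 by lra. f_equal; field.
Qed.

Lemma Cmod_unit t : Cmod (cos t, sin t) = 1.
Proof.
unfold Cmod; simpl. assert (H := sin2_cos2 t). unfold Rsqr in H.
replace (cos t * (cos t * 1) + sin t * (sin t * 1)) with 1 by lra. apply sqrt_1.
Qed.

Lemma unit_neq_0 t : ((cos t, sin t) : C) <> RtoC 0.
Proof. intro E. assert (H := Cmod_unit t). rewrite E, Cmod_0 in H. lra. Qed.

(** Orthogonality of the exponentials on the circle. *)
Lemma is_RInt_exp_mode (j n : nat) (k : R) :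
  is_RInt (V := C_R_NormedModule)
    (fun t => (- (k * sin ((INR j - INR n) * t)), k * cos ((INR j - INR n) * t)) : C) 0 (2 * PI)
    ((0, if Nat.eq_dec j n then k * (2 * PI) else 0) : C).
Proof.
apply (is_RInt_fct_extend_pair (U := R_NormedModule) (V := R_NormedModule)); cbn [fst snd].
- destruct (Nat.eq_dec j n) as [->|N].
  + apply is_RInt_ext with (fun _ => 0).
    * intros t _. rewrite Rminus_diag, Rmult_0_l, sin_0. Rring.
    * evar_last; [apply @is_RInt_const|]. unfold scal; simpl; unfold mult; simpl. Rring.
  + set (m := INR j - INR n).
    assert (Hm : m <> 0) by (intro E; apply N, INR_eq; unfold m in E; lra).
    evar_last.
    * apply (is_RInt_derive (fun t => k * cos (m * t) / m)).
      -- intros t _. auto_derive; [easy|]. field. exact Hm.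
      -- intros t _. apply @ex_derive_continuous. auto_derive. easy.
    * unfold minus, plus, opp; simpl.
      replace (m * (2 * PI)) with (0 + 2 * INR j * PI - 2 * INR n * PI) by (unfold m; ring).
      rewrite cos_minus, cos_period, sin_period.
      replace (2 * INR n * PI) with (0 + 2 * INR n * PI) by ring. rewrite cos_period, sin_period.
      rewrite Rmult_0_r, cos_0, sin_0. field. exact Hm.
- destruct (Nat.eq_dec j n) as [->|N].
  + apply is_RInt_ext with (fun _ => k).
    * intros t _. rewrite Rminus_diag, Rmult_0_l, cos_0. Rring.
    * evar_last; [apply @is_RInt_const|]. unfold scal; simpl; unfold mult; simpl. Rring.
  + set (m := INR j - INR n).
    assert (Hm : m <> 0) by (intro E; apply N, INR_eq; unfold m in E; lra).
    evar_last.
    * apply (is_RInt_derive (fun t => k * sin (m * t) / m)).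
      -- intros t _. auto_derive; [easy|]. field. exact Hm.
      -- intros t _. apply @ex_derive_continuous. auto_derive. easy.
    * unfold minus, plus, opp; simpl.
      replace (m * (2 * PI)) with (0 + 2 * INR j * PI - 2 * INR n * PI) by (unfold m; ring).
      rewrite sin_minus, cos_period, sin_period.
      replace (2 * INR n * PI) with (0 + 2 * INR n * PI) by ring. rewrite cos_period, sin_period.
      rewrite Rmult_0_r, cos_0, sin_0. field. exact Hm.
Qed.

Definition circle_point (r t : R) : C := (RtoC r * (cos t, sin t))%C.

(** The residue of a polynomial divided by [z^(n+1)]: only
    the monomial of degree [n] survives. *)
Lemma is_RInt_binomial_partial b r n J : 0 < r ->
  is_RInt (V := C_R_NormedModule)
    (fun t => let z := circle_point r t in
       (/ z ^ (n + 1) * binomial_partial b J z * (Ci * z))%C) 0 (2 * PI)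
    ((0, if le_dec n J then cesaroR b n * (2 * PI) else 0) : C).
Proof.
intro Hr.
set (mode := fun j t =>
  ((- (cesaroR b j * r ^ j / r ^ n * sin ((INR j - INR n) * t)),
    cesaroR b j * r ^ j / r ^ n * cos ((INR j - INR n) * t)) : C)).
assert (T : forall j t, let z := circle_point r t in mode j t =
  (/ z ^ (n + 1) * (RtoC (cesaroR b j) * z ^ j) * (Ci * z))%C).
{ intros j t z. unfold z, circle_point, mode.
  assert (Hu := unit_neq_0 t). assert (Hr0 : RtoC r <> RtoC 0) by (intro E; apply RtoC_inj in E; lra).
  assert (HrR : r ^ n <> 0) by (apply pow_nonzero; lra).
  transitivity (RtoC (cesaroR b j * r ^ j / r ^ n) * (Ci * ((cos t, sin t) ^ j * / (cos t, sin t) ^ n)))%C.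
  - rewrite !unit_pow, unit_inv. rewrite Rmult_minus_distr_r, cos_minus, sin_minus.
    unfold Cmult, RtoC, Ci; simpl. f_equal; ring.
  - rewrite RtoC_div by assumption. rewrite RtoC_mult, !RtoC_pow, !Cpow_mult_l, !Cpow_add_r, !Cpow_1_r.
    field. repeat split; try assumption; now apply Cpow_nz. }
induction J as [|J IH].
- apply (is_RInt_ext (V := C_R_NormedModule) (mode 0%nat)).
  + intros t _. unfold binomial_partial. rewrite sum_O. exact (T 0%nat t).
  + evar_last; [apply is_RInt_exp_mode|].
    destruct (Nat.eq_dec 0 n) as [E|N], (le_dec n 0) as [L|L]; try lia; try reflexivity.
    rewrite <- E. apply injective_projections; simpl; field.
- apply (is_RInt_ext (V := C_R_NormedModule)
    (fun t => let z := circle_point r t in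
       plus (/ z ^ (n + 1) * binomial_partial b J z * (Ci * z))%C (mode (S J) t))).
  + intros t _. unfold binomial_partial at 2. cbv zeta. rewrite (sum_n_CS _ J), (T (S J) t).
    fold (binomial_partial b J (circle_point r t)).
    change (plus ?a ?b) with (Cplus a b). Cring.
  + evar_last; [exact (is_RInt_plus (V := C_R_NormedModule) _ _ _ _ _ _ IH (is_RInt_exp_mode (S J) n _))|].
    change (plus ?a ?b) with (Cplus a b). unfold Cplus. cbn [fst snd].
    rewrite Rplus_0_l. apply f_equal2; [reflexivity|].
    destruct (Nat.eq_dec (S J) n) as [E|N], (le_dec n J) as [L|L], (le_dec n (S J)) as [L'|L'];
      try lia; try Rring.
    rewrite <- E, Rplus_0_l. field. apply pow_nonzero; lra.
Qed.

Lemma Cmod_circle_point r t : 0 < r -> Cmod (circle_point r t) = r.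
Proof.
intro Hr. unfold circle_point. rewrite Cmod_mult, Cmod_unit, Cmod_R, Rabs_right; lra.
Qed.

(** The partial sums converge uniformly on the circle of radius
    [r < 1], so the integral is the limit of their integrals, which are constant
    from the rank [n] on. *)
Lemma is_RInt_Cpower_mode b r n : 0 < r < 1 ->
  is_RInt (V := C_R_CompleteNormedModule)
    (fun t => let z := circle_point r t in
       (/ z ^ (n + 1) * Cpower (1 - z) (- b) * (Ci * z))%C) 0 (2 * PI)
    ((0, cesaroR b n * (2 * PI)) : C).
Proof.
intro Hr.
set (f := fun J t => let z := circle_point r t in
       (/ z ^ (n + 1) * binomial_partial b J z * (Ci * z))%C).
set (g := fun t => let z := circle_point r t in
       (/ z ^ (n + 1) * Cpower (1 - z) (- b) * (Ci * z))%C).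
set (I := fun J => (0, if le_dec n J then cesaroR b n * (2 * PI) else 0) : C).
set (L := ln 2 - ln (1 - r)).
set (A := exp (Rabs b * L) * (2 * exp (Rabs (b - 1) * L))).
assert (Bd : forall J t, Cmod (f J t - g t)%C <= / r ^ n * A * (Rabs (cesaroR b (S J)) * r ^ S J)).
{ intros J t. unfold f, g. cbv zeta. set (z := circle_point r t).
  assert (Hz : z <> RtoC 0).
  { intro E. assert (H := Cmod_circle_point r t). fold z in H. rewrite E, Cmod_0 in H. lra. }
  replace (_ - _)%C with (Ci * / z ^ n * (binomial_partial b J z - Cpower (1 - z) (- b)))%C.
  2:{ rewrite Cpow_add_r, Cpow_1_r. field. split; [assumption|now apply Cpow_nz]. }
  rewrite !Cmod_mult, Cmod_inv, Cmod_pow by now apply Cpow_nz.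
  replace (Cmod Ci) with 1.
  2:{ symmetry. unfold Cmod, Ci; simpl. replace (0 * _ + _) with 1 by ring. apply sqrt_1. }
  unfold z at 1. rewrite Cmod_circle_point by lra. rewrite Rmult_1_l, Rmult_assoc.
  apply Rmult_le_compat_l; [apply Rlt_le, Rinv_0_lt_compat, pow_lt; lra|].
  apply (binomial_partial_error b (cos t, sin t) r (1 - r) J); try lra.
  - apply Cmod_unit.
  - intros u Hu. cbn [fst]. assert (H := COS_bound t). nra. }
assert (Lim : is_lim_seq (fun J => / r ^ n * A * (Rabs (cesaroR b (S J)) * r ^ S J)) 0).
{ replace (Finite 0) with (Rbar_mult (/ r ^ n * A) 0) by (simpl; f_equal; ring).
  apply is_lim_seq_scal_l, (is_lim_seq_incr_1 (fun J => Rabs (cesaroR b J) * r ^ J)).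
  apply cesaroR_geom_lim; lra. }
destruct (filterlim_RInt (V := C_R_CompleteNormedModule) f 0 (2 * PI) eventually _ g I) as [If [H1 H2]].
- intro J. apply (is_RInt_binomial_partial b r n J); lra.
- apply filterlim_locally. intro eps.
  apply is_lim_seq_spec in Lim. destruct (Lim eps) as [N HN].
  exists N. intros J HJ t. specialize (HN J HJ). specialize (Bd J t).
  rewrite Rminus_0_r in HN. apply Rabs_lt_between in HN.
  split.
  + change (Rabs (fst (f J t - g t)%C) < eps). eapply Rle_lt_trans; [apply fst_le_Cmod|lra].
  + change (Rabs (snd (f J t - g t)%C) < eps). eapply Rle_lt_trans; [apply snd_le_Cmod|lra].
- replace ((0, cesaroR b n * (2 * PI)) : C) with If; [exact H2|].
  apply (filterlim_locally_unique (F := eventually) I); [exact H1|].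
  apply filterlim_ext_loc with (fun _ : nat => (0, cesaroR b n * (2 * PI)) : C_R_CompleteNormedModule).
  + exists n. intros J HJ. unfold I. destruct (le_dec n J); [reflexivity|contradiction].
  + apply filterlim_const.
Qed.

(** The integrand satisfies the same recursion in [j] as [dwrightR]:
    a factor [1 - h w^alpha] splits it into the same integrand and [h] times the
    one in which [b] is lowered by [alpha]. *)
Lemma is_RInt_dwright alpha h b r n j : 0 < h -> 0 < r < 1 ->
  is_RInt (V := C_R_CompleteNormedModule)
    (fun t => let z := (RtoC r * Cexp (Ci * RtoC t))%C in
       let w := ((RtoC 1 - z) / RtoC h)%C in
       (/ z ^ (n + 1) * ((RtoC 1 - RtoC h * Cpower w alpha) ^ j / Cpower w b) * (Ci * z))%C)
    0 (2 * PI)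
    (RtoC (Rpower h b * dwrightR alpha (Rpower h (1 - alpha)) b j n) * (RtoC (2 * PI) * Ci))%C.
Proof.
intros Hh Hr. revert b; induction j as [|j IH]; intro b.
- cbn [dwrightR].
  apply (is_RInt_ext (V := C_R_CompleteNormedModule) (fun t => scal (Rpower h b)
     (let z := circle_point r t in (/ z ^ (n + 1) * Cpower (1 - z) (- b) * (Ci * z))%C))).
  + intros t _. cbv zeta. rewrite Cexp_Ci. fold (circle_point r t). set (z := circle_point r t).
    rewrite (Cpower_scale _ h b); [|assumption|].
    * rewrite !scal_R_Cmult.
      unfold Cdiv. cbn [Cpow].
      replace (/ (RtoC (Rpower h (- b)) * Cpower (1 - z) b))%C
        with (RtoC (Rpower h b) * Cpower (1 - z) (- b))%C; [Cring|].
      rewrite <- Cpower_inv, Rpower_Ropp.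
      assert (Rpower h b <> 0) by (apply Rgt_not_eq, exp_pos).
      rewrite RtoC_inv by assumption. assert (RtoC (Rpower h b) <> RtoC 0) by (intro E; apply RtoC_inj in E; contradiction).
      field. repeat split; try assumption; try apply Cpower_neq_0; exact C1_nz.
    * unfold z, circle_point. cbn. assert (H := COS_bound t). nra.
  + evar_last; [exact (is_RInt_scal (V := C_R_CompleteNormedModule) _ _ _ (Rpower h b) _ (is_RInt_Cpower_mode b r n Hr))|].
    rewrite !scal_R_Cmult.
    apply injective_projections; simpl; ring.
- apply (is_RInt_ext (V := C_R_CompleteNormedModule) (fun t =>
     minus
      (let z := (RtoC r * Cexp (Ci * RtoC t))%C in
       let w := ((RtoC 1 - z) / RtoC h)%C in
       (/ z ^ (n + 1) * ((RtoC 1 - RtoC h * Cpower w alpha) ^ j / Cpower w b) * (Ci * z))%C)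
      (scal h (let z := (RtoC r * Cexp (Ci * RtoC t))%C in
       let w := ((RtoC 1 - z) / RtoC h)%C in
       (/ z ^ (n + 1) * ((RtoC 1 - RtoC h * Cpower w alpha) ^ j / Cpower w (b - alpha)) * (Ci * z))%C)))).
  + intros t _. cbv zeta. set (z := (RtoC r * _)%C). set (w := ((RtoC 1 - z) / RtoC h)%C).
    rewrite !scal_R_Cmult. change (minus ?a ?b) with (Cminus a b).
    replace (/ z ^ (n + 1) * ((1 - h * Cpower w alpha) ^ j / Cpower w (b - alpha)) * (Ci * z))%C
      with (/ z ^ (n + 1) * ((1 - h * Cpower w alpha) ^ j * (Cpower w alpha / Cpower w b)) * (Ci * z))%C.
    2:{ unfold Cdiv. rewrite !Cpower_inv, <- Cpower_plus.
        replace (alpha + - b) with (- (b - alpha)) by ring. reflexivity. }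
    unfold Cdiv. rewrite Cpow_S. Cring.
  + evar_last; [exact (is_RInt_minus (V := C_R_CompleteNormedModule) _ _ _ _ _ _ (IH b)
      (is_RInt_scal (V := C_R_CompleteNormedModule) _ _ _ h _ (IH (b - alpha))))|].
    rewrite !scal_R_Cmult. change (minus ?a ?b) with (Cminus a b).
    cbn [dwrightR].
    replace (Rpower h b * (dwrightR alpha (Rpower h (1 - alpha)) b j n -
        Rpower h (1 - alpha) * dwrightR alpha (Rpower h (1 - alpha)) (b - alpha) j n))
     with (Rpower h b * dwrightR alpha (Rpower h (1 - alpha)) b j n -
        h * (Rpower h (b - alpha) * dwrightR alpha (Rpower h (1 - alpha)) (b - alpha) j n)).
    2:{ replace (Rpower h (b - alpha)) with (Rpower h b * Rpower h (- alpha)) by (rewrite <- Rpower_plus; reflexivity).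
        set (d1 := dwrightR _ _ b j n). set (d2 := dwrightR _ _ (b - alpha) j n).
        assert (E : Rpower h (1 - alpha) = h * Rpower h (- alpha))
          by (unfold Rminus; now rewrite Rpower_plus, Rpower_1).
        rewrite E. ring. }
    rewrite RtoC_minus, (RtoC_mult h). Cring.
Qed.

Lemma dwright_eq alpha h b r n j : 0 < h -> 0 < r < 1 ->
  dwright r h alpha b n j = RtoC (Rpower h b * dwrightR alpha (Rpower h (1 - alpha)) b j n).
Proof.
intros Hh Hr. unfold dwright, circle_integral.
assert (E := is_RInt_unique (V := C_R_CompleteNormedModule) _ _ _ _
  (is_RInt_dwright alpha h b r n j Hh Hr)).
etransitivity; [apply f_equal; exact E|].
assert (RtoC (2 * PI) <> RtoC 0).
{ intro F; apply RtoC_inj in F. assert (H := PI_RGT_0). lra. }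
assert (Ci <> RtoC 0).
{ intro F; apply (f_equal snd) in F; simpl in F; lra. }
field. now split.
Qed.

(** * Improper integrals over the positive axis *)

Notation is_RInt_0_infty f := (is_RInt_gen (V := R_NormedModule) f (at_right 0) (Rbar_locally p_infty)).

Lemma filter_0_infty (P : R * R -> Prop) :
  (exists d B, 0 < d /\ forall a b, 0 < a < d -> B < b -> P (a, b)) ->
  filter_prod (at_right 0) (Rbar_locally p_infty) P.
Proof.
intros [d [B [Hd H]]].
apply Filter_prod with (fun a => 0 < a < d) (fun b => B < b).
- exists (mkposreal d Hd). intros a Ha Ha'. split; [assumption|].
  change (Rabs (a - 0) < d) in Ha. rewrite Rminus_0_r in Ha. apply Rabs_lt_between in Ha. lra.
- now exists B.
- intros a b Ha Hb. now apply H.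
Qed.

Lemma is_RInt_0_infty_ext (f g : R -> R) (l : R) :
  (forall u, 0 < u -> f u = g u) -> is_RInt_0_infty f l -> is_RInt_0_infty g l.
Proof.
intros H. apply is_RInt_gen_ext. apply filter_0_infty.
exists 1, 1. split; [lra|]. intros a b Ha Hb u Hu. apply H.
simpl in Hu. rewrite Rmin_left in Hu; lra.
Qed.

Lemma is_RInt_0_infty_nonneg (f : R -> R) (l : R) :
  (forall u, 0 < u -> 0 <= f u) -> is_RInt_0_infty f l -> 0 <= l.
Proof.
intros H Hf.
assert (E : Rabs l <= l).
{ apply (RInt_gen_norm (V := R_CompleteNormedModule) (Fa := at_right 0) (Fb := Rbar_locally p_infty) f f l l); [| |exact Hf|exact Hf].
  - apply filter_0_infty. exists 1, 1. split; [lra|]. simpl. intros; lra.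
  - apply filter_0_infty. exists 1, 1. split; [lra|]. simpl. intros a b Ha Hb u Hu.
    unfold norm; simpl; unfold abs; simpl. rewrite Rabs_right; [lra|]. apply Rle_ge, H; lra. }
assert (H0 := Rabs_pos l). lra.
Qed.

Lemma is_RInt_0_infty_plus (f g : R -> R) (l m : R) :
  is_RInt_0_infty f l -> is_RInt_0_infty g m -> is_RInt_0_infty (fun u => f u + g u) (l + m).
Proof. intros Hf Hg. exact (is_RInt_gen_plus f g l m Hf Hg). Qed.

Lemma is_RInt_0_infty_scal (f : R -> R) (k l : R) :
  is_RInt_0_infty f l -> is_RInt_0_infty (fun u => k * f u) (k * l).
Proof. intros Hf. exact (is_RInt_gen_scal f k l Hf). Qed.

Lemma is_RInt_0_infty_unique (f : R -> R) (l m : R) :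
  is_RInt_0_infty f l -> is_RInt_0_infty f m -> l = m.
Proof.
intros Hl Hm.
rewrite <- (is_RInt_gen_unique (V := R_CompleteNormedModule) f l Hl).
exact (is_RInt_gen_unique (V := R_CompleteNormedModule) f m Hm).
Qed.

Lemma is_RInt_0_infty_derive (F f : R -> R) (l0 l1 : R) :
  (forall u, 0 < u -> is_derive F u (f u)) ->
  (forall u, 0 < u -> continuous f u) ->
  filterlim F (at_right 0) (locally l0) ->
  filterlim F (Rbar_locally p_infty) (locally l1) ->
  is_RInt_0_infty f (l1 - l0).
Proof.
intros D Cf H0 H1.
apply is_RInt_0_infty_ext with (Derive F).
- intros u Hu. now apply is_derive_unique, D.
- apply is_RInt_gen_Derive; [| |exact H0|exact H1].
  + apply filter_0_infty. exists 1, 1. split; [lra|]. simpl. intros a b Ha Hb u Hu.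
    rewrite Rmin_left in Hu by lra. exists (f u). apply D; lra.
  + apply filter_0_infty. exists 1, 1. split; [lra|]. simpl. intros a b Ha Hb u Hu.
    rewrite Rmin_left in Hu by lra.
    apply continuous_ext_loc with f; [|apply Cf; lra].
    assert (Hu0 : 0 < u) by lra.
    exists (mkposreal u Hu0). intros v Hv. symmetry. apply is_derive_unique, D.
    change (Rabs (v - u) < u) in Hv. apply Rabs_lt_between in Hv. lra.
Qed.

Lemma ex_RInt_positive_axis (f : R -> R) a b :
  (forall u, 0 < u -> continuous f u) -> 0 < a -> 0 < b -> ex_RInt f a b.
Proof.
intros Cf Ha Hb. apply (ex_RInt_continuous (V := R_CompleteNormedModule)). intros u Hu. apply Cf.
unfold Rmin in Hu. destruct (Rle_dec a b); lra.
Qed.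

Lemma RInt_nonneg_widen (f : R -> R) a a0 b0 b :
  (forall u, 0 < u -> continuous f u) -> (forall u, 0 < u -> 0 <= f u) ->
  0 < a <= a0 -> a0 <= b0 <= b -> RInt f a0 b0 <= RInt f a b.
Proof.
intros Cf Pf Ha Hb.
assert (E : forall p q, 0 < p -> 0 < q -> ex_RInt f p q) by (intros; now apply ex_RInt_positive_axis).
assert (P : forall p q, 0 < p <= q -> 0 <= RInt f p q).
{ intros p q Hp. apply RInt_ge_0; [lra|apply E; lra|]. intros u Hu. apply Pf; lra. }
assert (E1 := RInt_Chasles f a a0 b (E a a0 ltac:(lra) ltac:(lra)) (E a0 b ltac:(lra) ltac:(lra))).
assert (E2 := RInt_Chasles f a0 b0 b (E a0 b0 ltac:(lra) ltac:(lra)) (E b0 b ltac:(lra) ltac:(lra))).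
change (plus ?x ?y) with (x + y) in E1, E2.
assert (P1 := P a a0 ltac:(lra)). assert (P2 := P b0 b ltac:(lra)).
change (RInt f a a0 + RInt f a0 b = RInt f a b) in E1.
change (RInt f a0 b0 + RInt f b0 b = RInt f a0 b) in E2. lra.
Qed.

(** The integral converges to the least upper bound of the
    integrals over compact intervals. *)
Lemma bounded_is_RInt_0_infty (f : R -> R) (M : R) :
  (forall u, 0 < u -> continuous f u) -> (forall u, 0 < u -> 0 <= f u) ->
  (forall a b, 0 < a <= b -> RInt f a b <= M) ->
  exists l, is_RInt_0_infty f l.
Proof.
intros Cf Pf HM.
destruct (completeness (fun v => exists a b, 0 < a <= b /\ v = RInt f a b)) as [S [HS1 HS2]].
- exists M. intros v [a [b [Hab ->]]]. now apply HM.
- exists (RInt f 1 1), 1, 1. split; [lra|reflexivity].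
- exists S. intros P [eps HP].
  assert (Hex : exists a0 b0, 0 < a0 <= b0 /\ S - eps < RInt f a0 b0).
  { destruct (Classical_Prop.classic (exists a0 b0, 0 < a0 <= b0 /\ S - eps < RInt f a0 b0)) as [H|H]; [exact H|].
    exfalso. assert (S <= S - eps).
    { apply HS2. intros v [a [b [Hab ->]]]. apply Rnot_lt_le. intro HH. apply H. now exists a, b. }
    destruct eps as [e He]; simpl in *; lra. }
  destruct Hex as [a0 [b0 [H0 H1]]].
  apply filter_0_infty. exists a0, b0. split; [lra|]. intros a b Ha Hb.
  exists (RInt f a b). split.
  + apply (RInt_correct (V := R_CompleteNormedModule)), ex_RInt_positive_axis; try assumption; simpl; lra.
  + apply HP. change (Rabs (RInt f a b - S) < eps).
    assert (H2 : RInt f a b <= S) by (apply HS1; exists a, b; split; [lra|reflexivity]).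
    assert (H3 := RInt_nonneg_widen f a a0 b0 b Cf Pf ltac:(lra) ltac:(lra)).
    apply Rabs_lt_between. lra.
Qed.

Lemma dominated_is_RInt_0_infty (f g : R -> R) (m : R) :
  (forall u, 0 < u -> continuous f u) -> (forall u, 0 < u -> continuous g u) ->
  (forall u, 0 < u -> 0 <= f u <= g u) ->
  is_RInt_0_infty g m -> exists l, is_RInt_0_infty f l.
Proof.
intros Cf Cg H Hg.
apply bounded_is_RInt_0_infty with (m + 1); [assumption|intros u Hu; now apply H|].
intros a b Hab.
assert (L : locally m (fun v : R => v < m + 1)).
{ exists (mkposreal 1 Rlt_0_1). intros v Hv. change (Rabs (v - m) < 1) in Hv.
  apply Rabs_lt_between in Hv. lra. }
specialize (Hg _ L). destruct Hg as [Q R' HQ HR HH].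
destruct HQ as [d Hd]. destruct HR as [B HB].
set (a' := Rmin (d / 2) a). set (b' := Rmax (B + 1) b).
assert (Hdp := cond_pos d).
assert (Ha' : 0 < a') by (unfold a'; apply Rmin_pos; lra).
assert (Ha2 : a' <= a) by apply Rmin_r. assert (Ha3 : a' <= d / 2) by apply Rmin_l.
assert (Hb2 : b <= b') by apply Rmax_r. assert (Hb3 : B + 1 <= b') by apply Rmax_l.
destruct (HH a' b') as [v [Hv1 Hv2]].
- apply Hd; [|lra]. change (Rabs (a' - 0) < d). rewrite Rminus_0_r, Rabs_right by lra. lra.
- apply HB. lra.
- simpl in Hv1. apply (is_RInt_unique (V := R_CompleteNormedModule)) in Hv1.
  apply Rle_trans with (RInt g a b).
  + apply RInt_le; try lra; try (apply ex_RInt_positive_axis; try assumption; lra).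
    intros u Hu. apply H; lra.
  + apply Rle_trans with (RInt g a' b').
    * apply RInt_nonneg_widen; try assumption; try lra.
      intros u Hu. destruct (H u Hu); lra.
    * change (RInt g a' b' = v) in Hv1. lra.
Qed.

(** * The Gamma function *)

Lemma Rpower_pos x a : 0 < Rpower x a.
Proof. apply exp_pos. Qed.

Lemma is_derive_Rpower a u : 0 < u -> is_derive (fun v => Rpower v a) u (a * Rpower u (a - 1)).
Proof.
intro Hu. unfold Rpower. auto_derive; [assumption|].
replace ((a - 1) * ln u) with (a * ln u + - ln u) by ring. rewrite exp_plus, exp_Ropp, exp_ln by assumption.
field. lra.
Qed.

Lemma continuous_Rpower a u : 0 < u -> continuous (fun v => Rpower v a) u.
Proof. intro Hu. apply @ex_derive_continuous. eexists. now apply is_derive_Rpower. Qed.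

Lemma exp_ge_tangent x : 1 + x <= exp x.
Proof. destruct (Req_dec x 0) as [->|N]; [rewrite exp_0; lra|]. left. now apply exp_ineq1. Qed.

Lemma ln_le_tangent v : 0 < v -> ln v <= v - 1.
Proof. intro H. assert (E := exp_ge_tangent (ln v)). rewrite exp_ln in E by assumption. lra. Qed.

Lemma Rpower_limit_0 a : 0 < a -> filterlim (fun u => Rpower u a) (at_right 0) (locally 0).
Proof.
intro Ha. apply filterlim_locally. intro eps.
exists (mkposreal (Rpower eps (/ a)) (Rpower_pos _ _)). intros u Hu Hu0.
change (Rabs (u - 0) < Rpower eps (/ a)) in Hu.
change (Rabs (Rpower u a - 0) < eps).
rewrite Rminus_0_r, Rabs_right in * by (try apply Rle_ge, Rlt_le, Rpower_pos; lra).
replace (pos eps) with (Rpower (Rpower eps (/ a)) a).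
- unfold Rpower. apply exp_increasing, Rmult_lt_compat_l; [assumption|].
  apply ln_increasing; assumption.
- rewrite Rpower_mult, Rinv_l, Rpower_1; [reflexivity|apply cond_pos|lra].
Qed.

(** The maximum over [u] is attained at [u = K/p]; the tangent line
    of the logarithm at that point gives the bound. *)
Lemma exp_power_bound K p u : 0 < K -> 0 < p -> 0 < u ->
  Rpower u K * exp (- (p * u)) <= exp (K * (ln (K / p) - 1)).
Proof.
intros HK Hp Hu. unfold Rpower. rewrite <- exp_plus.
assert (H : 0 < u * p / K) by (apply Rdiv_lt_0_compat; nra).
assert (E := ln_le_tangent _ H).
replace (ln u) with (ln (u * p / K) + ln (K / p)).
2:{ rewrite <- ln_mult; [f_equal; field; lra|assumption|now apply Rdiv_lt_0_compat]. }
assert (K * ln (u * p / K) <= p * u - K).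
{ replace (p * u - K) with (K * (u * p / K - 1)) by (field; lra).
  apply Rmult_le_compat_l; lra. }
assert (L : K * (ln (u * p / K) + ln (K / p)) + - (p * u) <= K * (ln (K / p) - 1)) by lra.
destruct L as [L|L]; [left; now apply exp_increasing|right; now rewrite L].
Qed.

Lemma power_exp_limit_infty a p : 0 < p ->
  filterlim (fun u => Rpower u a * exp (- (p * u))) (Rbar_locally p_infty) (locally 0).
Proof.
intro Hp. (* One power more than [|a|] leaves a factor [1/u]. *)
set (K := Rabs a + 1). assert (HK : 1 <= K) by (assert (H := Rabs_pos a); unfold K; lra).
set (A := exp (K * (ln (K / p) - 1))). assert (HA : 0 < A) by apply exp_pos.
apply filterlim_locally. intro eps. assert (He := cond_pos eps).
exists (Rmax 1 (A / eps)). intros u Hu.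
assert (H1 : 1 < u) by (eapply Rle_lt_trans; [apply Rmax_l|exact Hu]).
assert (H2 : A / eps < u) by (eapply Rle_lt_trans; [apply Rmax_r|exact Hu]).
change (Rabs (Rpower u a * exp (- (p * u)) - 0) < eps).
assert (Hpos : 0 < Rpower u a * exp (- (p * u))) by (apply Rmult_lt_0_compat; apply exp_pos).
rewrite Rminus_0_r, Rabs_right by lra.
apply Rle_lt_trans with (A * / u).
- replace (Rpower u a) with (Rpower u K * Rpower u (a - K)).
  2:{ rewrite <- Rpower_plus. f_equal. ring. }
  assert (B := exp_power_bound K p u ltac:(lra) Hp ltac:(lra)). fold A in B.
  assert (C : Rpower u (a - K) <= / u).
  { rewrite <- (Rpower_1 u) at 2 by lra. rewrite <- Rpower_Ropp. apply Rle_Rpower; [lra|].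
    unfold K. assert (H := Rle_abs a). lra. }
  replace (Rpower u K * Rpower u (a - K) * exp (- (p * u)))
    with (Rpower u K * exp (- (p * u)) * Rpower u (a - K)) by ring.
  apply Rmult_le_compat; try assumption; [|left; apply Rpower_pos].
  left. apply Rmult_lt_0_compat; apply exp_pos.
- apply Rmult_lt_reg_r with u; [lra|]. rewrite Rmult_assoc, Rinv_l, Rmult_1_r by lra.
  apply Rmult_lt_reg_r with (/ eps); [now apply Rinv_0_lt_compat|].
  replace (eps * u * / eps) with u by (field; lra). exact H2.
Qed.

Definition gamma_integrand (x u : R) : R := Rpower u (x - 1) * exp (- u).

Lemma continuous_gamma_integrand x u : 0 < u -> continuous (gamma_integrand x) u.
Proof.
intro Hu. apply @ex_derive_continuous. unfold gamma_integrand, Rpower. auto_derive. assumption.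
Qed.

(** The integrand is dominated by a multiple of
    [u^(x-1) (1+u)^(-x-1)], which has the bounded primitive
    [(u/(1+u))^x / x]. *)
Lemma is_RInt_Gamma x : 0 < x -> is_RInt_0_infty (gamma_integrand x) (Gamma x).
Proof.
intro Hx.
assert (Hex : exists l, is_RInt_0_infty (gamma_integrand x) l).
{ set (K := x + 1). set (A := exp (K * (ln (K / 1) - 1)) * exp 1). 
  assert (HA : 0 < A) by (apply Rmult_lt_0_compat; apply exp_pos).
  apply bounded_is_RInt_0_infty with (A * / x).
  - intros u Hu. now apply continuous_gamma_integrand.
  - intros u Hu. left. apply Rmult_lt_0_compat; apply exp_pos.
  - intros a b Hab.
    set (F := fun u => A * (Rpower (u / (1 + u)) x / x)).
    set (f := fun u => A * (Rpower u (x - 1) * Rpower (1 + u) (- K))).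
    assert (DF : forall u, 0 < u -> is_derive F u (f u)).
    { intros u Hu. unfold F, f, Rpower. auto_derive.
      - repeat split; try lra. apply Rdiv_lt_0_compat; lra.
      - unfold Rdiv. rewrite ln_mult, ln_Rinv by (try apply Rinv_0_lt_compat; lra).
        replace (x * (ln u + - ln (1 + u))) with (x * ln u + - (x * ln (1 + u))) by ring.
        replace ((x - 1) * ln u) with (x * ln u + - ln u) by ring.
        replace (- K * ln (1 + u)) with (- (x * ln (1 + u)) + - ln (1 + u)) by (unfold K; ring).
        rewrite !exp_plus, (exp_Ropp (ln u)), (exp_Ropp (ln (1 + u))), !exp_ln by lra.
        field. lra. }
    assert (Cf : forall u, 0 < u -> continuous f u).
    { intros u Hu. apply @ex_derive_continuous. unfold f, Rpower. auto_derive. repeat split; lra. }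
    assert (I : is_RInt f a b (F b - F a)).
    { apply (is_RInt_derive F f); intros u Hu; rewrite Rmin_left in Hu by lra; [apply DF|apply Cf]; lra. }
    apply Rle_trans with (F b - F a).
    + rewrite <- (is_RInt_unique (V := R_CompleteNormedModule) _ _ _ _ I).
      apply RInt_le; [lra| | |].
      * apply ex_RInt_positive_axis; try lra. intros u Hu. now apply continuous_gamma_integrand.
      * now exists (F b - F a).
      * intros u Hu. unfold gamma_integrand, f.
        replace (A * (Rpower u (x - 1) * Rpower (1 + u) (- K))) with (Rpower u (x - 1) * (A * Rpower (1 + u) (- K))) by ring.
        apply Rmult_le_compat_l; [left; apply Rpower_pos|].
        assert (B := exp_power_bound K 1 (1 + u) ltac:(unfold K; lra) Rlt_0_1 ltac:(lra)).
        rewrite Rpower_Ropp.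
        apply Rmult_le_reg_l with (Rpower (1 + u) K); [apply Rpower_pos|].
        replace (Rpower (1 + u) K * (A * / Rpower (1 + u) K)) with A
          by (field; apply Rgt_not_eq, Rpower_pos).
        unfold A. replace (- u) with (- (1 * (1 + u)) + 1) by ring. rewrite exp_plus, <- Rmult_assoc.
        apply Rmult_le_compat_r; [left; apply exp_pos|exact B].
    + assert (F b <= A * / x).
      { unfold F. apply Rmult_le_compat_l; [lra|]. unfold Rdiv at 1.
        rewrite <- (Rmult_1_l (/ x)) at 2. apply Rmult_le_compat_r; [left; now apply Rinv_0_lt_compat|].
        assert (Hb : 0 < b / (1 + b)) by (apply Rdiv_lt_0_compat; lra).
        assert (L := ln_le_tangent _ Hb).
        assert (E : b / (1 + b) - 1 = - / (1 + b)) by (field; lra).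
        assert (0 < / (1 + b)) by (apply Rinv_0_lt_compat; lra).
        unfold Rpower. apply Rle_trans with (exp 0); [|rewrite exp_0; lra].
        left. apply exp_increasing. nra. }
      assert (0 <= F a).
      { unfold F. apply Rmult_le_pos; [lra|]. apply Rmult_le_pos; [left; apply Rpower_pos|].
        left. now apply Rinv_0_lt_compat. }
      lra. }
destruct Hex as [l Hl].
replace (Gamma x) with l; [exact Hl|]. symmetry.
exact (is_RInt_gen_unique (V := R_CompleteNormedModule) _ l Hl).
Qed.

(** Integration by parts of [u^x e^(-u)]. *)
Lemma Gamma_succ x : 0 < x -> Gamma (x + 1) = x * Gamma x.
Proof.
intro Hx.
assert (I : is_RInt_0_infty (fun u => x * gamma_integrand x u + -1 * gamma_integrand (x + 1) u) (0 - 0)).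
{ apply (is_RInt_0_infty_derive (fun u => Rpower u x * exp (- u))).
  - intros u Hu. unfold gamma_integrand.
    replace (x + 1 - 1) with x by ring.
    assert (H := is_derive_Rpower x u Hu).
    evar_last.
    + apply (is_derive_mult (fun v => Rpower v x) (fun v => exp (- v)) u _ (- exp (- u)) H); [|intros; apply Rmult_comm].
      auto_derive; [easy|ring].
    + unfold plus, mult; simpl. ring.
  - intros u Hu. apply @ex_derive_continuous. unfold gamma_integrand, Rpower. auto_derive. easy.
  - replace 0 with (0 * exp (- 0)) at 2 by ring.
    apply (filterlim_comp_2 (F := at_right 0) (G := locally 0) (H := locally (exp (- 0)))
             (fun u => Rpower u x) (fun u => exp (- u)) Rmult).
    + now apply Rpower_limit_0.
    + apply (filterlim_filter_le_1 (F := locally 0)).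
      * intros P HP. unfold at_right, within. destruct HP as [e He]. exists e. intros; now apply He.
      * apply (ex_derive_continuous (fun u => exp (- u)) 0). auto_derive. easy.
    + exact (@filterlim_mult R_AbsRing 0 (exp (- 0))).
  - apply filterlim_ext with (fun u => Rpower u x * exp (- (1 * u))).
    + intro u. now rewrite Rmult_1_l.
    + apply power_exp_limit_infty. lra. }
assert (J := is_RInt_0_infty_plus _ _ _ _
  (is_RInt_0_infty_scal _ x _ (is_RInt_Gamma x Hx))
  (is_RInt_0_infty_scal _ (-1) _ (is_RInt_Gamma (x + 1) ltac:(lra)))).
assert (E := is_RInt_0_infty_unique _ _ _ I J). lra.
Qed.

Lemma Gamma_1 : Gamma 1 = 1.
Proof.
assert (I : is_RInt_0_infty (gamma_integrand 1) (0 - - exp (- 0))).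
{ apply is_RInt_0_infty_ext with (fun u => exp (- u)).
  - intros u Hu. unfold gamma_integrand. rewrite Rminus_diag, Rpower_O by assumption. ring.
  - apply (is_RInt_0_infty_derive (fun u => - exp (- u))).
    + intros u Hu. auto_derive; [easy|ring].
    + intros u Hu. apply @ex_derive_continuous. auto_derive. easy.
    + apply (filterlim_filter_le_1 (F := locally 0)).
      * intros P HP. unfold at_right, within. destruct HP as [e He]. exists e. intros; now apply He.
      * apply (ex_derive_continuous (fun u => - exp (- u)) 0). auto_derive. easy.
    + replace 0 with (- 0) by ring.
      apply (filterlim_comp _ _ _ (fun u => exp (- u)) Ropp _ (locally 0)).
      * apply filterlim_ext_loc with (fun u => Rpower u 0 * exp (- (1 * u))).
        -- exists 0. intros u Hu. rewrite Rpower_O by assumption. now rewrite !Rmult_1_l.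
        -- apply power_exp_limit_infty. lra.
      * exact (filterlim_opp (V := R_NormedModule) 0). }
assert (E := is_RInt_0_infty_unique _ _ _ I (is_RInt_Gamma 1 Rlt_0_1)).
rewrite Ropp_0, exp_0 in E. lra.
Qed.

Lemma Gamma_fact n : Gamma (INR (S n)) = INR (fact n).
Proof.
induction n as [|n IH]; [exact Gamma_1|].
rewrite S_INR, Gamma_succ by (apply lt_0_INR; lia).
rewrite IH, fact_simpl, mult_INR. ring.
Qed.

Lemma Rpower_neg_tangent v c : 0 < v -> 0 <= c -> 1 - c * (v - 1) <= Rpower v (- c).
Proof.
intros Hv Hc. unfold Rpower. eapply Rle_trans; [|apply exp_ge_tangent].
assert (H := ln_le_tangent v Hv). nra.
Qed.

(** Bernoulli's inequality, obtained from the tangent line at 1 of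
    [w^(-(d-1))], read at [w = 1/v]. *)
Lemma Rpower_tangent v d : 0 < v -> 1 <= d -> 1 + d * (v - 1) <= Rpower v d.
Proof.
intros Hv Hd.
assert (Hi : 0 < / v) by now apply Rinv_0_lt_compat.
assert (H := Rpower_neg_tangent (/ v) (d - 1) Hi ltac:(lra)).
replace (Rpower v d) with (v * Rpower (/ v) (- (d - 1))).
- apply Rle_trans with (v * (1 - (d - 1) * (/ v - 1))); [right; field; lra|].
  apply Rmult_le_compat_l; lra.
- unfold Rpower. rewrite ln_Rinv by assumption. rewrite <- (exp_ln v) at 1 by assumption.
  rewrite <- exp_plus. f_equal. ring.
Qed.

Lemma gamma_integrand_shift x c u : 0 < u -> gamma_integrand (x + c) u = Rpower u c * gamma_integrand x u.
Proof.
intro Hu. unfold gamma_integrand.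
replace (x + c - 1) with (c + (x - 1)) by ring. rewrite Rpower_plus. ring.
Qed.

Lemma Rpower_div u v c : 0 < u -> 0 < v -> Rpower (u / v) c = Rpower u c * Rpower v (- c).
Proof.
intros Hu Hv. unfold Rpower, Rdiv. rewrite ln_mult, ln_Rinv by (try apply Rinv_0_lt_compat; assumption).
rewrite <- exp_plus. f_equal. ring.
Qed.

(** Integrate against [u^(x-1) e^(-u)] the tangent line at [u = x]
    of the convex function [u^(-c)]; the linear term contributes nothing beyond
    its value at [x], because [x] is the mean of that weight. *)
Lemma Gamma_shift_down x c : 0 <= c < x -> Rpower x (- c) * Gamma x <= Gamma (x - c).
Proof.
intros Hc.
assert (J := is_RInt_0_infty_plus _ _ _ _ (is_RInt_Gamma (x + - c) ltac:(lra))
  (is_RInt_0_infty_plus _ _ _ _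
  (is_RInt_0_infty_scal _ (- Rpower x (- c) * (1 + c)) _ (is_RInt_Gamma x ltac:(lra)))
  (is_RInt_0_infty_scal _ (Rpower x (- c) * (c / x)) _ (is_RInt_Gamma (x + 1) ltac:(lra))))).
apply is_RInt_0_infty_nonneg in J.
- rewrite Gamma_succ in J by lra.
  replace (Rpower x (- c) * (c / x) * (x * Gamma x)) with (Rpower x (- c) * c * Gamma x) in J by (field; lra).
  unfold Rminus. lra.
- intros u Hu. rewrite !gamma_integrand_shift, Rpower_1 by assumption.
  assert (G : 0 < gamma_integrand x u) by (apply Rmult_lt_0_compat; apply exp_pos).
  assert (H : 0 < u / x) by (apply Rdiv_lt_0_compat; lra).
  assert (T := Rpower_neg_tangent (u / x) c H ltac:(lra)).
  rewrite Rpower_div, Ropp_involutive in T by lra.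
  assert (P := Rpower_pos x (- c)).
  assert (PP : Rpower x c * Rpower x (- c) = 1) by (rewrite <- Rpower_plus, Rplus_opp_r, Rpower_O; lra).
  replace (_ + _) with ((Rpower x (- c) * (Rpower u (- c) * Rpower x c - (1 - c * (u / x - 1)))) * gamma_integrand x u).
  2:{ replace (Rpower x (- c) * (Rpower u (- c) * Rpower x c - (1 - c * (u / x - 1))))
        with (Rpower u (- c) * (Rpower x c * Rpower x (- c)) - Rpower x (- c) * (1 - c * (u / x - 1))) by ring.
      rewrite PP. field. lra. }
  apply Rmult_le_pos; [|lra]. apply Rmult_le_pos; lra.
Qed.

(** The same argument for the convex function [u^d] with the weight
    [u^(y-1) e^(-u)], of mean [y]. *)
Lemma Gamma_shift_up y d : 0 < y -> 1 <= d -> Rpower y d * Gamma y <= Gamma (y + d).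
Proof.
intros Hy Hd.
assert (J := is_RInt_0_infty_plus _ _ _ _ (is_RInt_Gamma (y + d) ltac:(lra))
  (is_RInt_0_infty_plus _ _ _ _
  (is_RInt_0_infty_scal _ (- Rpower y d * (1 - d)) _ (is_RInt_Gamma y ltac:(lra)))
  (is_RInt_0_infty_scal _ (- Rpower y d * (d / y)) _ (is_RInt_Gamma (y + 1) ltac:(lra))))).
apply is_RInt_0_infty_nonneg in J.
- rewrite Gamma_succ in J by lra.
  replace (- Rpower y d * (d / y) * (y * Gamma y)) with (- Rpower y d * d * Gamma y) in J by (field; lra).
  lra.
- intros u Hu. rewrite !gamma_integrand_shift, Rpower_1 by assumption.
  assert (G : 0 < gamma_integrand y u) by (apply Rmult_lt_0_compat; apply exp_pos).
  assert (H : 0 < u / y) by (apply Rdiv_lt_0_compat; lra).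
  assert (T := Rpower_tangent (u / y) d H Hd).
  rewrite Rpower_div in T by lra.
  assert (P := Rpower_pos y d).
  assert (PP : Rpower y d * Rpower y (- d) = 1) by (rewrite <- Rpower_plus, Rplus_opp_r, Rpower_O; lra).
  replace (_ + _) with ((Rpower y d * (Rpower u d * Rpower y (- d) - (1 + d * (u / y - 1)))) * gamma_integrand y u).
  2:{ replace (Rpower y d * (Rpower u d * Rpower y (- d) - (1 + d * (u / y - 1))))
        with (Rpower u d * (Rpower y d * Rpower y (- d)) - Rpower y d * (1 + d * (u / y - 1))) by ring.
      rewrite PP. field. lra. }
  apply Rmult_le_pos; [|lra]. apply Rmult_le_pos; lra.
Qed.

Lemma Gamma_pos x : 0 < x -> 0 < Gamma x.
Proof.
intro Hx. destruct (INR_unbounded x) as [n Hn].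
assert (H := Gamma_shift_down (INR (S n)) (INR (S n) - x)).
replace (INR (S n) - (INR (S n) - x)) with x in H by ring.
rewrite Gamma_fact in H. assert (Hn2 : x < INR (S n)) by (rewrite S_INR; lra).
eapply Rlt_le_trans; [|apply H; lra].
apply Rmult_lt_0_compat; [apply Rpower_pos|apply INR_fact_lt_0].
Qed.

(** The upper bound comes from a shift by [c + 1] instead of
    [c], so that [Gamma_shift_up] applies for every [c >= 0]. *)
Lemma Gamma_ratio_bounds x c : 0 <= c -> c + 1 < x ->
  1 <= Rpower x c * Gamma (x - c) / Gamma x <= Rpower (x / (x - c - 1)) c.
Proof.
intros Hc Hx. assert (G := Gamma_pos x ltac:(lra)).
assert (PP : Rpower x c * Rpower x (- c) = 1) by (rewrite <- Rpower_plus, Rplus_opp_r, Rpower_O; lra).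
assert (Px := Rpower_pos x c).
split.
- apply Rmult_le_reg_r with (Gamma x); [assumption|].
  unfold Rdiv. rewrite Rmult_assoc, Rinv_l, Rmult_1_l, Rmult_1_r by lra.
  assert (H := Gamma_shift_down x c ltac:(lra)).
  apply Rmult_le_compat_l with (r := Rpower x c) in H; [|lra].
  rewrite <- Rmult_assoc, PP in H. lra.
- rewrite Rpower_div by lra. unfold Rdiv. rewrite Rmult_assoc. apply Rmult_le_compat_l; [lra|].
  set (y := x - c - 1).
  assert (H := Gamma_shift_up y (c + 1) ltac:(unfold y; lra) ltac:(lra)).
  replace (y + (c + 1)) with x in H by (unfold y; ring).
  replace (x - c) with (y + 1) by (unfold y; ring).
  rewrite Gamma_succ by (unfold y; lra).
  rewrite Rpower_plus, Rpower_1 in H by (unfold y; lra).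
  assert (PY : Rpower y c * Rpower y (- c) = 1) by (rewrite <- Rpower_plus, Rplus_opp_r, Rpower_O; unfold y; lra).
  assert (P1 := Rpower_pos y (- c)).
  apply Rmult_le_reg_r with (Gamma x); [assumption|].
  rewrite Rmult_assoc, Rinv_l, Rmult_1_r by lra.
  apply Rmult_le_compat_l with (r := Rpower y (- c)) in H; [|lra].
  replace (Rpower y (- c) * (Rpower y c * y * Gamma y)) with (Rpower y c * Rpower y (- c) * (y * Gamma y)) in H by ring.
  rewrite PY in H. lra.
Qed.

Lemma rGamma_pos_eq x : 0 < x -> rGamma x = / Gamma x.
Proof.
intro Hx. unfold rGamma.
assert (H : (up (- x) <= 0)%Z).
{ destruct (archimed (- x)) as [_ H]. apply le_IZR.
  destruct (Z_le_gt_dec (up (- x)) 0) as [L|L]; [now apply IZR_le|].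
  assert (1 <= IZR (up (- x))) by (apply IZR_le; lia). lra. }
replace (Z.to_nat (up (- x))) with 0%nat by lia. reflexivity.
Qed.

(** Raising [x <= 0] by one removes one step of the recursion behind
    [rGamma]; for [x > 0] there is no step, and this is the functional equation
    of Gamma. *)
Lemma rGamma_step x : rGamma x = x * rGamma (x + 1).
Proof.
destruct (Rlt_le_dec 0 x) as [Hx|Hx].
- rewrite !rGamma_pos_eq, Gamma_succ by lra. field. split; [|lra]. apply Rgt_not_eq, Gamma_pos, Hx.
- unfold rGamma.
  assert (E : up (- (x + 1)) = (up (- x) - 1)%Z).
  { symmetry. apply tech_up; rewrite minus_IZR; destruct (archimed (- x)); lra. }
  assert (H : (1 <= up (- x))%Z).
  { destruct (archimed (- x)) as [H _]. assert (0 < IZR (up (- x))) by lra.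
    apply lt_IZR in H0. lia. }
  rewrite E. replace (Z.to_nat (up (- x))) with (S (Z.to_nat (up (- x) - 1))) by lia.
  reflexivity.
Qed.

Lemma rGamma_nonneg x : 0 <= x -> 0 <= rGamma x.
Proof.
intros [Hx|<-].
- rewrite rGamma_pos_eq by assumption. left. apply Rinv_0_lt_compat, Gamma_pos, Hx.
- rewrite rGamma_step. lra.
Qed.

Lemma cesaroR_rGamma a n : rGamma a = cesaroR a n * INR (fact n) * rGamma (a + INR n).
Proof.
induction n as [|n IH].
- simpl. rewrite Rplus_0_r. ring.
- rewrite IH, (rGamma_step (a + INR n)), S_INR, fact_simpl, mult_INR.
  replace (a + (INR n + 1)) with (a + INR n + 1) by ring.
  replace (cesaroR a (S n) * (INR (S n) * INR (fact n))) with ((INR n + a) * cesaroR a n * INR (fact n)).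
  + ring.
  + rewrite <- cesaroR_succ. ring.
Qed.

(** [k^a(n) = Gamma(n+a) / (Gamma(a) n!)], also when [1/Gamma(a)] is
    a continued value. *)
Lemma cesaroR_Gamma a n : 0 < INR n + a ->
  cesaroR a n * INR (fact n) = rGamma a * Gamma (INR n + a).
Proof.
intro H. rewrite (cesaroR_rGamma a n), (Rplus_comm a), rGamma_pos_eq by assumption.
assert (G := Gamma_pos _ H). field. lra.
Qed.

Lemma Gamma_ge_half x : 1 <= x -> / 2 <= Gamma x.
Proof.
intro Hx. assert (H : exists n, x <= INR n + 2) by (destruct (INR_unbounded x) as [n Hn]; exists n; lra).
destruct H as [n Hn]. revert x Hx Hn. induction n as [|n IH]; intros x Hx Hn.
- simpl in Hn. assert (H := Gamma_shift_down 2 (2 - x) ltac:(lra)).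
  replace (2 - (2 - x)) with x in H by ring.
  assert (G2 : Gamma 2 = 1) by exact (Gamma_fact 1). rewrite G2, Rmult_1_r in H.
  eapply Rle_trans; [|exact H]. rewrite Rpower_Ropp. apply Rinv_le_contravar; [apply Rpower_pos|].
  apply Rle_trans with (Rpower 2 1); [apply Rle_Rpower; lra|rewrite Rpower_1; lra].
- destruct (Rle_lt_dec x 2) as [H|H].
  + apply IH; [assumption|]. assert (H0 := pos_INR n). lra.
  + replace x with (x - 1 + 1) by ring. rewrite Gamma_succ by lra.
    rewrite S_INR in Hn. assert (H1 := IH (x - 1) ltac:(lra) ltac:(lra)). nra.
Qed.

(** Each step to the left multiplies [1/Gamma(y)] by less than
    the growth of [Gamma(4-y)]; on [1,2] the bound holds because
    [Gamma >= 1/2] on the half-line [x >= 1]. *)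
Lemma rGamma_abs_le y : y <= 2 -> Rabs (rGamma y) <= 4 * Gamma (4 - y).
Proof.
intro Hy. assert (H : exists n, 1 <= y + INR n) by (destruct (INR_unbounded (1 - y)) as [n Hn]; exists n; lra).
destruct H as [n Hn]. revert y Hy Hn. induction n as [|n IH]; intros y Hy Hn.
- simpl in Hn. assert (H1 := Gamma_ge_half y ltac:(lra)). assert (H2 := Gamma_ge_half (4 - y) ltac:(lra)).
  rewrite rGamma_pos_eq by lra. rewrite Rabs_right by (left; apply Rinv_0_lt_compat; lra).
  assert (/ Gamma y <= 2); [|lra]. rewrite <- (Rinv_inv 2). apply Rinv_le_contravar; lra.
- destruct (Rle_lt_dec 1 y) as [H|H].
  + apply IH; [assumption|]. assert (H0 := pos_INR n). lra.
  + rewrite rGamma_step, Rabs_mult. rewrite S_INR in Hn.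
    assert (H1 := IH (y + 1) ltac:(lra) ltac:(lra)).
    replace (4 - y) with (4 - (y + 1) + 1) by ring. rewrite Gamma_succ by lra.
    assert (G := Gamma_pos (4 - (y + 1)) ltac:(lra)).
    assert (Rabs y <= 4 - (y + 1)) by (apply Rabs_le; lra).
    replace (4 * ((4 - (y + 1)) * Gamma (4 - (y + 1)))) with ((4 - (y + 1)) * (4 * Gamma (4 - (y + 1)))) by ring.
    apply Rmult_le_compat; try assumption; apply Rabs_pos.
Qed.

(** * The Wright function on the negative axis *)

(** Coefficients of [x |-> W_{-alpha,b}(-x)]. *)
Definition wright_coef (alpha b : R) (m : nat) : R :=
  (-1) ^ m * rGamma (b - alpha * INR m) / INR (fact m).

Definition wrightR (alpha b x : R) : R := PSeries (wright_coef alpha b) x.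

Lemma wright_coef_abs alpha b m :
  Rabs (wright_coef alpha b m) = Rabs (rGamma (b - alpha * INR m)) / INR (fact m).
Proof.
unfold wright_coef, Rdiv. rewrite !Rabs_mult, pow_1_abs, Rmult_1_l, (Rabs_right (/ _)); [reflexivity|].
apply Rle_ge, Rlt_le, Rinv_0_lt_compat, INR_fact_lt_0.
Qed.

(** By [rGamma_abs_le] and [Gamma_shift_up] the coefficient of
    index [m] is at most [4 Y^(-d)] with [Y] close to [alpha m] and [d] close to
    [(1-alpha) m]; since [Y] is unbounded and [alpha < 1], this beats every
    geometric sequence. *)
Lemma ex_series_wright_coef alpha b x : 0 < alpha < 1 -> 0 <= x ->
  ex_series (fun m => Rabs (wright_coef alpha b m) * x ^ m).
Proof.
intros Ha Hx.
(* [z >= 2 x] turns a bound by [z^(-m)] into the geometric majorant [2^(-m)],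
   and [Y >= Y0] is what makes [Y^d] exceed [z^m]. *)
set (z := 2 * (x + 1)).
assert (Hz : 0 < ln z) by (rewrite <- ln_1; apply ln_increasing; unfold z; lra).
set (Y0 := exp (2 * ln z / (1 - alpha))).
assert (HY0 : 0 < Y0) by apply exp_pos.
destruct (INR_unbounded (Rabs ((b - 2) / alpha) + Rabs ((4 - b) / (1 - alpha)) + Rabs (2 * (3 - b) / (1 - alpha)) + Rabs ((Y0 + b) / alpha))) as [N HN].
apply (ex_series_incr_n _ N).
apply (ex_series_le (fun k => Rabs (wright_coef alpha b (N + k)) * x ^ (N + k)) (fun m => 4 * ((1 / 2) ^ N * (1 / 2) ^ m))).
2:{ apply (ex_series_scal 4 (fun m => (1 / 2) ^ N * (1 / 2) ^ m)).
    apply (ex_series_scal ((1 / 2) ^ N) (fun m => (1 / 2) ^ m)).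
    apply ex_series_geom. rewrite Rabs_right; lra. }
intro k. set (m := (N + k)%nat).
rewrite <- pow_add. fold m.
unfold norm; simpl; unfold abs; simpl.
rewrite Rabs_right by (apply Rle_ge, Rmult_le_pos; [apply Rabs_pos|now apply pow_le]).
rewrite wright_coef_abs.
assert (HNm : INR N <= INR m) by (apply le_INR; unfold m; lia).
assert (A1 := Rle_abs ((b - 2) / alpha)). assert (A2 := Rle_abs ((4 - b) / (1 - alpha))).
assert (A3 := Rle_abs (2 * (3 - b) / (1 - alpha))). assert (A4 := Rle_abs ((Y0 + b) / alpha)).
assert (P1 := Rabs_pos ((b - 2) / alpha)). assert (P2 := Rabs_pos ((4 - b) / (1 - alpha))).
assert (P3 := Rabs_pos (2 * (3 - b) / (1 - alpha))). assert (P4 := Rabs_pos ((Y0 + b) / alpha)).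
assert (B1 : b - alpha * INR m <= 2).
{ assert (b - 2 = alpha * ((b - 2) / alpha)) by (field; lra). nra. }
assert (B2 : 1 <= (1 - alpha) * INR m + b - 3).
{ assert (4 - b = (1 - alpha) * ((4 - b) / (1 - alpha))) by (field; lra). nra. }
assert (B3 : (1 - alpha) * INR m / 2 <= (1 - alpha) * INR m + b - 3).
{ assert (2 * (3 - b) = (1 - alpha) * (2 * (3 - b) / (1 - alpha))) by (field; lra). nra. }
assert (B4 : Y0 <= 4 - b + alpha * INR m).
{ assert (Y0 + b = alpha * ((Y0 + b) / alpha)) by (field; lra). nra. }
set (Y := 4 - b + alpha * INR m) in *. set (d := (1 - alpha) * INR m + b - 3) in *.
assert (G := rGamma_abs_le (b - alpha * INR m) B1).
replace (4 - (b - alpha * INR m)) with Y in G by (unfold Y; ring).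
assert (T := Gamma_shift_up Y d ltac:(lra) B2).
replace (Y + d) with (INR (S m)) in T by (rewrite S_INR; unfold Y, d; ring).
rewrite Gamma_fact in T.
assert (F := INR_fact_lt_0 m).
assert (Hm : 0 <= INR m) by apply pos_INR.
assert (L : INR m * ln z <= d * ln Y).
{ assert (H1 : 2 * ln z / (1 - alpha) <= ln Y) by (rewrite <- (ln_exp (2 * ln z / (1 - alpha))); apply ln_le; assumption).
  apply Rle_trans with ((1 - alpha) * INR m / 2 * (2 * ln z / (1 - alpha))).
  - right. field. lra.
  - apply Rmult_le_compat; try assumption.
    + nra.
    + apply Rlt_le, Rdiv_lt_0_compat; lra. }
assert (Q : z ^ m <= Rpower Y d).
{ rewrite <- (Rpower_pow m z) by (unfold z; lra). unfold Rpower. destruct L as [L|L]; [left; now apply exp_increasing|right; now rewrite L]. }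
assert (GY := Gamma_pos Y ltac:(lra)).
assert (Hx2 : x ^ m <= (1 / 2) ^ m * z ^ m).
{ rewrite <- Rpow_mult_distr. apply pow_incr. unfold z. lra. }
assert (Px : 0 <= x ^ m) by now apply pow_le.
assert (Ph : 0 < (1 / 2) ^ m) by (apply pow_lt; lra).
apply Rle_trans with (4 * Gamma Y / INR (fact m) * ((1 / 2) ^ m * z ^ m)).
- apply Rmult_le_compat; try assumption.
  + apply Rmult_le_pos; [apply Rabs_pos|]. left; now apply Rinv_0_lt_compat.
  + apply Rmult_le_compat_r; [left; now apply Rinv_0_lt_compat|assumption].
- assert (z ^ m * Gamma Y <= INR (fact m)) by nra.
  replace (4 * Gamma Y / INR (fact m) * ((1 / 2) ^ m * z ^ m)) with
    (4 * (1 / 2) ^ m * (z ^ m * Gamma Y * / INR (fact m))) by (field; lra).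
  replace (4 * (1 / 2) ^ m) with (4 * (1 / 2) ^ m * 1) at 2 by ring.
  apply Rmult_le_compat_l; [lra|].
  apply Rmult_le_reg_r with (INR (fact m)); [assumption|].
  rewrite Rmult_assoc, Rinv_l; lra.
Qed.

Lemma wright_entire alpha b x : 0 < alpha < 1 ->
  Rbar_lt (Rabs x) (CV_radius (wright_coef alpha b)).
Proof.
intro Ha. apply Rbar_lt_le_trans with (Rabs (Rabs x + 1)).
- assert (H := Rabs_pos x). simpl. rewrite (Rabs_right (Rabs x + 1)); lra.
- assert (H := Rabs_pos x). rewrite (Rabs_right (Rabs x + 1)) by lra.
  apply (proj1 (Lub_Rbar_correct (CV_disk (wright_coef alpha b)))). unfold CV_disk.
  apply ex_series_ext with (2 := ex_series_wright_coef alpha b (Rabs x + 1) Ha ltac:(lra)).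
  intro m. rewrite Rabs_mult, (Rabs_right ((Rabs x + 1) ^ m)); [reflexivity|].
  apply Rle_ge, pow_le; lra.
Qed.

Lemma ex_pseries_wright alpha b x : 0 < alpha < 1 -> ex_pseries (wright_coef alpha b) x.
Proof. intro Ha. apply CV_radius_inside. now apply wright_entire. Qed.

Lemma wrightR_0 alpha b : wrightR alpha b 0 = rGamma b.
Proof.
unfold wrightR. rewrite PSeries_0. unfold wright_coef. simpl.
rewrite Rmult_0_r, Rminus_0_r. field.
Qed.

Lemma is_derive_wrightR alpha b x : 0 < alpha < 1 ->
  is_derive (wrightR alpha b) x (- wrightR alpha (b - alpha) x).
Proof.
intro Ha. unfold wrightR. evar_last.
- apply is_derive_PSeries. now apply wright_entire.
- rewrite <- PSeries_opp. apply PSeries_ext. intro m.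
  unfold PS_derive, PS_opp, wright_coef, opp; simpl opp. cbn [pow].
  change (opp ?a) with (- a).
  rewrite S_INR, fact_simpl, mult_INR, S_INR.
  replace (b - alpha * (INR m + 1)) with (b - alpha - alpha * INR m) by ring.
  assert (H := pos_INR m).  simpl. field. split; [apply INR_fact_neq_0|lra].
Qed.

(** Comparison of coefficients: the functional equation of [1/Gamma] at
    [b - 1 - alpha m] produces the factor [b - 1 - alpha m], and the part
    [- alpha m] is the derivative in [x]. *)
Lemma wrightR_lower alpha b x : 0 < alpha < 1 ->
  wrightR alpha (b - 1) x = (b - 1) * wrightR alpha b x + alpha * (x * wrightR alpha (b - alpha) x).
Proof.
intro Ha. unfold wrightR.
rewrite <- PSeries_incr_1, <- !PSeries_scal, <- PSeries_plus.
- apply PSeries_ext. intro m. unfold PS_plus, PS_scal, PS_incr_1, plus, scal; simpl. unfold mult; simpl.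
  unfold wright_coef. rewrite (rGamma_step (b - 1 - alpha * INR m)).
  replace (b - 1 - alpha * INR m + 1) with (b - alpha * INR m) by ring.
  destruct m as [|m].
  + simpl. unfold zero; simpl. field.
  + rewrite fact_simpl, mult_INR. cbn [pow].
    replace (b - alpha - alpha * INR m) with (b - alpha * INR (S m)) by (rewrite S_INR; ring).
    rewrite S_INR. assert (H := pos_INR m). field. split; [apply INR_fact_neq_0|lra].
- apply ex_pseries_scal; [apply Rmult_comm|]. now apply ex_pseries_wright.
- apply ex_pseries_scal; [apply Rmult_comm|]. apply ex_pseries_incr_1. now apply ex_pseries_wright.
Qed.

(** * Positivity of the Wright function *)

Lemma partial_sum_gap (f D : nat -> R) I J : (I <= J)%nat ->
  (forall i, (i <= J)%nat -> Rabs (f i) <= D i) ->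
  sum_n f J - sum_n f I <= sum_n D J - sum_n D I.
Proof.
induction 1 as [|J HJ IH]; intro H; [rewrite !Rminus_diag; lra|].
rewrite !sum_n_RS. assert (H1 := H (S J) (le_n _)). assert (H2 := Rle_abs (f (S J))).
assert (H3 : sum_n f J - sum_n f I <= sum_n D J - sum_n D I) by (apply IH; intros; apply H; lia). lra.
Qed.

(** Dominated convergence for sums with a growing number of terms, in
    the form needed to carry nonnegativity over to the limit: up to the tail of
    the majorant, a fixed partial sum of the limit is a limit of full sums. *)
Lemma tannery_nonneg (f : nat -> nat -> R) (J : nat -> nat) (g D : nat -> R) :
  (forall i, is_lim_seq (fun N => f N i) (g i)) ->
  (forall I, eventually (fun N => (I <= J N)%nat)) ->
  eventually (fun N => forall i, (i <= J N)%nat -> Rabs (f N i) <= D i) ->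
  eventually (fun N => 0 <= sum_n (f N) (J N)) ->
  (forall i, 0 <= D i) -> ex_series D -> ex_series g ->
  0 <= Series g.
Proof.
intros Hf HJ HD Hpos D0 [SD HSD] [Sg HSg].
assert (LD : is_lim_seq (sum_n D) SD) by exact HSD.
assert (Lg : is_lim_seq (sum_n g) Sg) by exact HSg.
rewrite (is_series_unique g Sg HSg).
assert (TD : forall N, sum_n D N <= SD).
{ intro N. apply (is_lim_seq_incr_compare (sum_n D) SD LD).
  intro n. rewrite sum_n_RS. specialize (D0 (S n)). lra. }
(* [SD - sum_n D I] is the tail of the majorant. *)
assert (K : forall I, 0 <= sum_n g I + (SD - sum_n D I)).
{ intro I.
  assert (LI : is_lim_seq (fun N => sum_n (f N) I) (sum_n g I)).
  { clear -Hf. induction I as [|I IH].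
    - apply is_lim_seq_ext with (fun N => f N 0%nat); [intro; now rewrite sum_O|]. rewrite sum_O. apply Hf.
    - apply is_lim_seq_ext with (fun N => sum_n (f N) I + f N (S I)); [intro; now rewrite sum_n_RS|].
      rewrite sum_n_RS. now apply is_lim_seq_plus'. }
  assert (LI2 := is_lim_seq_plus' _ _ _ _ LI (is_lim_seq_const (SD - sum_n D I))).
  apply (is_lim_seq_le_loc (fun _ => 0) _ 0 _) with (3 := LI2); [|apply is_lim_seq_const].
  generalize (filter_and _ _ (HJ I) (filter_and _ _ HD Hpos)). apply filter_imp.
  intros N [H1 [H2 H3]].
  assert (E := partial_sum_gap (f N) D I (J N) H1 H2). specialize (TD (J N)). 
  lra. }
assert (LS : is_lim_seq (fun I => sum_n g I + (SD - sum_n D I)) (Sg + (SD - SD))).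
{ apply is_lim_seq_plus'; [exact Lg|]. apply is_lim_seq_minus'; [apply is_lim_seq_const|exact LD]. }
rewrite Rminus_diag, Rplus_0_r in LS.
exact (is_lim_seq_le (fun _ => 0) _ 0 Sg K (is_lim_seq_const 0) LS).
Qed.

(** [j (j-1) ... (j-i+1) / j^i], the price of replacing a binomial
    coefficient by [j^i / i!]. *)
Definition falling_ratio (J i : nat) : R := Binomial.C J i * INR (fact i) / INR J ^ i.

Lemma falling_ratio_0 J : falling_ratio J 0 = 1.
Proof.
unfold falling_ratio, Binomial.C. rewrite Nat.sub_0_r. simpl.
field. apply INR_fact_neq_0.
Qed.

Lemma falling_ratio_succ J i : (S i <= J)%nat ->
  falling_ratio J (S i) = falling_ratio J i * (1 - INR i * / INR J).
Proof.
intro H. unfold falling_ratio, Binomial.C.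
replace (J - i)%nat with (S (J - S i)) by lia.
rewrite (fact_simpl (J - S i)), mult_INR.
replace (S (J - S i)) with (J - i)%nat by lia. rewrite minus_INR by lia.
cbn [pow].
assert (INR J <> 0) by (apply not_0_INR; lia).
assert (INR J - INR i <> 0) by (rewrite <- minus_INR by lia; apply not_0_INR; lia).
field. repeat split; try apply INR_fact_neq_0; try assumption. now apply pow_nonzero.
Qed.

Lemma falling_ratio_bounds J i : (i <= J)%nat -> 0 <= falling_ratio J i <= 1.
Proof.
induction i as [|i IH]; intro H; [rewrite falling_ratio_0; lra|].
rewrite falling_ratio_succ by assumption.
assert (H1 := IH ltac:(lia)).
assert (HJ : 0 < INR J) by (apply lt_0_INR; lia).
assert (Hi : INR i <= INR J) by (apply le_INR; lia).
assert (H0 := pos_INR i).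
assert (Q : 0 <= INR i * / INR J <= 1).
{ split.
  - apply Rmult_le_pos; [assumption|]. left. now apply Rinv_0_lt_compat.
  - apply Rmult_le_reg_r with (INR J); [assumption|]. rewrite Rmult_assoc, Rinv_l; lra. }
nra.
Qed.

Lemma falling_ratio_lim (J : nat -> nat) i :
  is_lim_seq (fun N => INR (J N)) p_infty ->
  is_lim_seq (fun N => falling_ratio (J N) i) 1.
Proof.
intro HJ. induction i as [|i IH].
- apply is_lim_seq_ext with (fun _ => 1); [intro; now rewrite falling_ratio_0|apply is_lim_seq_const].
- apply is_lim_seq_ext_loc with (fun N => falling_ratio (J N) i * (1 - INR i * / INR (J N))).
  + apply is_lim_seq_spec in HJ. destruct (HJ (INR i)) as [N HN].
    exists N. intros n Hn. symmetry. apply falling_ratio_succ. apply INR_lt, HN, Hn.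
  + replace (Finite 1) with (Finite (1 * (1 - INR i * 0))) by (f_equal; ring).
    apply is_lim_seq_mult'; [exact IH|].
    apply is_lim_seq_minus'; [apply is_lim_seq_const|].
    apply (is_lim_seq_scal_l (fun N => / INR (J N)) (INR i) 0).
    exact (is_lim_seq_inv _ p_infty HJ ltac:(discriminate)).
Qed.

Lemma is_lim_seq_INR_plus b : is_lim_seq (fun N => INR N + b) p_infty.
Proof.
apply (is_lim_seq_plus _ _ p_infty b); [apply is_lim_seq_INR|apply is_lim_seq_const|reflexivity].
Qed.

Lemma is_lim_seq_ln (u : nat -> R) : is_lim_seq u p_infty -> is_lim_seq (fun N => ln (u N)) p_infty.
Proof. intro H. exact (filterlim_comp _ _ _ u ln _ _ _ H is_lim_ln_p). Qed.

Lemma Rpower_lim_infty b a : 0 < a -> is_lim_seq (fun N => Rpower (INR N + b) a) p_infty.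
Proof.
intro Ha. unfold Rpower.
apply (filterlim_comp _ _ _ (fun N => a * ln (INR N + b)) exp _ (Rbar_locally p_infty)); [|exact is_lim_exp_p].
replace p_infty with (Rbar_mult a p_infty).
- apply is_lim_seq_scal_l, is_lim_seq_ln, is_lim_seq_INR_plus.
- simpl. destruct (Rle_dec 0 a) as [H|H]; [|lra]. destruct (Rle_lt_or_eq_dec 0 a H); [reflexivity|lra].
Qed.

Lemma Rpower_lim_0 b a : a < 0 -> is_lim_seq (fun N => Rpower (INR N + b) a) 0.
Proof.
intro Ha.
apply is_lim_seq_ext with (fun N => / Rpower (INR N + b) (- a)).
- intro N. now rewrite <- Rpower_Ropp, Ropp_involutive.
- apply (is_lim_seq_inv _ p_infty); [apply Rpower_lim_infty; lra|discriminate].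
Qed.

Lemma Gamma_ratio_lim b c : 0 <= c ->
  is_lim_seq (fun N => Rpower (INR N + b) c * Gamma (INR N + b - c) / Gamma (INR N + b)) 1.
Proof.
intro Hc.
apply is_lim_seq_le_le_loc with (fun _ => 1) (fun N => Rpower ((INR N + b) / (INR N + b - c - 1)) c).
- destruct (INR_unbounded (c + 1 - b)) as [N0 HN0]. exists N0. intros N HN.
  apply le_INR in HN. apply Gamma_ratio_bounds; lra.
- apply is_lim_seq_const.
- replace (Finite 1) with (Finite (Rpower 1 c)).
  2:{ unfold Rpower. rewrite ln_1, Rmult_0_r, exp_0. reflexivity. }
  apply (is_lim_seq_continuous (fun v => Rpower v c)).
  + apply continuity_pt_filterlim. apply (continuous_Rpower c 1). lra.
  + apply is_lim_seq_ext_loc with (fun N => 1 + (c + 1) * / (INR N + (b - c - 1))).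
    * destruct (INR_unbounded (c + 1 - b)) as [N0 HN0]. exists N0. intros N HN.
      apply le_INR in HN. field. lra.
    * replace (Finite 1) with (Finite (1 + (c + 1) * 0)) by (f_equal; ring).
      apply is_lim_seq_plus'; [apply is_lim_seq_const|].
      apply (is_lim_seq_scal_l (fun N => / (INR N + (b - c - 1))) (c + 1) 0).
      exact (is_lim_seq_inv _ p_infty (is_lim_seq_INR_plus _) ltac:(discriminate)).
Qed.

(** Normalising [dwrightR] by [Gamma(X)/n!] and writing
    [y = x X^alpha / j] exhibits its [i]-th term as the [i]-th term of the Wright
    series times two factors that tend to 1. *)
Lemma dwrightR_Gamma_expansion alpha x b j n :
  0 < x -> 0 <= b -> (0 < n)%nat -> (0 < j)%nat -> alpha * INR j < INR n + b -> 0 < alpha ->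
  let X := INR n + b in
  dwrightR alpha (x * Rpower X alpha / INR j) b j n * INR (fact n) / Gamma X =
  sum_n (fun i => wright_coef alpha b i * x ^ i * falling_ratio j i *
    (Rpower X (alpha * INR i) * Gamma (X - alpha * INR i) / Gamma X)) j :> R.
Proof.
intros Hx Hb Hn Hj Hlt Ha X.
assert (HX : 0 < X) by (assert (H := lt_0_INR n Hn); unfold X; lra).
assert (HG := Gamma_pos X HX).
rewrite dwrightR_binomial. unfold Rdiv at 1. rewrite Rmult_assoc, Rmult_comm, <- sum_n_Rscal.
apply sum_n_Rext. intros i Hi.
assert (Hij : alpha * INR i <= alpha * INR j) by (apply Rmult_le_compat_l; [lra|now apply le_INR]).
assert (E := cesaroR_Gamma (b - alpha * INR i) n ltac:(lra)).
replace (INR n + (b - alpha * INR i)) with (X - alpha * INR i) in E by (unfold X; ring).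
transitivity (Binomial.C j i * (- (x * Rpower X alpha / INR j)) ^ i *
   (cesaroR (b - alpha * INR i) n * INR (fact n)) / Gamma X); [field; lra|].
rewrite E.
replace (- (x * Rpower X alpha / INR j)) with (-1 * (x * (Rpower X alpha * / INR j))) by (unfold Rdiv; ring).
rewrite !Rpow_mult_distr, pow_inv.
replace (Rpower X alpha ^ i) with (Rpower X (alpha * INR i)).
2:{ rewrite <- Rpower_pow by apply Rpower_pos. now rewrite Rpower_mult. }
unfold wright_coef, falling_ratio.
field. repeat split; try lra; try apply INR_fact_neq_0. apply pow_nonzero, not_0_INR; lia.
Qed.

(** The sum of [dwrightR_Gamma_expansion] is nonnegative as soon as
    [y = x X^alpha / j] is at most 1, that is [j >= x X^alpha].  Taking for [j]
    the next integer keeps [alpha j] below [X/2] for large [n], which bounds the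
    ratios of Gamma values by [2^(alpha i)]; then the sums tend to the Wright
    series. *)
Lemma wrightR_nonneg alpha b x : 0 < alpha < 1 -> 0 <= b -> 0 <= x -> 0 <= wrightR alpha b x.
Proof.
intros Ha Hb [Hx|<-]; [|rewrite wrightR_0; now apply rGamma_nonneg].
set (X := fun N => INR N + b).
set (J := fun N => Z.to_nat (up (x * Rpower (X N) alpha))).
assert (HJ : forall N, x * Rpower (X N) alpha <= INR (J N) <= x * Rpower (X N) alpha + 1).
{ intro N. unfold J. assert (P : 0 < x * Rpower (X N) alpha) by (apply Rmult_lt_0_compat; [lra|apply Rpower_pos]).
  destruct (archimed (x * Rpower (X N) alpha)) as [A1 A2].
  assert (0 < up (x * Rpower (X N) alpha))%Z by (apply lt_IZR; lra).
  rewrite INR_IZR_INZ, Z2Nat.id by lia. lra. }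
assert (LJ : is_lim_seq (fun N => INR (J N)) p_infty).
{ apply is_lim_seq_le_p_loc with (fun N => x * Rpower (X N) alpha).
  - exists 0%nat. intros N _. apply HJ.
  - replace p_infty with (Rbar_mult x p_infty).
    + apply is_lim_seq_scal_l, Rpower_lim_infty; lra.
    + simpl. destruct (Rle_dec 0 x) as [H|H]; [|lra]. destruct (Rle_lt_or_eq_dec 0 x H); [reflexivity|lra]. }
(* From this rank on, every argument of Gamma stays above [X/2]. *)
assert (Large : eventually (fun N => (0 < N)%nat /\ alpha * INR (J N) + 1 <= X N / 2)).
{ assert (L0 := Rpower_lim_0 b (alpha - 1) ltac:(lra)).
  apply is_lim_seq_spec in L0.
  assert (He : 0 < / (8 * (x + 1))) by (apply Rinv_0_lt_compat; lra).
  destruct (L0 (mkposreal _ He)) as [N1 HN1].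
  exists (N1 + 8)%nat. intros N HN. split; [lia|].
  specialize (HN1 N ltac:(lia)). cbn [pos] in HN1. fold (X N) in HN1.
  assert (H8 : INR 8 <= INR N) by (apply le_INR; lia). simpl in H8.
  assert (HX : 8 <= X N) by (unfold X; lra).
  rewrite Rminus_0_r, Rabs_right in HN1 by (left; apply Rpower_pos).
  assert (E : Rpower (X N) alpha = X N * Rpower (X N) (alpha - 1)).
  { rewrite <- (Rpower_1 (X N)) at 2 by lra. rewrite <- Rpower_plus. f_equal; ring. }
  assert (Q : x * Rpower (X N) alpha <= X N / 8).
  { rewrite E. apply Rle_trans with (x * (X N * / (8 * (x + 1)))).
    - apply Rmult_le_compat_l; [lra|]. apply Rmult_le_compat_l; lra.
    - replace (X N / 8) with ((x + 1) * (X N * / (8 * (x + 1)))) by (field; lra).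
      apply Rmult_le_compat_r; [|lra]. apply Rmult_le_pos; lra. }
  destruct (HJ N) as [_ H2]. assert (H3 := pos_INR (J N)). nra. }
unfold wrightR, PSeries.
apply (tannery_nonneg
  (fun N i => wright_coef alpha b i * x ^ i * falling_ratio (J N) i *
    (Rpower (X N) (alpha * INR i) * Gamma (X N - alpha * INR i) / Gamma (X N))) J
  _ (fun i => Rabs (wright_coef alpha b i) * (x * Rpower 2 alpha) ^ i)).
- intro i. replace (Finite (wright_coef alpha b i * x ^ i)) with (Finite (wright_coef alpha b i * x ^ i * 1 * 1)) by (f_equal; ring).
  apply is_lim_seq_mult'; [|apply Gamma_ratio_lim; apply Rmult_le_pos; [lra|apply pos_INR]].
  apply is_lim_seq_mult'; [apply is_lim_seq_const|]. now apply falling_ratio_lim.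
- intro I. apply is_lim_seq_spec in LJ. destruct (LJ (INR I)) as [N HN].
  exists N. intros n Hn. apply INR_le. left. now apply HN.
- revert Large. apply filter_imp. intros N [HN HL] i Hi.
  assert (HNX : 1 <= INR N) by (apply (le_INR 1); lia).
  assert (HX : 0 < X N) by (unfold X; lra).
  assert (Hi' : alpha * INR i <= alpha * INR (J N)) by (apply Rmult_le_compat_l; [lra|now apply le_INR]).
  assert (Hi0 : 0 <= alpha * INR i) by (apply Rmult_le_pos; [lra|apply pos_INR]).
  destruct (Gamma_ratio_bounds (X N) (alpha * INR i) Hi0 ltac:(lra)) as [B1 B2].
  assert (HF := falling_ratio_bounds (J N) i Hi).
  assert (B3 : Rpower (X N / (X N - alpha * INR i - 1)) (alpha * INR i) <= Rpower 2 alpha ^ i).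
  { rewrite <- Rpower_pow by apply Rpower_pos. rewrite Rpower_mult.
    apply Rle_Rpower_l; [assumption|]. split; [apply Rdiv_lt_0_compat; lra|].
    apply Rmult_le_reg_r with (X N - alpha * INR i - 1); [lra|].
    unfold Rdiv. rewrite Rmult_assoc, Rinv_l; lra. }
  rewrite !Rabs_mult, Rpow_mult_distr.
  rewrite (Rabs_right (x ^ i)) by (apply Rle_ge, pow_le; lra).
  rewrite (Rabs_right (falling_ratio _ _)) by lra.
  rewrite (Rabs_right (_ / _)) by lra.
  assert (P1 := Rabs_pos (wright_coef alpha b i)). assert (P2 : 0 <= x ^ i) by (apply pow_le; lra).
  set (v := _ / _) in *.
  rewrite <- Rmult_assoc. apply Rmult_le_compat; try lra.
  + apply Rmult_le_pos; [now apply Rmult_le_pos|lra].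
  + rewrite <- (Rmult_1_r (_ * x ^ i)) at 2. apply Rmult_le_compat_l; [|lra].
    now apply Rmult_le_pos.
- revert Large. apply filter_imp. intros N [HN HL].
  assert (HNX : 1 <= INR N) by (apply (le_INR 1); lia).
  assert (HX : 0 < X N) by (unfold X; lra).
  assert (P : 0 < x * Rpower (X N) alpha) by (apply Rmult_lt_0_compat; [lra|apply Rpower_pos]).
  destruct (HJ N) as [H1 H2].
  assert (HJ0 : (0 < J N)%nat) by (apply INR_lt; simpl; lra).
  unfold X at 1 2 3. rewrite <- (dwrightR_Gamma_expansion alpha x b (J N) N); try assumption; try lra.
  2:{ fold (X N). lra. }
  apply Rmult_le_pos; [|left; apply Rinv_0_lt_compat, Gamma_pos, HX].
  apply Rmult_le_pos; [|apply pos_INR].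
  apply dwrightR_nonneg; try assumption. fold (X N). split.
  + apply Rmult_le_pos; [lra|]. left. apply Rinv_0_lt_compat. lra.
  + apply Rmult_le_reg_r with (INR (J N)); [lra|]. unfold Rdiv. rewrite Rmult_assoc, Rinv_l; lra.
- intro i. apply Rmult_le_pos; [apply Rabs_pos|]. apply pow_le.
  apply Rmult_le_pos; [lra|left; apply Rpower_pos].
- apply ex_series_wright_coef; [assumption|]. apply Rmult_le_pos; [lra|left; apply Rpower_pos].
- apply ex_series_ext with (2 := ex_pseries_wright alpha b x Ha).
  intro i. rewrite pow_n_pow. unfold scal; simpl; unfold mult; simpl. apply Rmult_comm.
Qed.

(** The derivative is minus a nonnegative Wright function. *)
Lemma wrightR_le alpha b x : 0 < alpha < 1 -> alpha <= b -> 0 <= x -> wrightR alpha b x <= rGamma b.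
Proof.
intros Ha Hb Hx. rewrite <- (wrightR_0 alpha b).
assert (H := increment_le (wrightR alpha b) (fun _ => 0) (fun u => - wrightR alpha (b - alpha) u) (fun _ => 0) x Hx).
cut (wrightR alpha b x - wrightR alpha b 0 <= 0 - 0); [lra|]. apply H.
- intros. now apply is_derive_wrightR.
- intros. apply @is_derive_const.
- intros u Hu. assert (P := wrightR_nonneg alpha (b - alpha) u Ha ltac:(lra) ltac:(lra)). lra.
Qed.

(** Solve [wrightR_lower] for its last term and drop a nonnegative
    one. *)
Lemma wrightR_decay alpha b x : 0 < alpha < 1 -> 1 <= b -> 0 <= x ->
  alpha * (x * wrightR alpha b x) <= rGamma (b + alpha - 1).
Proof.
intros Ha Hb Hx.
assert (E := wrightR_lower alpha (b + alpha) x Ha).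
replace (b + alpha - alpha) with b in E by ring.
assert (P := wrightR_nonneg alpha (b + alpha) x Ha ltac:(lra) Hx).
assert (Q := wrightR_le alpha (b + alpha - 1) x Ha ltac:(lra) Hx). nra.
Qed.

(** * Exponential generating functions of the discrete Wright function *)

Lemma is_series_shift {K : AbsRing} {V : NormedModule K} (a : nat -> V) (l : V) :
  a O = zero -> is_series (fun i => a (S i)) l -> is_series a l.
Proof.
intros H0 H. apply is_series_decr_1.
replace (plus l (opp (a O))) with l; [exact H|]. rewrite H0.
etransitivity; [symmetry; exact (plus_zero_r l)|]. apply f_equal. symmetry. exact opp_zero.
Qed.

Lemma is_series_Rplus (a b : nat -> R) (l m : R) :
  is_series a l -> is_series b m -> is_series (fun i => a i + b i) (l + m).
Proof. exact (is_series_plus a b l m). Qed.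

Lemma is_series_Rscal (c : R) (a : nat -> R) (l : R) :
  is_series a l -> is_series (fun i => c * a i) (c * l).
Proof. exact (is_series_scal c a l). Qed.

Lemma is_series_Rext (a b : nat -> R) (l : R) :
  (forall i, a i = b i) -> is_series a l -> is_series b l.
Proof. exact (is_series_ext a b l). Qed.

(** Summed over [j] with [x = t/h], this gives the right-hand side of (iii), up to
    powers of [h] and exponentials. *)
Definition dwrightR_exp_term (alpha y x b : R) (n j : nat) : R :=
  dwrightR alpha y b j n * (x ^ j / INR (fact j)).

Definition dwrightR_exp (alpha y x b : R) (n : nat) : R := Series (dwrightR_exp_term alpha y x b n).

Lemma is_series_dwrightR_exp_0 alpha y x b :
  is_series (dwrightR_exp_term alpha y x b 0) (exp ((1 - y) * x)).
Proof.
apply is_series_Rext with (2 := is_exp_Reals ((1 - y) * x)). intro j.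
unfold dwrightR_exp_term. rewrite dwrightR_at_0, pow_n_pow, Rpow_mult_distr. 
unfold scal; simpl; unfold mult; simpl. unfold Rdiv. Rring.
Qed.

Lemma is_series_dwrightR_exp_succ alpha y x b n l m :
  is_series (dwrightR_exp_term alpha y x (b + 1) n) l ->
  is_series (dwrightR_exp_term alpha y x (b + 1 - alpha) n) m ->
  is_series (dwrightR_exp_term alpha y x b (S n)) (/ INR (S n) * (b * l + alpha * y * (x * m))).
Proof.
intros Hl Hm.
assert (Hs : is_series (fun j => INR j * dwrightR alpha y (b + 1 - alpha) (pred j) n * (x ^ j / INR (fact j))) (x * m)).
{ apply is_series_shift; [simpl; unfold zero; simpl; Rring|].
  apply is_series_Rext with (2 := is_series_Rscal x _ _ Hm). intro j.
  unfold dwrightR_exp_term. cbn [pred]. rewrite fact_simpl, mult_INR. cbn [pow].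
  field. split; [apply INR_fact_neq_0|apply not_0_INR; lia]. }
apply is_series_Rext with (2 := is_series_Rscal (/ INR (S n)) _ _
  (is_series_Rplus _ _ _ _ (is_series_Rscal b _ _ Hl) (is_series_Rscal (alpha * y) _ _ Hs))).
intro j. cbv beta. unfold dwrightR_exp_term.
assert (HS : INR (S n) <> 0) by (apply not_0_INR; lia).
apply Rmult_eq_reg_l with (INR (S n)); [|exact HS].
rewrite <- Rmult_assoc, Rinv_r, Rmult_1_l by exact HS.
rewrite <- (Rmult_assoc (INR (S n))), dwrightR_raise. ring.
Qed.

Lemma ex_series_dwrightR_exp alpha y x b n : ex_series (dwrightR_exp_term alpha y x b n).
Proof.
revert b; induction n as [|n IH]; intro b.
- eexists. apply is_series_dwrightR_exp_0.
- destruct (IH (b + 1)) as [l Hl], (IH (b + 1 - alpha)) as [m Hm].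
  eexists. exact (is_series_dwrightR_exp_succ alpha y x b n l m Hl Hm).
Qed.

Lemma is_series_dwrightR_exp alpha y x b n :
  is_series (dwrightR_exp_term alpha y x b n) (dwrightR_exp alpha y x b n).
Proof. apply Series_correct, ex_series_dwrightR_exp. Qed.

Lemma dwrightR_exp_0 alpha y x b : dwrightR_exp alpha y x b 0 = exp ((1 - y) * x).
Proof. apply is_series_unique, is_series_dwrightR_exp_0. Qed.

Lemma dwrightR_exp_raise alpha y x b n :
  INR (S n) * dwrightR_exp alpha y x b (S n) =
  b * dwrightR_exp alpha y x (b + 1) n + alpha * y * (x * dwrightR_exp alpha y x (b + 1 - alpha) n).
Proof.
unfold dwrightR_exp at 1.
rewrite (is_series_unique _ _ (is_series_dwrightR_exp_succ _ _ _ _ _ _ _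
  (is_series_dwrightR_exp alpha y x (b + 1) n) (is_series_dwrightR_exp alpha y x (b + 1 - alpha) n))).
rewrite <- Rmult_assoc, Rinv_r by (apply not_0_INR; lia). ring.
Qed.

Lemma dwrightR_exp_telescope alpha y x b n :
  dwrightR_exp alpha y x (b + 1) (S n) = dwrightR_exp alpha y x b (S n) + dwrightR_exp alpha y x (b + 1) n.
Proof.
apply is_series_unique.
apply is_series_Rext with (2 := is_series_Rplus _ _ _ _
  (is_series_dwrightR_exp alpha y x b (S n)) (is_series_dwrightR_exp alpha y x (b + 1) n)).
intro j. unfold dwrightR_exp_term. rewrite (dwrightR_telescope alpha y (b + 1)).
replace (b + 1 - 1) with b by ring. Rring.
Qed.

(** * The Laplace transform of the scaled Wright function *)

Lemma is_RInt_0_infty_rescale (f : R -> R) (p l : R) : 0 < p ->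
  is_RInt_0_infty f l -> is_RInt_0_infty (fun s => p * f (p * s)) l.
Proof.
intros Hp Hf P HP. destruct (Hf P HP) as [Q R' [d Hd] [B HB] HH].
apply filter_0_infty. exists (d / p), (B / p). split; [apply Rdiv_lt_0_compat; [apply cond_pos|assumption]|].
intros a b Ha Hb.
destruct (HH (p * a) (p * b)) as [v [Hv1 Hv2]].
- apply Hd; [|nra]. change (Rabs (p * a - 0) < d). rewrite Rminus_0_r, Rabs_right by nra.
  apply Rlt_le_trans with (p * (d / p)); [apply Rmult_lt_compat_l; lra|right; field; lra].
- apply HB. apply Rle_lt_trans with (p * (B / p)); [right; field; lra|apply Rmult_lt_compat_l; lra].
- exists v. split; [|exact Hv2]. cbn [fst snd] in *.
  apply (is_RInt_ext (fun s => scal p (f (p * s + 0)))).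
  + intros s _. now rewrite Rplus_0_r.
  + apply (is_RInt_comp_lin f p 0 a b v). now rewrite !Rplus_0_r.
Qed.

Lemma is_RInt_power_laplace a p : 0 < a -> 0 < p ->
  is_RInt_0_infty (fun s => exp (- (p * s)) * Rpower s (a - 1)) (Gamma a * Rpower p (- a)).
Proof.
intros Ha Hp. rewrite (Rmult_comm (Gamma a)).
apply is_RInt_0_infty_ext with (2 := is_RInt_0_infty_scal _ (Rpower p (- a)) _
  (is_RInt_0_infty_rescale _ p _ Hp (is_RInt_Gamma a Ha))).
intros s Hs. unfold gamma_integrand.
replace (Rpower (p * s) (a - 1)) with (Rpower p (a - 1) * Rpower s (a - 1)) by (apply Rpower_mult_distr; assumption).
replace (Rpower p (- a) * (p * (Rpower p (a - 1) * Rpower s (a - 1) * exp (- (p * s)))))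
  with (p * (Rpower p (- a) * Rpower p (a - 1)) * (exp (- (p * s)) * Rpower s (a - 1))) by ring.
rewrite <- Rpower_plus. replace (- a + (a - 1)) with (- (1)) by ring.
rewrite Rpower_Ropp, Rpower_1 by assumption. field. lra.
Qed.

(** The scaled Wright function, as a real function of [s]. *)
Definition psi (alpha t b s : R) : R := Rpower s (b - 1) * wrightR alpha b (t * Rpower s (- alpha)).

(** [wrightR_lower] multiplied by a power of [s]. *)
Lemma psi_times alpha t b s : 0 < alpha < 1 -> 0 < s ->
  s * psi alpha t b s = b * psi alpha t (b + 1) s + alpha * t * psi alpha t (b + 1 - alpha) s.
Proof.
intros Ha Hs. unfold psi.
assert (E := wrightR_lower alpha (b + 1) (t * Rpower s (- alpha)) Ha).
replace (b + 1 - 1) with b in * by ring. rewrite E.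
replace (b + 1 - alpha - 1) with (b + - alpha) by ring. rewrite Rpower_plus.
replace (Rpower s b) with (s * Rpower s (b - 1)); [ring|].
rewrite <- (Rpower_1 s) at 1 by assumption. rewrite <- Rpower_plus. f_equal; ring.
Qed.

(** The chain rule and [wrightR_lower]. *)
Lemma is_derive_psi alpha t b s : 0 < alpha < 1 -> 0 < s ->
  is_derive (psi alpha t (b + 1)) s (psi alpha t b s).
Proof.
intros Ha Hs.
assert (D1 := is_derive_Rpower (b + 1 - 1) s Hs).
assert (D2 : is_derive (fun v => t * Rpower v (- alpha)) s (t * (- alpha * Rpower s (- alpha - 1)))).
{ apply is_derive_scal. now apply is_derive_Rpower. }
assert (D3 : is_derive (fun v => wrightR alpha (b + 1) (t * Rpower v (- alpha))) s
  (t * (- alpha * Rpower s (- alpha - 1)) * (- wrightR alpha (b + 1 - alpha) (t * Rpower s (- alpha))))).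
{ exact (is_derive_comp (wrightR alpha (b + 1)) (fun v => t * Rpower v (- alpha)) s _ _
   (is_derive_wrightR alpha (b + 1) _ Ha) D2). }
evar_last; [exact (is_derive_mult _ _ s _ _ D1 D3 Rmult_comm)|].
unfold plus, mult; simpl. unfold psi.
assert (E := wrightR_lower alpha (b + 1) (t * Rpower s (- alpha)) Ha).
replace (b + 1 - 1) with b in * by ring. rewrite E.
replace (Rpower s (- alpha - 1)) with (Rpower s (- alpha) * Rpower s (- (1))) by (rewrite <- Rpower_plus; f_equal; ring).
replace (Rpower s (b - 1)) with (Rpower s b * Rpower s (- (1))) by (rewrite <- Rpower_plus; f_equal; ring).
Rring.
Qed.

Lemma psi_bounds alpha t b s : 0 < alpha < 1 -> 0 < t -> 0 < s -> alpha <= b ->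
  0 <= psi alpha t b s <= rGamma b * Rpower s (b - 1).
Proof.
intros Ha Ht Hs Hb. unfold psi.
assert (P := Rpower_pos s (b - 1)).
assert (Hx : 0 <= t * Rpower s (- alpha)) by (apply Rmult_le_pos; [lra|left; apply Rpower_pos]).
assert (W1 := wrightR_nonneg alpha b _ Ha ltac:(lra) Hx).
assert (W2 := wrightR_le alpha b _ Ha Hb Hx). split; [apply Rmult_le_pos; lra|].
rewrite Rmult_comm. apply Rmult_le_compat_r; lra.
Qed.

(** The decay of [wrightR] at infinity becomes a gain of [s^alpha] at 0;
    it is what makes the boundary term vanish when [b = 0]. *)
Lemma psi_small alpha t b s : 0 < alpha < 1 -> 0 < t -> 0 < s -> 0 <= b ->
  psi alpha t (b + 1) s <= rGamma (b + alpha) / (alpha * t) * Rpower s (b + alpha).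
Proof.
intros Ha Ht Hs Hb. unfold psi.
assert (Hx : 0 <= t * Rpower s (- alpha)) by (apply Rmult_le_pos; [lra|left; apply Rpower_pos]).
assert (W := wrightR_decay alpha (b + 1) _ Ha ltac:(lra) Hx).
set (g := wrightR alpha (b + 1) _) in *.
replace (b + 1 + alpha - 1) with (b + alpha) in W by ring.
replace (b + 1 - 1) with b by ring.
assert (P := Rpower_pos s (b + alpha)).
assert (E : Rpower s b = Rpower s (b + alpha) * Rpower s (- alpha)) by (rewrite <- Rpower_plus; f_equal; ring).
rewrite E.
apply Rmult_le_reg_l with (alpha * t); [nra|].
replace (alpha * t * (Rpower s (b + alpha) * Rpower s (- alpha) * g))
  with (alpha * (t * Rpower s (- alpha) * g) * Rpower s (b + alpha)) by ring.
replace (alpha * t * (rGamma (b + alpha) / (alpha * t) * Rpower s (b + alpha)))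
  with (rGamma (b + alpha) * Rpower s (b + alpha)) by (field; lra).
apply Rmult_le_compat_r; lra.
Qed.

Lemma filterlim_squeeze_0 (F : (R -> Prop) -> Prop) (f g : R -> R) : Filter F ->
  F (fun u => 0 <= f u <= g u) -> filterlim g F (locally 0) -> filterlim f F (locally 0).
Proof.
intros FF H Hg. apply filterlim_locally. intro eps.
assert (Hg' := proj1 (filterlim_locally g 0) Hg eps).
generalize (filter_and _ _ H Hg'). apply filter_imp. intros u [H1 H2].
change (Rabs (g u - 0) < eps) in H2. change (Rabs (f u - 0) < eps).
rewrite Rminus_0_r in *. apply Rabs_lt_between in H2. rewrite Rabs_right; lra.
Qed.

Definition laplace_integrand (alpha t p b : R) (n : nat) (s : R) : R :=
  exp (- (p * s)) * s ^ n * psi alpha t b s.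

(** The integrand is the derivative of
    [e^(-ps) s^n psi_(b+1)(s)], which vanishes at both ends. *)
Lemma laplace_by_parts alpha t p b n : 0 < alpha < 1 -> 0 < t -> 0 < p -> 0 <= b ->
  is_RInt_0_infty (fun s => laplace_integrand alpha t p b n s
     + (INR n * laplace_integrand alpha t p (b + 1) (pred n) s
        + - p * laplace_integrand alpha t p (b + 1) n s)) (0 - 0).
Proof.
intros Ha Ht Hp Hb.
set (F := fun s => laplace_integrand alpha t p (b + 1) n s).
assert (DF : forall c m s, 0 < s -> is_derive (laplace_integrand alpha t p (c + 1) m) s
   (laplace_integrand alpha t p c m s
     + (INR m * laplace_integrand alpha t p (c + 1) (pred m) s
        + - p * laplace_integrand alpha t p (c + 1) m s))).
{ intros c m s Hs.
  assert (D1 : is_derive (fun s => exp (- (p * s)) * s ^ m) s (- p * exp (- (p * s)) * s ^ m + exp (- (p * s)) * (INR m * s ^ pred m))).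
  { auto_derive; [easy|]. ring. }
  evar_last; [exact (is_derive_mult _ _ s _ _ D1 (is_derive_psi alpha t c s Ha Hs) Rmult_comm)|].
  unfold plus, mult, laplace_integrand; simpl. Rring. }
assert (CF : forall c m s, 0 < s -> continuous (laplace_integrand alpha t p c m) s).
{ intros c m s Hs. apply @ex_derive_continuous.
  assert (D := DF (c - 1) m s Hs). replace (c - 1 + 1) with c in D by ring.
  eexists. exact D. }
assert (PF : forall s, 0 < s -> 0 <= F s).
{ intros s Hs. unfold F, laplace_integrand.
  destruct (psi_bounds alpha t (b + 1) s Ha Ht Hs ltac:(lra)) as [Q _].
  apply Rmult_le_pos; [|exact Q]. apply Rmult_le_pos; [left; apply exp_pos|apply pow_le; lra]. }
apply (is_RInt_0_infty_derive F).
- intros s Hs. unfold F. now apply DF.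
- intros s Hs. apply @continuous_plus; [now apply CF|].
  apply @continuous_plus; apply @continuous_scal_r; now apply CF.
- apply filterlim_squeeze_0 with (fun s => rGamma (b + alpha) / (alpha * t) * Rpower s (INR n + (b + alpha))).
  + typeclasses eauto.
  + exists (mkposreal 1 Rlt_0_1). intros s _ Hs. split; [now apply PF|].
    unfold F, laplace_integrand.
    assert (H := psi_small alpha t b s Ha Ht Hs Hb).
    destruct (psi_bounds alpha t (b + 1) s Ha Ht Hs ltac:(lra)) as [Q _].
    rewrite Rpower_plus, Rpower_pow by assumption.
    assert (H1 : exp (- (p * s)) <= 1).
    { rewrite <- exp_0. left. apply exp_increasing. nra. }
    assert (H2 := exp_pos (- (p * s))). assert (H3 : 0 < s ^ n) by now apply pow_lt.
    replace (rGamma (b + alpha) / (alpha * t) * (s ^ n * Rpower s (b + alpha)))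
      with (1 * s ^ n * (rGamma (b + alpha) / (alpha * t) * Rpower s (b + alpha))) by ring.
    apply Rmult_le_compat; [nra|assumption| |assumption].
    apply Rmult_le_compat_r; lra.
  + set (C := rGamma (b + alpha) / (alpha * t)).
    replace 0 with (scal C 0) at 2 by (unfold scal; simpl; unfold mult; simpl; ring).
    apply (filterlim_comp _ _ _ (fun s => Rpower s (INR n + (b + alpha))) (fun v => scal C v) _ (locally 0)).
    * apply Rpower_limit_0. assert (H := pos_INR n). lra.
    * exact (filterlim_scal_r (V := R_NormedModule) C 0).
- apply filterlim_squeeze_0 with (fun s => rGamma (b + 1) * (Rpower s (INR n + b) * exp (- (p * s)))).
  + typeclasses eauto.
  + exists 0. intros s Hs. split; [now apply PF|].
    unfold F, laplace_integrand.
    destruct (psi_bounds alpha t (b + 1) s Ha Ht Hs ltac:(lra)) as [_ Q].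
    replace (b + 1 - 1) with b in Q by ring.
    rewrite Rpower_plus, Rpower_pow by assumption.
    replace (rGamma (b + 1) * (s ^ n * Rpower s b * exp (- (p * s))))
      with (exp (- (p * s)) * s ^ n * (rGamma (b + 1) * Rpower s b)) by ring.
    apply Rmult_le_compat_l; [|assumption].
    apply Rmult_le_pos; [left; apply exp_pos|apply pow_le; lra].
  + replace 0 with (scal (rGamma (b + 1)) 0) at 1 by (unfold scal; simpl; unfold mult; simpl; ring).
    apply (filterlim_comp _ _ _ (fun s => Rpower s (INR n + b) * exp (- (p * s))) (fun v => scal (rGamma (b + 1)) v) _ (locally 0)).
    * now apply power_exp_limit_infty.
    * exact (filterlim_scal_r (V := R_NormedModule) (rGamma (b + 1)) 0).
Qed.

Lemma is_derive_n_wrightR alpha b k x : 0 < alpha < 1 ->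
  is_derive_n (wrightR alpha b) k x ((-1) ^ k * wrightR alpha (b - alpha * INR k) x).
Proof.
intro Ha. revert x; induction k as [|k IH]; intro x.
- simpl. rewrite Rmult_0_r, Rminus_0_r. Rring.
- change (is_derive (Derive_n (wrightR alpha b) k) x ((-1) ^ S k * wrightR alpha (b - alpha * INR (S k)) x)).
  apply is_derive_ext with (fun v => (-1) ^ k * wrightR alpha (b - alpha * INR k) v).
  + intro v. symmetry. apply is_derive_n_unique, IH.
  + evar_last; [apply is_derive_scal, is_derive_wrightR, Ha|].
    rewrite S_INR. cbn [pow]. replace (b - alpha * (INR k + 1)) with (b - alpha * INR k - alpha) by ring.
    Rring.
Qed.

Lemma wrightR_taylor alpha b x N : 0 < alpha < 1 -> 0 < x -> alpha * (INR N + 2) <= b ->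
  Rabs (wrightR alpha b x - sum_f_R0 (fun m => wright_coef alpha b m * x ^ m) N)
  <= rGamma (b - alpha * INR (S N)) * (x ^ S N / INR (fact (S N))).
Proof.
intros Ha Hx Hb.
destruct (Taylor_Lagrange (wrightR alpha b) N 0 x Hx) as [z [Hz E]].
- intros u _ k _. destruct k as [|k]; [exact I|]. eexists.
  exact (is_derive_n_wrightR alpha b (S k) u Ha).
- rewrite (is_derive_n_unique _ _ _ _ (is_derive_n_wrightR alpha b (S N) z Ha)) in E.
  rewrite Rminus_0_r in E.
  replace (sum_f_R0 (fun m => x ^ m / INR (fact m) * Derive_n (wrightR alpha b) m 0) N)
    with (sum_f_R0 (fun m => wright_coef alpha b m * x ^ m) N) in E.
  2:{ apply sum_eq. intros m _.
      rewrite (is_derive_n_unique _ _ _ _ (is_derive_n_wrightR alpha b m 0 Ha)), wrightR_0.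
      unfold wright_coef. field. apply INR_fact_neq_0. }
  rewrite E.
  match goal with |- Rabs (?s + ?r - ?s) <= _ => replace (s + r - s) with r by ring end.
  rewrite !Rabs_mult, pow_1_abs, Rmult_1_l.
  assert (P : 0 <= x ^ S N / INR (fact (S N))).
  { apply Rmult_le_pos; [apply pow_le; lra|]. left. apply Rinv_0_lt_compat, INR_fact_lt_0. }
  assert (HS := S_INR N). assert (HN := pos_INR N).
  assert (B1 := wrightR_nonneg alpha (b - alpha * INR (S N)) z Ha ltac:(nra) ltac:(lra)).
  assert (B2 := wrightR_le alpha (b - alpha * INR (S N)) z Ha ltac:(nra) ltac:(lra)).
  rewrite !Rabs_right by lra. rewrite Rmult_comm. apply Rmult_le_compat_r; lra.
Qed.

Lemma is_RInt_0_infty_sum (f : nat -> R -> R) (l : nat -> R) N :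
  (forall m, (m <= N)%nat -> is_RInt_0_infty (f m) (l m)) ->
  is_RInt_0_infty (fun u => sum_f_R0 (fun m => f m u) N) (sum_f_R0 l N).
Proof.
induction N as [|N IH]; intro H; [now apply H|].
simpl. apply is_RInt_0_infty_plus; [apply IH; intros; apply H; lia|now apply H].
Qed.

Lemma is_RInt_0_infty_abs_le (f g : R -> R) (l m : R) :
  (forall u, 0 < u -> Rabs (f u) <= g u) ->
  is_RInt_0_infty f l -> is_RInt_0_infty g m -> Rabs l <= m.
Proof.
intros H Hf Hg.
apply (RInt_gen_norm (V := R_CompleteNormedModule) (Fa := at_right 0) (Fb := Rbar_locally p_infty) f g l m); [| |exact Hf|exact Hg].
- apply filter_0_infty. exists 1, 1. split; [lra|]. simpl. intros; lra.
- apply filter_0_infty. exists 1, 1. split; [lra|]. simpl. intros a b Ha Hb u Hu. apply H; lra.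
Qed.

(** For large [b] the first terms of the Wright series and the
    remainder of Taylor's formula are all integrable at 0, and their integrals
    are Gamma integrals in which the values of Gamma cancel. *)
Lemma laplace_taylor alpha t p b N l : 0 < alpha < 1 -> 0 < t -> 0 < p ->
  alpha * (INR N + 2) <= b ->
  is_RInt_0_infty (laplace_integrand alpha t p b 0) l ->
  Rabs (Rpower p b * l - sum_f_R0 (fun m => / INR (fact m) * (- (t * Rpower p alpha)) ^ m) N)
  <= (t * Rpower p alpha) ^ S N / INR (fact (S N)).
Proof.
intros Ha Ht Hp Hb Hl.
assert (Term : forall m, (m <= S N)%nat -> forall c,
  is_RInt_0_infty (fun s => c * rGamma (b - alpha * INR m) * t ^ m * (exp (- (p * s)) * Rpower s (b - alpha * INR m - 1)))
   (Rpower p (- b) * (c * (t * Rpower p alpha) ^ m))).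
{ intros m Hm c.
  assert (Hm' : INR m <= INR N + 1) by (rewrite <- S_INR; now apply le_INR).
  assert (Hpos : 0 < b - alpha * INR m) by nra.
  replace (Rpower p (- b) * (c * (t * Rpower p alpha) ^ m)) with
    (c * rGamma (b - alpha * INR m) * t ^ m * (Gamma (b - alpha * INR m) * Rpower p (- (b - alpha * INR m)))).
  - apply is_RInt_0_infty_scal. now apply is_RInt_power_laplace.
  - rewrite rGamma_pos_eq by assumption. rewrite Rpow_mult_distr, <- (Rpower_pow m (Rpower p alpha)) by apply Rpower_pos.
    rewrite Rpower_mult. replace (- (b - alpha * INR m)) with (- b + alpha * INR m) by ring. rewrite Rpower_plus.
    field. apply Rgt_not_eq, Gamma_pos, Hpos. }
assert (Pw : forall m s, 0 < s -> Rpower s (b - alpha * INR m - 1) = Rpower s (b - 1) * Rpower s (- alpha) ^ m).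
{ intros m s Hs. rewrite <- (Rpower_pow m (Rpower s (- alpha))) by apply Rpower_pos.
  rewrite Rpower_mult, <- Rpower_plus. f_equal. ring. }
assert (S1 := is_RInt_0_infty_sum _ _ N (fun m Hm => Term m (le_S _ _ Hm) ((-1) ^ m / INR (fact m)))).
assert (S2 := Term (S N) (le_n _) (/ INR (fact (S N)))).
assert (S3 := is_RInt_0_infty_plus _ _ _ _ Hl (is_RInt_0_infty_scal _ (-1) _ S1)).
assert (PB := Rpower_pos p b).
assert (PP : Rpower p b * Rpower p (- b) = 1) by (rewrite <- Rpower_plus, Rplus_opp_r, Rpower_O; lra).
assert (Bd : Rabs (l + -1 * sum_f_R0 (fun m => Rpower p (- b) * ((-1) ^ m / INR (fact m) * (t * Rpower p alpha) ^ m)) N)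
   <= Rpower p (- b) * (/ INR (fact (S N)) * (t * Rpower p alpha) ^ S N)).
{ refine (is_RInt_0_infty_abs_le _ _ _ _ _ S3 S2).
  intros s Hs. cbv beta. unfold laplace_integrand, psi. rewrite pow_O, Rmult_1_r.
  assert (Hx : 0 < t * Rpower s (- alpha)) by (apply Rmult_lt_0_compat; [lra|apply Rpower_pos]).
  assert (W := wrightR_taylor alpha b _ N Ha Hx Hb).
  replace (sum_f_R0 _ N) with (exp (- (p * s)) * Rpower s (b - 1) *
     sum_f_R0 (fun m => wright_coef alpha b m * (t * Rpower s (- alpha)) ^ m) N).
  2:{ rewrite scal_sum. apply sum_eq. intros m _. rewrite Pw by assumption. unfold wright_coef.
      rewrite Rpow_mult_distr. field. apply INR_fact_neq_0. }
  rewrite (Pw (S N)) by assumption.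
  assert (Q : 0 < exp (- (p * s)) * Rpower s (b - 1)) by (apply Rmult_lt_0_compat; apply exp_pos).
  match goal with |- Rabs ?v <= _ => replace v with (exp (- (p * s)) * Rpower s (b - 1) *
    (wrightR alpha b (t * Rpower s (- alpha)) - sum_f_R0 (fun m => wright_coef alpha b m * (t * Rpower s (- alpha)) ^ m) N)) by ring end.
  rewrite Rabs_mult, (Rabs_right (exp _ * _)) by lra.
  eapply Rle_trans; [apply Rmult_le_compat_l; [lra|exact W]|]. right.
  rewrite Rpow_mult_distr. field. apply INR_fact_neq_0. }
replace (Rpower p b * l - _) with (Rpower p b *
  (l + -1 * sum_f_R0 (fun m => Rpower p (- b) * ((-1) ^ m / INR (fact m) * (t * Rpower p alpha) ^ m)) N)).
- rewrite Rabs_mult, (Rabs_right (Rpower p b)) by lra.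
  replace ((t * Rpower p alpha) ^ S N / INR (fact (S N))) with
    (Rpower p b * (Rpower p (- b) * (/ INR (fact (S N)) * (t * Rpower p alpha) ^ S N))).
  + apply Rmult_le_compat_l; lra.
  + rewrite <- Rmult_assoc, PP. field. apply INR_fact_neq_0.
- rewrite Rmult_plus_distr_l. unfold Rminus. f_equal.
  replace (sum_f_R0 (fun m => Rpower p (- b) * _) N) with
   (Rpower p (- b) * sum_f_R0 (fun m => / INR (fact m) * (- (t * Rpower p alpha)) ^ m) N).
  + replace (Rpower p b * (-1 * (Rpower p (- b) * sum_f_R0 (fun m => / INR (fact m) * (- (t * Rpower p alpha)) ^ m) N)))
     with (- (Rpower p b * Rpower p (- b)) * sum_f_R0 (fun m => / INR (fact m) * (- (t * Rpower p alpha)) ^ m) N) by ring.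
    rewrite PP. ring.
  + rewrite scal_sum. apply sum_eq. intros m _.
    replace (- (t * Rpower p alpha)) with (-1 * (t * Rpower p alpha)) by ring. rewrite (Rpow_mult_distr (-1)).
    field. apply INR_fact_neq_0.
Qed.

Lemma laplace_exists alpha t p b : 0 < alpha < 1 -> 0 < t -> 0 < p -> alpha <= b ->
  exists l, is_RInt_0_infty (laplace_integrand alpha t p b 0) l.
Proof.
intros Ha Ht Hp Hb.
apply dominated_is_RInt_0_infty with (fun s => rGamma b * (exp (- (p * s)) * Rpower s (b - 1))) (rGamma b * (Gamma b * Rpower p (- b))).
- intros s Hs. apply @ex_derive_continuous.
  eexists. unfold laplace_integrand.
  apply (is_derive_mult (fun s => exp (- (p * s)) * s ^ 0) (psi alpha t b) s (- p * exp (- (p * s))) (psi alpha t (b - 1) s)).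
  + auto_derive; [easy|]. Rring.
  + replace b with (b - 1 + 1) at 1 by ring. now apply is_derive_psi.
  + exact Rmult_comm.
- intros s Hs. apply @ex_derive_continuous. unfold Rpower. auto_derive. repeat split; lra.
- intros s Hs. unfold laplace_integrand. rewrite pow_O, Rmult_1_r.
  destruct (psi_bounds alpha t b s Ha Ht Hs Hb) as [Q1 Q2]. assert (P := exp_pos (- (p * s))).
  split; [apply Rmult_le_pos; lra|].
  replace (rGamma b * (exp (- (p * s)) * Rpower s (b - 1))) with (exp (- (p * s)) * (rGamma b * Rpower s (b - 1))) by ring.
  apply Rmult_le_compat_l; lra.
- apply is_RInt_0_infty_scal. apply is_RInt_power_laplace; lra.
Qed.

Lemma laplace_shift alpha t p b n l l' : 0 < alpha < 1 -> 0 < t -> 0 < p -> 0 <= b ->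
  is_RInt_0_infty (laplace_integrand alpha t p (b + 1) n) l ->
  is_RInt_0_infty (fun s => INR n * laplace_integrand alpha t p (b + 1) (pred n) s) l' ->
  is_RInt_0_infty (laplace_integrand alpha t p b n) (p * l - l').
Proof.
intros Ha Ht Hp Hb Hl Hl'.
assert (J := is_RInt_0_infty_plus _ _ _ _ (laplace_by_parts alpha t p b n Ha Ht Hp Hb)
  (is_RInt_0_infty_plus _ _ _ _ (is_RInt_0_infty_scal _ p _ Hl) (is_RInt_0_infty_scal _ (-1) _ Hl'))).
replace (p * l - l') with (0 - 0 + (p * l + -1 * l')) by ring.
apply is_RInt_0_infty_ext with (2 := J). intros s Hs. ring.
Qed.

Lemma is_RInt_0_infty_zero : is_RInt_0_infty (fun _ => 0) 0.
Proof.
assert (H : is_RInt_0_infty (fun _ => 0) (0 - 0)); [|now rewrite Rminus_diag in H].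
apply (is_RInt_0_infty_derive (fun _ => 0)).
- intros. apply @is_derive_const.
- intros. apply continuous_const.
- apply filterlim_const.
- apply filterlim_const.
Qed.

(** The normalised transform [p^b L_b] is the same at [b] and
    [b + K]. *)
Lemma laplace_shift_n alpha t p b K : 0 < alpha < 1 -> 0 < t -> 0 < p -> 1 <= b ->
  exists l, is_RInt_0_infty (laplace_integrand alpha t p b 0) (Rpower p (- b) * l) /\
    is_RInt_0_infty (laplace_integrand alpha t p (b + INR K) 0) (Rpower p (- (b + INR K)) * l).
Proof.
intros Ha Ht Hp Hb.
assert (HK := pos_INR K).
destruct (laplace_exists alpha t p (b + INR K) Ha Ht Hp ltac:(lra)) as [l Hl].
exists (Rpower p (b + INR K) * l).
assert (E : Rpower p (- (b + INR K)) * (Rpower p (b + INR K) * l) = l).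
{ rewrite <- Rmult_assoc, <- Rpower_plus, Rplus_opp_l, Rpower_O by assumption. ring. }
rewrite E. split; [|exact Hl]. clear E. revert l Hl. induction K as [|K IH]; intros l Hl.
- simpl in *. rewrite Rplus_0_r in *. rewrite <- Rmult_assoc, <- Rpower_plus, Rplus_opp_l, Rpower_O by assumption.
  now rewrite Rmult_1_l.
- assert (HK' := pos_INR K). rewrite S_INR in *.
  replace (Rpower p (b + (INR K + 1)) * l) with (Rpower p (b + INR K) * (p * l)).
  + apply IH; [assumption|]. replace (p * l) with (p * l - 0) by ring.
    apply laplace_shift; try assumption; [lra| |].
    * now replace (b + INR K + 1) with (b + (INR K + 1)) by ring.
    * apply is_RInt_0_infty_ext with (2 := is_RInt_0_infty_zero). intros s Hs. simpl. ring.
  + replace (b + (INR K + 1)) with (b + INR K + 1) by ring. rewrite (Rpower_plus (b + INR K) 1), Rpower_1 by assumption. ring.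
Qed.

(** By [laplace_shift_n] the estimate of [laplace_taylor] may be used at
    [b + N + 2] for every [N], and its error is a term of a convergent
    exponential series. *)
Lemma laplace_value alpha t p b : 0 < alpha < 1 -> 0 < t -> 0 < p -> 1 <= b ->
  is_RInt_0_infty (laplace_integrand alpha t p b 0) (Rpower p (- b) * exp (- (t * Rpower p alpha))).
Proof.
intros Ha Ht Hp Hb.
set (v := t * Rpower p alpha).
destruct (laplace_shift_n alpha t p b 0 Ha Ht Hp Hb) as [l [Hl _]].
replace (exp (- v)) with l; [exact Hl|].
assert (Bd : forall N, Rabs (l - sum_f_R0 (fun m => / INR (fact m) * (- v) ^ m) N) <= v ^ S N / INR (fact (S N))).
{ intro N. (* [b + N + 2] exceeds [alpha (N + 2)], as the Taylor estimate requires. *)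
  destruct (laplace_shift_n alpha t p b (N + 2) Ha Ht Hp Hb) as [l' [H1 H2]].
  assert (E : l' = l).
  { apply Rmult_eq_reg_l with (Rpower p (- b)); [|apply Rgt_not_eq, Rpower_pos].
    exact (is_RInt_0_infty_unique _ _ _ H1 Hl). }
  subst l'.
  assert (HN := pos_INR N).
  assert (T := laplace_taylor alpha t p (b + INR (N + 2)) N _ Ha Ht Hp ltac:(rewrite plus_INR; simpl; nra) H2).
  rewrite <- Rmult_assoc, <- Rpower_plus, Rplus_opp_r, Rpower_O, Rmult_1_l in T by assumption. exact T. }
assert (L1 : is_lim_seq (fun N => sum_f_R0 (fun m => / INR (fact m) * (- v) ^ m) N) (exp (- v))).
{ apply is_lim_seq_ext with (sum_n (fun m => scal (pow_n (- v) m) (/ INR (fact m)))).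
  - intro N. rewrite sum_n_Reals. apply sum_eq. intros m _. rewrite pow_n_pow.
    unfold scal; simpl; unfold mult; simpl. ring.
  - exact (is_exp_Reals (- v)). }
assert (L2 : is_lim_seq (fun N => v ^ S N / INR (fact (S N))) 0).
{ apply (is_lim_seq_incr_1 (fun N => v ^ N / INR (fact N))).
  apply ex_series_lim_0. exists (exp v).
  apply is_series_Rext with (2 := is_exp_Reals v). intro m. rewrite pow_n_pow.
  unfold scal; simpl; unfold mult; simpl. reflexivity. }
assert (L3 : is_lim_seq (fun N => l - sum_f_R0 (fun m => / INR (fact m) * (- v) ^ m) N) 0).
{ apply is_lim_seq_abs_0. apply is_lim_seq_le_le with (3 := L2) (u := fun _ => 0); [|apply is_lim_seq_const].
  intro N. split; [apply Rabs_pos|apply Bd]. }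
assert (L4 := is_lim_seq_minus' _ _ _ _ (is_lim_seq_const l) L1).
assert (E := is_lim_seq_unique _ _ L3). rewrite (is_lim_seq_unique _ _ L4) in E.
injection E. lra.
Qed.

(** Multiplying by [s] follows [psi_times] on the left, and
    [dwrightR_exp_raise] on the right. *)
Lemma laplace_value_n alpha h t b n : 0 < alpha < 1 -> 0 < h -> 0 < t -> 1 <= b ->
  is_RInt_0_infty (laplace_integrand alpha t (/ h) b n)
    (INR (fact n) * (Rpower h (INR n + b) * (exp (- (t / h)) * dwrightR_exp alpha (Rpower h (1 - alpha)) (t / h) b n))).
Proof.
intros Ha Hh Ht. assert (Hp : 0 < / h) by now apply Rinv_0_lt_compat.
assert (Ey : Rpower h (1 - alpha) = h * Rpower h (- alpha)) by (unfold Rminus; now rewrite Rpower_plus, Rpower_1).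
revert b. induction n as [|n IH]; intros b Hb.
- replace (_ * _) with (Rpower (/ h) (- b) * exp (- (t * Rpower (/ h) alpha))).
  + now apply laplace_value.
  + rewrite dwrightR_exp_0, <- exp_plus.
    replace (Rpower (/ h) (- b)) with (Rpower h b).
    2:{ unfold Rpower. rewrite ln_Rinv by assumption. f_equal. ring. }
    replace (Rpower (/ h) alpha) with (Rpower h (- alpha)).
    2:{ unfold Rpower. rewrite ln_Rinv by assumption. f_equal. ring. }
    rewrite Ey. cbn [fact INR]. rewrite Rmult_1_l, Rplus_0_l. f_equal. f_equal. field. lra.
- assert (H1 := IH (b + 1) ltac:(lra)). assert (H2 := IH (b + 1 - alpha) ltac:(lra)).
  assert (J := is_RInt_0_infty_plus _ _ _ _ (is_RInt_0_infty_scal _ b _ H1) (is_RInt_0_infty_scal _ (alpha * t) _ H2)).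
  match type of J with is_RInt_gen _ _ _ ?v => replace (INR (fact (S n)) * _) with v end.
  + apply is_RInt_0_infty_ext with (2 := J). intros s Hs. unfold laplace_integrand. cbn [pow].
    assert (E := psi_times alpha t b s Ha Hs).
    replace (exp (- (/ h * s)) * (s * s ^ n) * psi alpha t b s) with (exp (- (/ h * s)) * s ^ n * (s * psi alpha t b s)) by ring.
    rewrite E. ring.
  + set (y := Rpower h (1 - alpha)) in *. set (x := t / h) in *.
    rewrite fact_simpl, mult_INR.
    replace (INR (S n) * INR (fact n) * (Rpower h (INR (S n) + b) * (exp (- x) * dwrightR_exp alpha y x b (S n))))
      with (INR (fact n) * (Rpower h (INR (S n) + b) * (exp (- x) * (INR (S n) * dwrightR_exp alpha y x b (S n))))) by ring.
    rewrite dwrightR_exp_raise.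
    replace (INR n + (b + 1)) with (INR (S n) + b) by (rewrite S_INR; ring).
    replace (INR n + (b + 1 - alpha)) with (INR (S n) + b + - alpha) by (rewrite S_INR; ring).
    rewrite (Rpower_plus (INR (S n) + b) (- alpha)).
    replace (alpha * y * (x * dwrightR_exp alpha y x (b + 1 - alpha) n))
      with (alpha * t * Rpower h (- alpha) * dwrightR_exp alpha y x (b + 1 - alpha) n).
    * ring.
    * rewrite Ey. unfold x. field. lra.
Qed.

(** One integration by parts lowers [b] by one; on the right
    this is [dwrightR_exp_telescope]. *)
Lemma laplace_value_n_nonneg alpha h t b n : 0 < alpha < 1 -> 0 < h -> 0 < t -> 0 <= b ->
  is_RInt_0_infty (laplace_integrand alpha t (/ h) b n)
    (INR (fact n) * (Rpower h (INR n + b) * (exp (- (t / h)) * dwrightR_exp alpha (Rpower h (1 - alpha)) (t / h) b n))).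
Proof.
intros Ha Hh Ht Hb. assert (Hp : 0 < / h) by now apply Rinv_0_lt_compat.
set (y := Rpower h (1 - alpha)). set (x := t / h).
assert (H1 := laplace_value_n alpha h t (b + 1) n Ha Hh Ht ltac:(lra)).
assert (HP : Rpower h (INR n + (b + 1)) = h * Rpower h (INR n + b)).
{ rewrite <- Rplus_assoc, Rpower_plus, Rpower_1 by assumption. ring. }
destruct n as [|n].
- assert (J := laplace_shift alpha t (/ h) b 0 _ 0 Ha Ht Hp Hb H1).
  match type of J with _ -> is_RInt_gen _ _ _ ?v => replace (INR (fact 0) * _) with v end.
  + apply J. apply is_RInt_0_infty_ext with (2 := is_RInt_0_infty_zero). intros; simpl; ring.
  + rewrite HP, !dwrightR_exp_0. fold x y. field. lra.
- assert (H2 := laplace_value_n alpha h t (b + 1) n Ha Hh Ht ltac:(lra)).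
  assert (J := laplace_shift alpha t (/ h) b (S n) _ _ Ha Ht Hp Hb H1 (is_RInt_0_infty_scal _ (INR (S n)) _ H2)).
  match type of J with is_RInt_gen _ _ _ ?v => replace (INR (fact (S n)) * _) with v end; [exact J|].
  fold x y. rewrite HP, dwrightR_exp_telescope, fact_simpl, mult_INR.
  replace (INR n + (b + 1)) with (INR (S n) + b) by (rewrite S_INR; ring).
  field. lra.
Qed.

(** * Complex series *)

Notation is_Cseries a l := (is_series (K := C_AbsRing) (V := C_NormedModule) a l).

Lemma is_Cseries_components (a : nat -> C) (l : C) :
  is_Cseries a l <->
  is_series (fun i => fst (a i)) (fst l) /\ is_series (fun i => snd (a i)) (snd l).
Proof.
assert (S1 : forall n, fst (sum_n (G := C_AbelianMonoid) a n) = sum_n (fun i => fst (a i)) n).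
{ induction n as [|n IH]; [now rewrite !sum_O|]. rewrite sum_n_CS, sum_n_RS, <- IH. reflexivity. }
assert (S2 : forall n, snd (sum_n (G := C_AbelianMonoid) a n) = sum_n (fun i => snd (a i)) n).
{ induction n as [|n IH]; [now rewrite !sum_O|]. rewrite sum_n_CS, sum_n_RS, <- IH. reflexivity. }
split.
- intro H. assert (H' := proj1 (filterlim_locally _ _) H). split; apply filterlim_locally; intro eps.
  + generalize (H' eps). apply filter_imp. intros n [B _]. rewrite <- S1. exact B.
  + generalize (H' eps). apply filter_imp. intros n [_ B]. rewrite <- S2. exact B.
- intros [H1 H2]. apply filterlim_locally. intro eps.
  generalize (filter_and _ _ (proj1 (filterlim_locally _ _) H1 eps) (proj1 (filterlim_locally _ _) H2 eps)).
  apply filter_imp. intros n [B1 B2]. rewrite <- S1 in B1. rewrite <- S2 in B2. split; assumption.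
Qed.

Lemma is_Cseries_CSeries (a : nat -> C) (l : C) : is_Cseries a l -> CSeries a = l.
Proof.
intro H. apply is_Cseries_components in H. destruct H as [H1 H2].
unfold CSeries. destruct l as [x v]. f_equal; apply is_series_unique; assumption.
Qed.

Lemma is_Cseries_RtoC (a : nat -> R) (l : R) :
  is_series a l -> is_Cseries (fun i => RtoC (a i)) (RtoC l).
Proof.
intro H. apply is_Cseries_components. split; [exact H|]. simpl.
apply is_series_shift; [reflexivity|]. 
apply (filterlim_ext (fun _ => 0)).
- intro n. rewrite sum_n_const. ring.
- apply filterlim_const.
Qed.

Lemma is_Cseries_ext (a b : nat -> C) (l : C) :
  (forall i, a i = b i) -> is_Cseries a l -> is_Cseries b l.
Proof. exact (is_series_ext a b l). Qed.

Lemma is_Cseries_plus (a b : nat -> C) (l m : C) :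
  is_Cseries a l -> is_Cseries b m -> is_Cseries (fun i => a i + b i)%C (l + m)%C.
Proof. exact (is_series_plus a b l m). Qed.

Lemma is_Cseries_scal (c : C) (a : nat -> C) (l : C) :
  is_Cseries a l -> is_Cseries (fun i => c * a i)%C (c * l)%C.
Proof. exact (is_series_scal c a l). Qed.

(** * Summation over n *)

(** [k^b(n)] is asymptotic to [n^(b-1)/Gamma(b)]. *)
Lemma cesaroR_lim_0 b : b < 1 -> is_lim_seq (cesaroR b) 0.
Proof.
intro Hb.
assert (L := is_lim_seq_mult' _ _ _ _ (Gamma_ratio_lim 1 (1 - b) ltac:(lra)) (Rpower_lim_0 1 (- (1 - b)) ltac:(lra))).
rewrite Rmult_0_r in L. apply (is_lim_seq_scal_l _ (rGamma b)) in L. simpl Rbar_mult in L. rewrite Rmult_0_r in L.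
apply is_lim_seq_ext_loc with (2 := L).
destruct (INR_unbounded (- b)) as [N HN]. exists N. intros n Hn. apply le_INR in Hn.
assert (HX : 0 < INR n + 1) by (assert (H := pos_INR n); lra).
assert (E := cesaroR_Gamma b n ltac:(lra)).
replace (INR n + 1 - (1 - b)) with (INR n + b) by ring.
apply Rmult_eq_reg_r with (INR (fact n)); [|apply INR_fact_neq_0].
rewrite E, <- (Gamma_fact n), S_INR.
assert (PP : Rpower (INR n + 1) (1 - b) * Rpower (INR n + 1) (- (1 - b)) = 1) by (rewrite <- Rpower_plus, Rplus_opp_r, Rpower_O; lra).
transitivity (rGamma b * Gamma (INR n + b) * (Rpower (INR n + 1) (1 - b) * Rpower (INR n + 1) (- (1 - b)))).
- field. apply Rgt_not_eq, Gamma_pos, HX.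
- rewrite PP. ring.
Qed.

Lemma dwrightR_lim_0 alpha y b j : 0 < alpha -> b < 1 -> is_lim_seq (dwrightR alpha y b j) 0.
Proof.
intros Ha. revert b. induction j as [|j IH]; intros b Hb.
- now apply cesaroR_lim_0.
- cbn [dwrightR]. replace (Finite 0) with (Finite (0 - y * 0)) by (f_equal; ring).
  apply is_lim_seq_minus'; [now apply IH|].
  apply (is_lim_seq_scal_l _ y 0). apply IH. lra.
Qed.

Lemma dwrightR_lim_1 alpha y j : 0 < alpha -> is_lim_seq (dwrightR alpha y 1 j) 1.
Proof.
intros Ha. induction j as [|j IH].
- apply is_lim_seq_ext with (fun _ => 1); [|apply is_lim_seq_const]. intro n. symmetry. apply cesaroR_1.
- cbn [dwrightR]. replace (Finite 1) with (Finite (1 - y * 0)) by (f_equal; ring).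
  apply is_lim_seq_minus'; [exact IH|].
  apply (is_lim_seq_scal_l _ y 0). apply dwrightR_lim_0; lra.
Qed.

Lemma is_series_dwrightR_total alpha y j : 0 < alpha -> is_series (fun i => dwrightR alpha y 0 j i) 1.
Proof.
intro Ha.
assert (H : is_lim_seq (sum_n (fun i => dwrightR alpha y 0 j i)) 1); [|exact H].
apply is_lim_seq_ext with (dwrightR alpha y 1 j); [|now apply dwrightR_lim_1].
intro n. symmetry. apply dwrightR_partial_sum.
Qed.

(** * The binomial series *)

Lemma binomial_series b z0 r d :
  Cmod z0 = 1 -> 0 <= r <= 1 -> 0 < d <= 1 ->
  (forall u, 0 <= u <= r -> d <= 1 - u * fst z0) ->
  is_lim_seq (fun J => Rabs (cesaroR b J) * r ^ J) 0 ->
  is_Cseries (fun j => RtoC (cesaroR b j) * (RtoC r * z0) ^ j)%C (Cpower (1 - RtoC r * z0) (- b)).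
Proof.
intros Hz Hr Hd Hx HL.
set (L := ln 2 - ln d).
set (A := exp (Rabs b * L) * (2 * exp (Rabs (b - 1) * L))).
apply filterlim_locally. intro eps.
assert (Lim : is_lim_seq (fun J => A * (Rabs (cesaroR b (S J)) * r ^ S J)) 0).
{ replace (Finite 0) with (Rbar_mult A 0) by (simpl; f_equal; ring).
  apply is_lim_seq_scal_l, (is_lim_seq_incr_1 (fun J => Rabs (cesaroR b J) * r ^ J)), HL. }
apply is_lim_seq_spec in Lim. destruct (Lim eps) as [N HN]. exists N. intros J HJ.
specialize (HN J HJ). rewrite Rminus_0_r in HN. apply Rabs_lt_between in HN.
assert (B := binomial_partial_error b z0 r d J Hz Hr Hd Hx).
cbv zeta in B. fold L A in B.
set (D := (binomial_partial b J (RtoC r * z0) - Cpower (1 - RtoC r * z0) (- b))%C) in B.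
split.
- change (Rabs (fst D) < eps). eapply Rle_lt_trans; [apply fst_le_Cmod|lra].
- change (Rabs (snd D) < eps). eapply Rle_lt_trans; [apply snd_le_Cmod|lra].
Qed.

Lemma Cpower_RtoC x a : 0 < x -> Cpower (RtoC x) a = RtoC (Rpower x a).
Proof.
intro Hx. unfold RtoC at 1. rewrite Cpower_right_half by assumption.
replace (0 / x) with 0 by (field; lra).
replace (x * x + 0 * 0) with (x * x) by ring. rewrite ln_mult by assumption.
rewrite atan_0, Rmult_0_r, cos_0, sin_0.
unfold RtoC, Rpower. f_equal; [|ring].
replace (a * ((ln x + ln x) / 2)) with (a * ln x) by field. ring.
Qed.

Lemma binomial_series_real b q : -1 <= q < 1 ->
  is_lim_seq (fun J => Rabs (cesaroR b J) * Rabs q ^ J) 0 ->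
  is_series (fun j => cesaroR b j * q ^ j) (Rpower (1 - q) (- b)).
Proof.
intros Hq HL.
(* The ray to [q] goes through [1] or [-1], according to the sign of [q]. *)
assert (G : forall z0 : R, Rabs z0 = 1 -> Rabs q * z0 = q ->
  is_series (fun j => cesaroR b j * q ^ j) (Rpower (1 - q) (- b))).
{ intros z0 Hz E.
  assert (H := binomial_series b (RtoC z0) (Rabs q) (Rmin 1 (1 - q))).
  rewrite <- RtoC_mult, E, <- RtoC_minus, Cpower_RtoC in H by lra.
  assert (H' := proj1 (is_Cseries_components _ _) (H ltac:(now rewrite Cmod_R)
    ltac:(split; [apply Rabs_pos|apply Rabs_le; lra])
    ltac:(split; [apply Rmin_pos; lra|apply Rmin_l]) ltac:(
      intros u Hu; cbn [fst RtoC];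
      destruct (Rle_lt_dec 0 z0) as [Hz0|Hz0];
      [rewrite (Rabs_right z0) in Hz by lra; eapply Rle_trans; [apply Rmin_r|]; nra
      |eapply Rle_trans; [apply Rmin_l|]; nra]) HL)).
  destruct H' as [H1 _]. apply is_series_Rext with (2 := H1). intro j.
  rewrite <- RtoC_pow. simpl. ring. }
destruct (Rle_lt_dec 0 q) as [H|H].
- apply (G 1); [apply Rabs_R1|rewrite Rabs_right; lra].
- apply (G (-1)); [rewrite Rabs_left; lra|rewrite Rabs_left; lra].
Qed.

(** * Summation over j *)

(** In terms of generating functions, the sum is
    [(1-z)^(-b)] times [(1 - (1 - y (1-z)^alpha))^(-g)]. *)
Lemma is_series_dwrightR_cesaro alpha y b g n : 0 < y < 2 -> 
  is_series (fun i => dwrightR alpha y b i n * cesaroR g i)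
    (Rpower y (- g) * cesaroR (b + g * alpha) n).
Proof.
intro Hy. revert b g. induction n as [|n IH]; intros b g.
- cbn [cesaroR]. rewrite Rmult_1_r. replace (Rpower y (- g)) with (Rpower (1 - (1 - y)) (- g)) by (f_equal; ring).
  apply is_series_Rext with (fun j => cesaroR g j * (1 - y) ^ j).
  + intro j. rewrite dwrightR_at_0. ring.
  + apply binomial_series_real; [lra|]. apply cesaroR_geom_lim.
    split; [apply Rabs_pos|apply Rabs_lt_between; lra].
- assert (HS : INR (S n) <> 0) by (apply not_0_INR; lia).
  assert (Hs : is_series (fun i => INR i * cesaroR g i * dwrightR alpha y (b + 1 - alpha) (pred i) n)
     (g * (Rpower y (- (g + 1)) * cesaroR (b + 1 - alpha + (g + 1) * alpha) n))).
  { apply is_series_shift; [simpl; unfold zero; simpl; Rring|].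
    apply is_series_Rext with (2 := is_series_Rscal g _ _ (IH (b + 1 - alpha) (g + 1))).
    intro i. cbn [pred]. rewrite cesaroR_raise. ring. }
  assert (J := is_series_Rscal (/ INR (S n)) _ _ (is_series_Rplus _ _ _ _
    (is_series_Rscal b _ _ (IH (b + 1) g)) (is_series_Rscal (alpha * y) _ _ Hs))).
  match type of J with is_series _ ?v => replace (Rpower y (- g) * _) with v end.
  + apply is_series_Rext with (2 := J). intro i. cbv beta.
    apply Rmult_eq_reg_l with (INR (S n)); [|exact HS].
    rewrite <- Rmult_assoc, Rinv_r, Rmult_1_l by exact HS.
    rewrite <- (Rmult_assoc (INR (S n))), dwrightR_raise. ring.
  + apply Rmult_eq_reg_l with (INR (S n)); [|exact HS].
    rewrite <- Rmult_assoc, Rinv_r, Rmult_1_l by exact HS.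
    replace (INR (S n) * (Rpower y (- g) * cesaroR (b + g * alpha) (S n)))
      with (Rpower y (- g) * (INR (S n) * cesaroR (b + g * alpha) (S n))) by ring.
    rewrite cesaroR_raise.
    replace (b + 1 - alpha + (g + 1) * alpha) with (b + g * alpha + 1) by ring.
    replace (b + 1 + g * alpha) with (b + g * alpha + 1) by ring.
    replace (- (g + 1)) with (- g + - (1)) by ring.
    rewrite Rpower_plus, (Rpower_Ropp y 1), Rpower_1 by lra. field. lra.
Qed.

(** For [y = 2] and [n = 0] this is the binomial series
    at the boundary point [-1]. *)
Lemma is_series_dwrightR_cesaro_edge alpha b g : g < 1 ->
  is_series (fun i => dwrightR alpha 2 b i 0 * cesaroR g i) (Rpower 2 (- g)).
Proof.
intros Hg. replace (Rpower 2 (- g)) with (Rpower (1 - (1 - 2)) (- g)) by (f_equal; ring).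
apply is_series_Rext with (fun j => cesaroR g j * (1 - 2) ^ j).
- intro j. rewrite dwrightR_at_0. ring.
- apply binomial_series_real; [lra|].
  apply is_lim_seq_ext with (fun J => Rabs (cesaroR g J)).
  + intro J. replace (Rabs (1 - 2)) with 1 by (rewrite Rabs_left; lra). rewrite pow1. ring.
  + exact (proj1 (is_lim_seq_abs_0 _) (cesaroR_lim_0 g Hg)).
Qed.

Lemma Cpower_1_right_half x v : 0 < x -> Cpower (x, v) 1 = (x, v).
Proof.
intro Hx. rewrite Cpower_right_half by assumption. rewrite !Rmult_1_l, cos_atan, sin_atan.
assert (H : 0 < x * x + v * v) by nra.
assert (E1 : exp (ln (x * x + v * v) / 2) = sqrt (x * x + v * v)).
{ rewrite <- (exp_ln (sqrt (x * x + v * v))) by now apply sqrt_lt_R0. f_equal.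
  rewrite <- (sqrt_sqrt (x * x + v * v)) at 1 by lra.
  rewrite ln_mult by now apply sqrt_lt_R0. lra. }
assert (E2 : sqrt (1 + (v / x)²) = sqrt (x * x + v * v) / x).
{ replace (1 + (v / x)²) with ((x * x + v * v) / (x * x)) by (unfold Rsqr; field; lra).
  rewrite sqrt_div_alt by nra. f_equal. apply sqrt_square; lra. }
assert (S0 := sqrt_lt_R0 _ H).
rewrite E1, E2. f_equal; field; lra.
Qed.

Lemma Cpower_opp_INR w g : 0 < Re w -> Cpower w (- INR g) = (/ w ^ g)%C.
Proof.
intro Hw. assert (E1 : Cpower w 1 = w) by (destruct w; now apply Cpower_1_right_half).
assert (E : Cpower w (INR g) = (w ^ g)%C).
{ induction g as [|g IH]; [apply Cpower_0|].
  rewrite S_INR, Cpower_plus, IH, E1, Cpow_S. ring. }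
now rewrite <- Cpower_inv, E.
Qed.

Lemma binomial_series_INR (w : C) g : Cmod w < 1 ->
  is_Cseries (fun j => RtoC (cesaroR (INR g) j) * w ^ j)%C (/ (1 - w) ^ g)%C.
Proof.
intro Hw.
assert (Hre : Rabs (fst w) < 1) by (eapply Rle_lt_trans; [apply fst_le_Cmod|exact Hw]).
apply Rabs_lt_between in Hre.
assert (Hz : exists z0, Cmod z0 = 1 /\ w = (RtoC (Cmod w) * z0)%C).
{ destruct (Req_dec (Cmod w) 0) as [E|N].
  - exists (RtoC 1). split; [apply Cmod_1|]. rewrite E. apply Cmod_eq_0 in E. rewrite E. ring.
  - assert (NC : RtoC (Cmod w) <> RtoC 0) by (intro E; apply RtoC_inj in E; contradiction).
    exists (w / RtoC (Cmod w))%C. split.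
    + rewrite Cmod_div by assumption. rewrite Cmod_R, Rabs_right by (apply Rle_ge, Cmod_ge_0). field. assumption.
    + field. assumption. }
destruct Hz as [z0 [Hz E]].
rewrite <- Cpower_opp_INR by (simpl; lra).
assert (H0 := Cmod_ge_0 w).
assert (F := fst_le_Cmod z0). rewrite Hz in F. apply Rabs_le_between in F.
rewrite E. apply (binomial_series (INR g) z0 (Cmod w) (1 - Cmod w)); try assumption; try lra.
- intros u Hu. nra.
- apply cesaroR_geom_lim. lra.
Qed.

(** The [n]-th Taylor coefficient of
    [(1-z)^(-b) (y (1-z)^alpha - nu)^(-g)], as a function of the value
    [s = y - nu] of the second base at [z = 0].  Both series below are expansions
    of this function, in powers of [1 - y (1-z)^alpha] and of [nu]. *)
Fixpoint resolvent_value (alpha y : R) (s : C) (n : nat) (b : R) (g : nat) : C :=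
  match n with
  | O => (/ s ^ g)%C
  | S m => (RtoC (/ INR (S m)) * (RtoC b * resolvent_value alpha y s m (b + 1) g
             + RtoC (alpha * y * INR g) * resolvent_value alpha y s m (b + 1 - alpha) (S g)))%C
  end.

(** Expansion in powers of [1 - y (1-z)^alpha], where
    [mu = 1 - nu].  Only [g = 1] is wanted, but differentiating in [z] raises
    [g]. *)
Lemma resolvent_dwrightR_series alpha y (mu : C) n b g :
  mu <> RtoC 0 -> Rabs (1 - y) < Cmod mu ->
  is_Cseries (fun j => RtoC (cesaroR (INR g) j * dwrightR alpha y b j n) * / mu ^ (j + g))%C
    (resolvent_value alpha y (mu - RtoC (1 - y)) n b g).
Proof.
intros Hmu Hq. revert b g; induction n as [|n IH]; intros b g.
- assert (Hm := Cmod_gt_0 mu). 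
  assert (Hw : Cmod (RtoC (1 - y) / mu)%C < 1).
  { rewrite Cmod_div, Cmod_R by assumption. apply Rmult_lt_reg_r with (Cmod mu); [apply Hm, Hmu|].
    unfold Rdiv. rewrite Rmult_assoc, Rinv_l, Rmult_1_r, Rmult_1_l; [assumption|]. apply Rgt_not_eq, Hm, Hmu. }
  assert (Hs : (mu - RtoC (1 - y))%C <> RtoC 0).
  { intro E. assert (E' : mu = RtoC (1 - y)) by (rewrite <- (Cplus_0_r (RtoC (1 - y))), <- E; ring).
    rewrite E', Cmod_R in Hq. lra. }
  assert (B := is_Cseries_scal (/ mu ^ g)%C _ _ (binomial_series_INR _ g Hw)).
  replace (resolvent_value _ _ _ 0 b g) with (/ mu ^ g * / (1 - RtoC (1 - y) / mu) ^ g)%C.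
  + apply is_Cseries_ext with (2 := B). intro j. rewrite dwrightR_at_0, RtoC_mult, RtoC_pow, Cpow_add_r.
    unfold Cdiv. rewrite Cpow_mult_l, Cpow_inv by assumption.
    field. split; now apply Cpow_nz.
  + cbn [resolvent_value]. rewrite <- !Cpow_inv, <- Cpow_mult_l; try assumption.
    * f_equal. field. split; assumption.
    * intro E. apply Hs. replace (mu - RtoC (1 - y))%C with (mu * (1 - RtoC (1 - y) / mu))%C by (field; assumption).
      rewrite E. ring.
- assert (HS : INR (S n) <> 0) by (apply not_0_INR; lia).
  assert (Sh : is_Cseries (fun j => RtoC (INR j * cesaroR (INR g) j * dwrightR alpha y (b + 1 - alpha) (pred j) n) * / mu ^ (j + g))%C
     (RtoC (INR g) * resolvent_value alpha y (mu - RtoC (1 - y)) n (b + 1 - alpha) (S g))%C).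
  { apply is_series_shift.
    - simpl (INR 0). rewrite !Rmult_0_l. apply Cmult_0_l.
    - apply is_Cseries_ext with (2 := is_Cseries_scal (RtoC (INR g)) _ _ (IH (b + 1 - alpha) (S g))).
      intro j. cbn [pred]. rewrite cesaroR_raise, S_INR.
      replace (S j + g)%nat with (j + S g)%nat by lia. rewrite !RtoC_mult. ring. }
  cbn [resolvent_value].
  assert (J := is_Cseries_scal (RtoC (/ INR (S n))) _ _ (is_Cseries_plus _ _ _ _
    (is_Cseries_scal (RtoC b) _ _ (IH (b + 1) g)) (is_Cseries_scal (RtoC (alpha * y)) _ _ Sh))).
  rewrite (RtoC_mult (alpha * y)), <- Cmult_assoc.
  apply is_Cseries_ext with (2 := J). intro j. cbv beta.
  rewrite !Cmult_assoc, <- Cmult_plus_distr_r, Cmult_assoc, <- !RtoC_mult, <- RtoC_plus, <- RtoC_mult.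
  f_equal. f_equal.
  apply Rmult_eq_reg_l with (INR (S n)); [|exact HS].
  rewrite <- Rmult_assoc, Rinv_r, Rmult_1_l by exact HS.
  replace (INR (S n) * (cesaroR (INR g) j * dwrightR alpha y b j (S n))) with (cesaroR (INR g) j * (INR (S n) * dwrightR alpha y b j (S n))) by ring.
  rewrite dwrightR_raise. ring.
Qed.

(** Expansion in powers of [nu]; the coefficients
    are those of a Mittag-Leffler sequence up to powers of [h]. *)
Lemma resolvent_mittag_leffler_series alpha y (nu : C) n b g :
  0 < y -> Cmod nu < y ->
  is_Cseries (fun i => RtoC (cesaroR (INR g) i * cesaroR (b + alpha * INR (g + i)) n * / y ^ (g + i)) * nu ^ i)%C
    (resolvent_value alpha y (RtoC y - nu) n b g).
Proof.
intros Hy Hnu. revert b g; induction n as [|n IH]; intros b g.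
- assert (HyC : RtoC y <> RtoC 0) by (intro E; apply RtoC_inj in E; lra).
  assert (Hw : Cmod (nu / RtoC y)%C < 1).
  { rewrite Cmod_div, Cmod_R, (Rabs_right y) by (assumption || lra). apply Rmult_lt_reg_r with y; [assumption|].
    unfold Rdiv. rewrite Rmult_assoc, Rinv_l; lra. }
  assert (Hs : (RtoC y - nu)%C <> RtoC 0).
  { intro E. assert (E' : nu = RtoC y) by (rewrite <- (Cplus_0_r nu), <- E; ring).
    rewrite E', Cmod_R, Rabs_right in Hnu; lra. }
  assert (B := is_Cseries_scal (/ RtoC y ^ g)%C _ _ (binomial_series_INR _ g Hw)).
  replace (resolvent_value _ _ _ 0 b g) with (/ RtoC y ^ g * / (1 - nu / RtoC y) ^ g)%C.
  + apply is_Cseries_ext with (2 := B). intro j. cbn [cesaroR].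
    rewrite Rmult_1_r, RtoC_mult, RtoC_inv, RtoC_pow, Cpow_add_r by (apply pow_nonzero; lra).
    unfold Cdiv. rewrite Cpow_mult_l, Cpow_inv by assumption.
    field. split; now apply Cpow_nz.
  + cbn [resolvent_value]. rewrite <- !Cpow_inv, <- Cpow_mult_l; try assumption.
    * f_equal. field. split; assumption.
    * intro E. apply Hs. replace (RtoC y - nu)%C with (RtoC y * (1 - nu / RtoC y))%C by (field; assumption).
      rewrite E. ring.
- assert (HS : INR (S n) <> 0) by (apply not_0_INR; lia).
  cbn [resolvent_value].
  assert (J := is_Cseries_scal (RtoC (/ INR (S n))) _ _ (is_Cseries_plus _ _ _ _
    (is_Cseries_scal (RtoC b) _ _ (IH (b + 1) g))
    (is_Cseries_scal (RtoC (alpha * y * INR g)) _ _ (IH (b + 1 - alpha) (S g))))).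
  apply is_Cseries_ext with (2 := J). intro i. cbv beta.
  rewrite !Cmult_assoc, <- Cmult_plus_distr_r, Cmult_assoc, <- !RtoC_mult, <- RtoC_plus, <- RtoC_mult.
  f_equal. f_equal.
  replace (b + 1 - alpha + alpha * INR (S g + i)) with (b + alpha * INR (g + i) + 1)
    by (cbn [Nat.add]; rewrite S_INR; ring).
  replace (b + 1 + alpha * INR (g + i)) with (b + alpha * INR (g + i) + 1) by ring.
  apply Rmult_eq_reg_l with (INR (S n)); [|exact HS].
  rewrite <- Rmult_assoc, Rinv_r, Rmult_1_l by exact HS.
  replace (INR (S n) * (cesaroR (INR g) i * cesaroR (b + alpha * INR (g + i)) (S n) * / y ^ (g + i)))
    with (cesaroR (INR g) i * (INR (S n) * cesaroR (b + alpha * INR (g + i)) (S n)) * / y ^ (g + i)) by ring.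
  rewrite cesaroR_raise.
  assert (E : INR g * cesaroR (INR (S g)) i = (INR g + INR i) * cesaroR (INR g) i).
  { rewrite S_INR, <- cesaroR_raise, cesaroR_succ. ring. }
  replace (alpha * y * INR g * (cesaroR (INR (S g)) i * cesaroR (b + alpha * INR (g + i) + 1) n * / y ^ (S g + i)))
    with (alpha * (INR g * cesaroR (INR (S g)) i) * cesaroR (b + alpha * INR (g + i) + 1) n * / y ^ (g + i)).
  + rewrite E, plus_INR. ring.
  + cbn [Nat.add pow]. field. split; [|lra]. apply pow_nonzero; lra.
Qed.

(** * The theorem *)

Lemma sum_n_C_real (a : nat -> C) (b : nat -> R) n :
  (forall i, (i <= n)%nat -> a i = RtoC (b i)) ->
  sum_n (G := C_AbelianMonoid) a n = RtoC (sum_n b n).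
Proof.
intro H. rewrite <- sum_n_RtoC. now apply (sum_n_ext_loc (G := C_AbelianMonoid)).
Qed.

Lemma is_RInt_gen_RtoC (f : R -> R) (l : R) :
  is_RInt_0_infty f l ->
  is_RInt_gen (V := C_R_NormedModule) (fun s => RtoC (f s)) (at_right 0) (Rbar_locally p_infty) (RtoC l).
Proof.
intros Hf P [eps HP].
assert (L : locally l (fun v : R => P (RtoC v))).
{ exists eps. intros v Hv. apply HP. split; [exact Hv|apply ball_center]. }
assert (H := Hf _ L). unfold filtermapi in H |- *.
revert H. apply filter_imp. intros ab [v [Hv1 Hv2]].
exists (RtoC v). split; [|exact Hv2].
apply (is_RInt_fct_extend_pair (U := R_NormedModule) (V := R_NormedModule)); [exact Hv1|].
cbn [RtoC snd]. evar_last; [apply @is_RInt_const|].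
unfold scal; simpl; unfold mult; simpl. Rring.
Qed.

Lemma scaled_wright_eq alpha b t s : 0 < alpha < 1 ->
  scaled_wright alpha b s (RtoC t) = RtoC (psi alpha t b s).
Proof.
intro Ha. unfold scaled_wright, psi. rewrite RtoC_mult. f_equal. unfold wright.
apply is_Cseries_CSeries.
set (x := t * Rpower s (- alpha)).
apply is_Cseries_ext with (fun m => RtoC (wright_coef alpha b m * x ^ m)).
- intro m. rewrite <- RtoC_opp, <- RtoC_mult, <- RtoC_pow, <- RtoC_div, <- RtoC_mult by apply INR_fact_neq_0.
  f_equal. unfold wright_coef.
  replace (- t * Rpower s (- alpha)) with (-1 * x) by (unfold x; ring). rewrite Rpow_mult_distr.
  replace (- alpha * INR m + b) with (b - alpha * INR m) by ring. field. apply INR_fact_neq_0.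
- apply is_Cseries_RtoC. apply is_series_Rext with (2 := PSeries_correct _ _ (ex_pseries_wright alpha b x Ha)).
  intro m. rewrite pow_n_pow. unfold scal; simpl; unfold mult; simpl. Rring.
Qed.

Theorem proposition4p3 (alpha beta h r : R) (n j : nat) :
  0 < alpha < 1 -> 0 <= beta -> 0 < h -> 0 < r < 1 ->
  (* (i) *)
  (dwright r h alpha beta n j =
     RtoC (Rpower h beta) *
     sum_n (G := C_AbelianMonoid)
       (fun i => RtoC (Binomial.C j i) * RtoC ((-1) ^ i) *
                 RtoC (Rpower h (INR i - alpha * INR i)) *
                 cesaro (RtoC (beta - alpha * INR i)) n) j)%C
  /\
  (* (ii) *)
  (forall gamma : R, 0 < gamma ->
     (dwright r h alpha (beta + gamma) n j =
        RtoC (Rpower h beta) *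
        sum_n (G := C_AbelianMonoid)
          (fun i => cesaro (RtoC beta) (n - i) * dwright r h alpha gamma i j) n)%C)
  /\
  (* (iii) *)
  ((1 <= n)%nat -> forall t : R, 0 < t ->
     exists I T : C,
       is_RInt_gen (V := C_R_NormedModule)
         (fun s : R => (RtoC (exp (- s / h) * s ^ (n - 1)) *
                        scaled_wright alpha beta s (RtoC t))%C)
         (at_right 0) (Rbar_locally p_infty) I
       /\
       is_series (K := C_AbsRing) (V := C_NormedModule)
         (fun i => let j := (i + 1)%nat in
            (dwright r h alpha beta (n - 1) (j - 1) *
             RtoC (t ^ (j - 1) / (h ^ j * INR (fact (j - 1)))))%C) T
       /\
       (RtoC (1 / (h ^ n * Gamma (INR n))) * I = RtoC (exp (- t / h)) * T)%C)
  /\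
  (* (iv) *)
  ((1 <= n)%nat -> forall lambda : C,
     Cmod lambda < 1 / Rpower h alpha ->
     Rabs (1 - Rpower h (1 - alpha)) < Cmod (RtoC 1 - RtoC h * lambda)%C ->
     is_series (K := C_AbsRing) (V := C_NormedModule)
       (fun i => let j := (i + 1)%nat in
          (dwright r h alpha beta (n - 1) (j - 1) * RtoC (1 / h ^ j) *
           / (RtoC (1 / h) - lambda) ^ j)%C)
       (RtoC (1 / h) * mittag_leffler h alpha (alpha + beta) lambda n)%C)
  /\
  (* (v) *)
  (dwright r h alpha beta n j - dwright r h alpha beta n (j + 1) =
     RtoC h * dwright r h alpha (beta - alpha) n j)%C
  /\
  (* (vi) *)
  (dwright r h alpha 0 n (j + 1) =
     sum_n (G := C_AbelianMonoid)
       (fun p => dwright r h alpha 0 (n - p) j * dwright r h alpha 0 p 1)%C n)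
  /\
  (* (vii) *)
  (h <= 1 ->
     Im (dwright r h alpha beta n j) = 0 /\ 0 <= Re (dwright r h alpha beta n j))
  /\
  (* (viii) *)
  is_series (K := C_AbsRing) (V := C_NormedModule)
    (fun i => dwright r h alpha 0 i j) (RtoC 1)
  /\
  (* (ix) *)
  (forall gamma : R, 0 < gamma ->
     (Rpower h (1 - alpha) < 2 \/
      (Rpower h (1 - alpha) = 2 /\ n = 0%nat /\ gamma < 1)) ->
     is_series (K := C_AbsRing) (V := C_NormedModule)
       (fun i => dwright r h alpha beta n i * cesaro (RtoC gamma) i)%C
       (RtoC (Rpower h (beta + gamma * (alpha - 1))) *
        cesaro (RtoC (beta + gamma * alpha)) n)%C).
Proof.
intros Ha Hb Hh Hr.
set (y := Rpower h (1 - alpha)).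
assert (Ey : y = h * Rpower h (- alpha)) by (unfold y, Rminus; now rewrite Rpower_plus, Rpower_1).
assert (Hy : 0 < y) by apply Rpower_pos.
assert (W : forall b m i, dwright r h alpha b m i = RtoC (Rpower h b * dwrightR alpha y b i m))
  by (intros; now apply dwright_eq).
assert (HhC : RtoC h <> RtoC 0) by (intro E; apply RtoC_inj in E; lra).
repeat apply conj.
- rewrite W, (sum_n_C_real _ (fun i => Binomial.C j i * (- y) ^ i * cesaroR (beta - alpha * INR i) n)).
  + now rewrite RtoC_mult, dwrightR_binomial.
  + intros i _. rewrite cesaro_RtoC, <- !RtoC_mult. f_equal.
    replace (- y) with (-1 * y) by ring. rewrite Rpow_mult_distr.
    replace (Rpower h (INR i - alpha * INR i)) with (y ^ i); [ring|].
    unfold y. rewrite <- Rpower_pow, Rpower_mult by apply Rpower_pos. f_equal. ring.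
- intros gamma _.
  rewrite W, (sum_n_C_real _ (fun i => Rpower h gamma * (cesaroR beta (n - i) * dwrightR alpha y gamma j i))).
  + rewrite sum_n_Rscal, Rpower_plus, dwrightR_vandermonde, <- RtoC_mult. f_equal. ring.
  + intros i _. rewrite W, cesaro_RtoC, <- RtoC_mult. f_equal. ring.
- destruct n as [|m]; [lia|]. intros _ t Ht. rewrite Nat.sub_succ, Nat.sub_0_r.
  exists (RtoC (INR (fact m) * (Rpower h (INR m + beta) * (exp (- (t / h)) * dwrightR_exp alpha y (t / h) beta m)))),
         (RtoC (Rpower h beta * / h * dwrightR_exp alpha y (t / h) beta m)).
  split; [|split].
  + apply (is_RInt_gen_ext (V := C_R_NormedModule) (fun s => RtoC (laplace_integrand alpha t (/ h) beta m s))).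
    * apply filter_0_infty. exists 1, 1. split; [lra|]. intros a b Hab Hb' s Hs.
      rewrite scaled_wright_eq, <- RtoC_mult by assumption. f_equal. unfold laplace_integrand.
      f_equal. f_equal. f_equal. field. lra.
    * apply is_RInt_gen_RtoC. now apply laplace_value_n_nonneg.
  + apply is_Cseries_ext with (fun i => RtoC (Rpower h beta * / h * dwrightR_exp_term alpha y (t / h) beta m i)).
    * intro i. cbv zeta. rewrite Nat.add_sub, W, <- RtoC_mult. f_equal.
      unfold dwrightR_exp_term. rewrite Nat.add_1_r. cbn [pow]. unfold Rdiv. rewrite Rpow_mult_distr, pow_inv.
      field. repeat split; try lra; try apply INR_fact_neq_0. apply pow_nonzero; lra.
    * apply is_Cseries_RtoC, is_series_Rscal, is_series_dwrightR_exp.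
  + rewrite <- !RtoC_mult. f_equal. rewrite Gamma_fact, Rpower_plus, Rpower_pow by assumption. cbn [pow].
    replace (- t / h) with (- (t / h)) by (field; lra).
    field. repeat split; try lra; try apply INR_fact_neq_0. apply pow_nonzero; lra.
- destruct n as [|m]; [lia|]. intros _ lambda Hl Hq. rewrite Nat.sub_succ, Nat.sub_0_r.
  set (mu := (RtoC 1 - RtoC h * lambda)%C) in *.
  assert (Hmu : mu <> RtoC 0).
  { intro E. rewrite E, Cmod_0 in Hq. assert (H := Rabs_pos (1 - y)). fold y in Hq. lra. }
  assert (Hnu : Cmod (RtoC h * lambda)%C < y).
  { rewrite Cmod_mult, Cmod_R, (Rabs_right h), Ey by lra. apply Rmult_lt_compat_l; [assumption|].
    rewrite Rpower_Ropp. unfold Rdiv in Hl. now rewrite Rmult_1_l in Hl. }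
  assert (L := resolvent_dwrightR_series alpha y mu m beta 1 Hmu Hq).
  assert (M := resolvent_mittag_leffler_series alpha y (RtoC h * lambda)%C m beta 1 Hy Hnu).
  replace (mu - RtoC (1 - y))%C with (RtoC y - RtoC h * lambda)%C in L
    by (unfold mu; rewrite RtoC_minus; ring).
  set (V := resolvent_value _ _ _ _ _ _) in L, M.
  replace (RtoC (1 / h) * mittag_leffler h alpha (alpha + beta) lambda (S m))%C with (RtoC (Rpower h beta) * V)%C.
  + apply is_Cseries_ext with (2 := is_Cseries_scal (RtoC (Rpower h beta)) _ _ L).
    intro i. cbv beta zeta. rewrite Nat.add_sub, W.
    replace (mu ^ (i + 1))%C with (RtoC h ^ (i + 1) * (RtoC (1 / h) - lambda) ^ (i + 1))%C.
    2:{ rewrite <- Cpow_mult_l. f_equal. unfold mu. rewrite RtoC_div by lra. field. assumption. }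
    change (INR 1) with 1. rewrite cesaroR_1, Rmult_1_l.
    rewrite (RtoC_mult (Rpower h beta)), (RtoC_div 1 (h ^ (i + 1))) by (apply pow_nonzero; lra). rewrite (RtoC_pow h).
    assert (Nl : (RtoC (1 / h) - lambda)%C <> RtoC 0).
    { intro E. apply Hmu. replace mu with (RtoC h * (RtoC (1 / h) - lambda))%C.
      - rewrite E. ring.
      - unfold mu. rewrite RtoC_div by lra. field. assumption. }
    assert (N1 := Cpow_nz _ (i + 1) HhC). assert (N2 := Cpow_nz _ (i + 1) Nl).
    field. repeat split; assumption.
  + assert (M' : is_Cseries (fun i => RtoC (Rpower h (alpha * INR i + (alpha + beta))) *
         cesaro (RtoC (alpha * INR i + (alpha + beta))) (S m - 1) * lambda ^ i)%C (RtoC h * (RtoC (Rpower h beta) * V))%C).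
    { apply is_Cseries_ext with (2 := is_Cseries_scal (RtoC h) _ _ (is_Cseries_scal (RtoC (Rpower h beta)) _ _ M)).
      intro i. cbv beta. rewrite Nat.sub_succ, Nat.sub_0_r, cesaro_RtoC.
      change (INR 1) with 1. rewrite cesaroR_1, Rmult_1_l, Cpow_mult_l, <- (RtoC_pow h).
      cbn [Nat.add]. rewrite S_INR.
      replace (beta + alpha * (INR i + 1)) with (alpha * INR i + (alpha + beta)) by ring.
      rewrite !Cmult_assoc, <- !RtoC_mult. f_equal. f_equal.
      replace (Rpower h (alpha * INR i + (alpha + beta))) with
        (h * Rpower h beta * / y ^ S i * h ^ i).
      - ring.
      - rewrite Ey, Rpow_mult_distr, <- (Rpower_pow (S i) (Rpower h (- alpha))), Rpower_mult by apply Rpower_pos.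
        replace (alpha * INR i + (alpha + beta)) with (beta + - (- alpha * INR (S i))) by (rewrite S_INR; ring).
        rewrite Rpower_plus, (Rpower_Ropp h (- alpha * INR (S i))). cbn [pow].
        field. repeat split; try lra; try (apply pow_nonzero; lra). apply Rgt_not_eq, Rpower_pos. }
    unfold mittag_leffler. rewrite (is_Cseries_CSeries _ _ M'), RtoC_div by lra. field. assumption.
- rewrite Nat.add_1_r, !W, <- RtoC_minus, <- RtoC_mult. f_equal. cbn [dwrightR].
  replace (Rpower h (beta - alpha)) with (Rpower h beta * Rpower h (- alpha))
    by (rewrite <- Rpower_plus; reflexivity).
  rewrite Ey. ring.
- rewrite W, Nat.add_1_r, dwrightR_convolution, sum_n_Rrev, Rpower_O, Rmult_1_l by assumption.
  symmetry. apply sum_n_C_real. intros i Hi.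
  rewrite !W, Rpower_O, !Rmult_1_l, <- RtoC_mult by assumption.
  replace (n - (n - i))%nat with i by lia. f_equal. ring.
- intro Hh1. assert (Hy1 : y <= 1).
  { unfold y. apply Rle_trans with (Rpower h 0); [unfold Rpower|rewrite Rpower_O; lra].
    assert (Hln : ln h <= 0) by (rewrite <- ln_1; apply ln_le; lra).
    destruct (Req_dec (ln h) 0) as [->|N]; [rewrite !Rmult_0_r; lra|].
    left. apply exp_increasing. nra. }
  intros. rewrite W. split; [reflexivity|]. simpl.
  apply Rmult_le_pos; [left; apply Rpower_pos|]. apply dwrightR_nonneg; lra.
- apply is_Cseries_ext with (fun i => RtoC (dwrightR alpha y 0 j i)).
  + intro i. now rewrite W, Rpower_O, Rmult_1_l.
  + apply is_Cseries_RtoC, is_series_dwrightR_total. lra.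
- intros gamma Hg Hc. rewrite cesaro_RtoC, <- RtoC_mult.
  apply is_Cseries_ext with (fun i => RtoC (Rpower h beta * (dwrightR alpha y beta i n * cesaroR gamma i))).
  + intro i. rewrite W, cesaro_RtoC, <- RtoC_mult. f_equal. ring.
  + apply is_Cseries_RtoC.
    replace (Rpower h (beta + gamma * (alpha - 1)) * cesaroR (beta + gamma * alpha) n)
      with (Rpower h beta * (Rpower y (- gamma) * cesaroR (beta + gamma * alpha) n)).
    * apply is_series_Rscal. fold y in Hc. destruct Hc as [Hc|[Hc [-> Hg1]]].
      -- apply is_series_dwrightR_cesaro. lra.
      -- rewrite Hc. cbn [cesaroR]. rewrite Rmult_1_r. now apply is_series_dwrightR_cesaro_edge.
    * rewrite <- Rmult_assoc. f_equal. unfold y. rewrite Rpower_mult, <- Rpower_plus. f_equal. ring.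
Qed.
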